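(* The Baire category theorem can be derived in $\mathsf{RCA}_0$ extended by either of the following: (i) the principle of $\Sigma^0_2$-induction along $\mathbb N$; (ii) the $\Pi^0_1$-genericity principle $\Pi^0_1\mathsf G$.
   Context: $\mathsf{RCA}_0$ is the usual base system of second-order arithmetic (basic arithmetic axioms, $\Sigma^0_1$-induction, $\Delta^0_1$-comprehension). Reals. A real is a Cauchy sequence $x=(x_n)_{n\in\mathbb N}$ of rationals with no rate of convergence given: for each rational $\varepsilon>0$ there is an $N\in\mathbb N$ with $|x_m-x_n|<\varepsilon$ for all $m,n\geq N$. For reals $x,y$: $x\leq y$ means that for each rational $\varepsilon>0$ there is an $N$ with $x_n\leq y_n+\varepsilon$ for all $n\geq N$; $x=y$ means $x\leq y$ and $y\leq x$; $x<y$ means $x\leq y$ but not $x=y$. Addition, multiplication and absolute value are defined pointwise; rationals are identified with constant sequences. Put $B_\delta(y)=\{z\in\mathbb R:|y-z|<\delta\}$. Open sets. A code for an open set is a set $U\subseteq\mathbb N\times\mathbb Q\times\mathbb Q_{>0}$. For a real $x$, write $x\in U$ if there are $N\in\mathbb N$ and $(a,r)\in\mathbb Q\times\mathbb Q_{>0}$ such that $x\in B_r(a)$ and $(n,a,r)\in U$ for all $n\geq N$. A family of open sets is a family of codes (coded as a single set). A subset of $\mathbb R$ is dense if it intersects every non-empty open set. Baire category theorem: $\bigcap_{i\in\mathbb N}U_i$ is dense for any family $(U_i)_{i\in\mathbb N}$ of dense open sets $U_i\subseteq\mathbb R$. $\Pi^0_1\mathsf G$: for $\sigma,\tau\in 2^{<\omega}$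 write $\sigma\sqsubseteq\tau$ if $\tau$ extends $\sigma$. For any set $X\subseteq\mathbb N$ put $\mathcal D_i=\{\sigma\in 2^{<\omega}:(\sigma,i,n)\in X\text{ for all }n\in\mathbb N\}$. The principle says: if each $\mathcal D_i$ is dense (any $\sigma\in 2^{<\omega}$ admits a $\tau\in\mathcal D_i$ with $\sigma\sqsubseteq\tau$), then there is a set $G\subseteq\mathbb N$ such that each $i\in\mathbb N$ admits a $k\in\mathbb N$ with $G[k]\in\mathcal D_i$, where $G[k]=\langle\chi_G(0),\ldots,\chi_G(k-1)\rangle$ for the characteristic function $\chi_G$ of $G$. *)

(* Defs.v *)
From Stdlib Require Import List Arith.

(** The two-sorted first-order language of second-order arithmetic: number
    terms, and set variables.  Both sorts of variables are de Bruijn indices, counted separately.  Equality is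
    primitive on numbers only; sets are compared extensionally. *)

Inductive term : Type :=
| tvar (n : nat)
| tzero
| tone
| tadd (t u : term)
| tmul (t u : term).

Inductive form : Type :=
| Eq (t u : term)
| Lt (t u : term)
| Mem (t : term) (X : nat)
| Bot
| Imp (p q : form)
| All1 (p : form)
| All2 (p : form).

Definition Neg p := Imp p Bot.
Definition And p q := Neg (Imp p (Neg q)).
Definition Or p q := Imp (Neg p) q.
Definition Iff p q := And (Imp p q) (Imp q p).
Definition Ex1 p := Neg (All1 (Neg p)).
Definition Ex2 p := Neg (All2 (Neg p)).

Fixpoint tsubst (s : nat -> term) (t : term) : term :=
  match t with
  | tvar n => s n
  | tzero => tzero
  | tone => tone
  | tadd t u => tadd (tsubst s t) (tsubst s u)
  | tmul t u => tmul (tsubst s t) (tsubst s u)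
  end.

Definition tshift : term -> term := tsubst (fun n => tvar (S n)).

Definition up1 (s : nat -> term) (n : nat) : term :=
  match n with 0 => tvar 0 | S k => tshift (s k) end.

Definition up2 (r : nat -> nat) (n : nat) : nat :=
  match n with 0 => 0 | S k => S (r k) end.

Fixpoint fsubst (s : nat -> term) (r : nat -> nat) (p : form) : form :=
  match p with
  | Eq t u => Eq (tsubst s t) (tsubst s u)
  | Lt t u => Lt (tsubst s t) (tsubst s u)
  | Mem t X => Mem (tsubst s t) (r X)
  | Bot => Bot
  | Imp p q => Imp (fsubst s r p) (fsubst s r q)
  | All1 p => All1 (fsubst (up1 s) r p)
  | All2 p => All2 (fsubst s (up2 r) p)
  end.

Definition fshift1 : form -> form := fsubst (fun n => tvar (S n)) (fun X => X).
Definition fshift2 : form -> form := fsubst tvar S.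

Definition inst1 (t : term) : form -> form :=
  fsubst (fun n => match n with 0 => t | S k => tvar k end) (fun X => X).
Definition inst2 (Y : nat) : form -> form :=
  fsubst tvar (fun X => match X with 0 => Y | S k => k end).

(** [prf T G p]: [p] is derivable from the axioms [T] and the assumptions [G].
    The free variables of an axiom (unlike those of an assumption) may be
    generalized: an axiom stands for its universal closure. *)
Inductive prf (T : form -> Prop) : list form -> form -> Prop :=
| prf_ax G p : T p -> prf T G p
| prf_hyp G p : In p G -> prf T G p
| prf_impI G p q : prf T (p :: G) q -> prf T G (Imp p q)
| prf_impE G p q : prf T G (Imp p q) -> prf T G p -> prf T G q
| prf_raa G p : prf T (Neg p :: G) Bot -> prf T G p
| prf_all1I G p : prf T (map fshift1 G) p -> prf T G (All1 p)
| prf_all1E G p t : prf T G (All1 p) -> prf T G (inst1 t p)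
| prf_all2I G p : prf T (map fshift2 G) p -> prf T G (All2 p)
| prf_all2E G p Y : prf T G (All2 p) -> prf T G (inst2 Y p)
| prf_eqI G t : prf T G (Eq t t)
| prf_eqE G p t u :
    prf T G (Eq t u) -> prf T G (inst1 t p) -> prf T G (inst1 u p).

Definition derivable (T : form -> Prop) (p : form) : Prop := prf T nil p.

Definition extend (T T' : form -> Prop) (p : form) : Prop := T p \/ T' p.

(** Formulas all of whose quantifiers are bounded number quantifiers; the
    bound does not contain the bound variable.  Bounded existential
    quantifiers are covered, as negated universal ones. *)
Inductive bounded : form -> Prop :=
| bd_eq t u : bounded (Eq t u)
| bd_lt t u : bounded (Lt t u)
| bd_mem t X : bounded (Mem t X)
| bd_bot : bounded Bot
| bd_imp p q : bounded p -> bounded q -> bounded (Imp p q)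
| bd_all t p : bounded p -> bounded (All1 (Imp (Lt (tvar 0) (tshift t)) p)).

Inductive Sigma01 : form -> Prop :=
| Sigma01_intro p : bounded p -> Sigma01 (Ex1 p).

Inductive Pi01 : form -> Prop :=
| Pi01_intro p : bounded p -> Pi01 (All1 p).

Inductive Sigma02 : form -> Prop :=
| Sigma02_intro p : Pi01 p -> Sigma02 (Ex1 p).

Inductive basic_axiom : form -> Prop :=
| ax_succ_ne0 : basic_axiom (Neg (Eq (tadd (tvar 0) tone) tzero))
| ax_succ_inj : basic_axiom
    (Imp (Eq (tadd (tvar 0) tone) (tadd (tvar 1) tone)) (Eq (tvar 0) (tvar 1)))
| ax_add0 : basic_axiom (Eq (tadd (tvar 0) tzero) (tvar 0))
| ax_addS : basic_axiom
    (Eq (tadd (tvar 0) (tadd (tvar 1) tone))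
        (tadd (tadd (tvar 0) (tvar 1)) tone))
| ax_mul0 : basic_axiom (Eq (tmul (tvar 0) tzero) tzero)
| ax_mulS : basic_axiom
    (Eq (tmul (tvar 0) (tadd (tvar 1) tone))
        (tadd (tmul (tvar 0) (tvar 1)) (tvar 0)))
| ax_lt0 : basic_axiom (Neg (Lt (tvar 0) tzero))
| ax_ltS : basic_axiom
    (Iff (Lt (tvar 0) (tadd (tvar 1) tone))
         (Or (Lt (tvar 0) (tvar 1)) (Eq (tvar 0) (tvar 1)))).

(** Induction for [p] in its variable 0; the other variables are parameters. *)
Definition induction_for (p : form) : form :=
  let p_succ :=
    fsubst (fun n => match n with
                     | 0 => tadd (tvar 0) tone
                     | S k => tvar (S k)
                     end) (fun X => X) p in
  Imp (inst1 tzero p) (Imp (All1 (Imp p p_succ)) (All1 p)).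

Inductive induction_scheme (C : form -> Prop) : form -> Prop :=
| induction_scheme_intro p : C p -> induction_scheme C (induction_for p).

Inductive delta01_comprehension : form -> Prop :=
| delta01_comprehension_intro p q :
    Sigma01 p -> Pi01 q ->
    delta01_comprehension
      (Imp (All1 (Iff p q)) (Ex2 (All1 (Iff (Mem (tvar 0) 0) (fshift2 p))))).

Inductive RCA0 : form -> Prop :=
| RCA0_basic p : basic_axiom p -> RCA0 p
| RCA0_induction p : induction_scheme Sigma01 p -> RCA0 p
| RCA0_comprehension p : delta01_comprehension p -> RCA0 p.

Definition ISigma02 : form -> Prop := induction_scheme Sigma02.

(** A [tm], [sv] or [fm] is a term, set variable or formula as a function of
    the number of enclosing binders (number binders, set binders, both).  A
    binder names its variable by its level, which [\all], [\ex], [\ALL], [\EX]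
    turn into the index appropriate to each place of occurrence. *)

Definition tm := nat -> term.
Definition sv := nat -> nat.
Definition fm := nat -> nat -> form.

Definition level1 (d : nat) : tm := fun d' => tvar (d' - S d).
Definition level2 (e : nat) : sv := fun e' => e' - S e.

Definition fall1 (P : tm -> fm) : fm :=
  fun d e => All1 (P (level1 d) (S d) e).
Definition fex1 (P : tm -> fm) : fm :=
  fun d e => Ex1 (P (level1 d) (S d) e).
Definition fall2 (P : sv -> fm) : fm :=
  fun d e => All2 (P (level2 e) d (S e)).
Definition fex2 (P : sv -> fm) : fm :=
  fun d e => Ex2 (P (level2 e) d (S e)).

Definition feq (t u : tm) : fm := fun d _ => Eq (t d) (u d).
Definition flt (t u : tm) : fm := fun d _ => Lt (t d) (u d).
Definition fmem (t : tm) (X : sv) : fm := fun d e => Mem (t d) (X e).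
Definition fimp (p q : fm) : fm := fun d e => Imp (p d e) (q d e).
Definition fneg (p : fm) : fm := fun d e => Neg (p d e).
Definition fand (p q : fm) : fm := fun d e => And (p d e) (q d e).
Definition for_ (p q : fm) : fm := fun d e => Or (p d e) (q d e).
Definition fiff (p q : fm) : fm := fun d e => Iff (p d e) (q d e).
Definition zero : tm := fun _ => tzero.
Definition one : tm := fun _ => tone.
Definition add (t u : tm) : tm := fun d => tadd (t d) (u d).
Definition mul (t u : tm) : tm := fun d => tmul (t d) (u d).

Definition sentence (p : fm) : form := p 0 0.

Declare Scope tm_scope.
Delimit Scope tm_scope with tm.
Bind Scope tm_scope with tm.
Notation "t + u" := (add t u) : tm_scope.
Notation "t * u" := (mul t u) : tm_scope.
Notation "0" := zero : tm_scope.
Notation "1" := one : tm_scope.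

Declare Scope fm_scope.
Delimit Scope fm_scope with fm.
Bind Scope fm_scope with fm.
Notation "t == u" := (feq t%tm u%tm) (at level 70) : fm_scope.
Notation "t < u" := (flt t%tm u%tm) : fm_scope.
Notation "t <= u" := (for_ (flt t%tm u%tm) (feq t%tm u%tm)) : fm_scope.
Notation "t \in X" := (fmem t%tm X) (at level 70) : fm_scope.
Notation "p -> q" := (fimp p%fm q%fm) : fm_scope.
Notation "~ p" := (fneg p%fm) : fm_scope.
Notation "p /\ q" := (fand p%fm q%fm) : fm_scope.
Notation "p \/ q" := (for_ p%fm q%fm) : fm_scope.
Notation "p <-> q" := (fiff p%fm q%fm) : fm_scope.
Notation "\all x .. y , P" := (fall1 (fun x => .. (fall1 (fun y => P%fm)) ..))
  (at level 200, x binder, y binder) : fm_scope.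
Notation "\ex x .. y , P" := (fex1 (fun x => .. (fex1 (fun y => P%fm)) ..))
  (at level 200, x binder, y binder) : fm_scope.
Notation "\ALL x .. y , P" := (fall2 (fun x => .. (fall2 (fun y => P%fm)) ..))
  (at level 200, x binder, y binder) : fm_scope.
Notation "\EX x .. y , P" := (fex2 (fun x => .. (fex2 (fun y => P%fm)) ..))
  (at level 200, x binder, y binder) : fm_scope.

Local Open Scope fm_scope.

(** Injective: [(t + u)^2] is the largest square below the code. *)
Definition pair (t u : tm) : tm := ((t + u) * (t + u) + t)%tm.
Definition triple (t u v : tm) : tm := pair t (pair u v).

(** Finite sets are coded by divisibility: [triple k m n] stands for the set of
    all [i < k] such that [m (i + 1) + 1] divides [n].  The code of a finite
    set is the least number that stands for it. *)
Definition fin_mem (i s : tm) : fm :=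
  \ex k m n, s == triple k m n /\ i < k /\
    \ex c, n == c * (m * (i + 1) + 1).

Definition is_triple (s : tm) : fm := \ex k m n, s == triple k m n.

Definition fin_set (s : tm) : fm :=
  is_triple s /\
  \all s', s' < s -> is_triple s' ->
    ~ (\all i, fin_mem i s' <-> fin_mem i s).

(** Binary sequences of length [l], as finite sets of pairs
    (position, digit). *)
Definition bin_seq (s l : tm) : fm :=
  fin_set s /\
  (\all x, fin_mem x s ->
     \ex i b, i < l /\ (b == 0 \/ b == 1) /\ x == pair i b) /\
  (\all i, i < l -> (fin_mem (pair i 0) s <-> ~ fin_mem (pair i 1) s)).

Definition in_bin (s : tm) : fm := \ex l, bin_seq s l.

Definition extends (s t : tm) : fm := \all x, fin_mem x s -> fin_mem x t.

(** [s] is the initial segment [G[k]]. *)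
Definition initial_segment (G : sv) (k s : tm) : fm :=
  bin_seq s k /\ \all i, i < k -> (fin_mem (pair i 1) s <-> i \in G).

Definition in_D (X : sv) (i s : tm) : fm :=
  in_bin s /\ \all n, triple s i n \in X.

Definition Pi01G : form := sentence (
  \ALL X,
    (\all i s, in_bin s -> \ex t, in_D X i t /\ extends s t) ->
    \EX G, \all i, \ex k s, initial_segment G k s /\ in_D X i s).

(** [triple m n d] represents [(m - n) / (d + 1)].  A rational number is the
    least of its representatives, so that equality of rationals is equality
    of codes. *)

Definition rep_rel (R : tm -> tm -> fm) (p q : tm) : fm :=
  \ex m n d m' n' d', p == triple m n d /\ q == triple m' n' d' /\
    R (m * (d' + 1) + n' * (d + 1))%tm (m' * (d + 1) + n * (d' + 1))%tm.

Definition same_value : tm -> tm -> fm := rep_rel feq.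
Definition rat_lt : tm -> tm -> fm := rep_rel flt.
Definition rat_le : tm -> tm -> fm := rep_rel (fun t u => t <= u).

Definition is_rat (q : tm) : fm :=
  is_triple q /\ \all q', q' < q -> ~ same_value q' q.

Definition rat_pos (q : tm) : fm := is_rat q /\ rat_lt (triple 0 0 0) q.

(** [s = p + q] *)
Definition rat_add (p q s : tm) : fm :=
  is_rat s /\
  \ex m n d m' n' d', p == triple m n d /\ q == triple m' n' d' /\
    same_value s (triple (m * (d' + 1) + m' * (d + 1))
                         (n * (d' + 1) + n' * (d + 1))
                         (d * d' + d + d')).

(** [s = |p - q|] *)
Definition rat_dist (p q s : tm) : fm :=
  is_rat s /\ rat_le (triple 0 0 0) s /\ (rat_add s q p \/ rat_add s p q).

(** A sequence of rationals, given by its graph. *)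
Definition qseq : Type := tm -> tm -> fm.

Definition set_seq (x : sv) : qseq := fun n q => pair n q \in x.
Definition const_seq (a : tm) : qseq := fun _ q => q == a.
Definition dist_seq (x y : qseq) : qseq :=
  fun n s => \ex p q, x n p /\ y n q /\ rat_dist p q s.

Definition is_real (x : sv) : fm :=
  (\all z, z \in x -> \ex n q, is_rat q /\ z == pair n q) /\
  (\all n, \ex q, pair n q \in x /\ \all q', pair n q' \in x -> q' == q) /\
  (\all e, rat_pos e -> \ex N, \all m n, N <= m -> N <= n ->
     \all p q s, pair m p \in x -> pair n q \in x -> rat_dist p q s ->
       rat_lt s e).

Definition real_le (x y : qseq) : fm :=
  \all e, rat_pos e -> \ex N, \all n, N <= n ->
    \all p q s, x n p -> y n q -> rat_add q e s -> rat_le p s.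

Definition real_eq (x y : qseq) : fm := real_le x y /\ real_le y x.
Definition real_lt (x y : qseq) : fm := real_le x y /\ ~ real_eq x y.

Definition in_ball (x : sv) (a r : tm) : fm :=
  real_lt (dist_seq (const_seq a) (set_seq x)) (const_seq r).

(** A set of numbers, given by its membership predicate; this covers both set
    variables and the members of a family coded by a single set. *)
Definition numset : Type := tm -> fm.

Definition of_sv (U : sv) : numset := fun z => z \in U.
Definition section (W : sv) (i : tm) : numset := fun z => pair i z \in W.

Definition open_code (U : numset) : fm :=
  \all z, U z -> \ex n a r, is_rat a /\ rat_pos r /\ z == triple n a r.

Definition in_open (x : sv) (U : numset) : fm :=
  \ex N a r, is_rat a /\ rat_pos r /\ in_ball x a r /\
    \all n, N <= n -> U (triple n a r).

(** [A] is a class of reals, given by a formula. *)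
Definition dense (A : sv -> fm) : fm :=
  \ALL V, open_code (of_sv V) ->
    (\EX x, is_real x /\ in_open x (of_sv V)) ->
    \EX y, is_real y /\ A y /\ in_open y (of_sv V).

Definition Baire_category_theorem : form := sentence (
  \ALL W,
    (\all i, open_code (section W i)) ->
    (\all i, dense (fun x => in_open x (section W i))) ->
    dense (fun x => \all i, in_open x (section W i))).

(* Main.v *)
(* By Goedel's completeness theorem it suffices to derive the Baire category
   theorem in an arbitrary Henkin model of the axioms, where one can argue about
   numbers, sets and rationals as about ordinary mathematical objects, using
   induction and comprehension for definable predicates only.

   Both cases go through one statement.  Given Pi-0-1 dense sets [D_i] of finite
   binary strings, there is a sequence [S] of strings such that, for each [i],
   some member of [D_i] is an initial segment of almost all [S n].  Under
   [Pi01G] take the initial segments of a generic set.  Under Sigma-0-2 induction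
   extend the empty string [n] times, in step [i] to the least string that has not
   been seen to lie outside [D_i] by stage [n]; Sigma-0-2 induction shows that each
   step stabilizes as [n] grows.

   A binary string codes a decreasing sequence of balls: a digit 1 at position [j]
   proposes the ball with code [j], which is accepted if it lies strictly inside
   the current one.  If [D_i] expresses that the current ball has radius below
   [1 / (i + 1)] and lies in the [i]-th open set, then [D_i] is dense, and the
   centers of the balls of the [S n] form a Cauchy sequence.  No rate of
   convergence is known, and none is required of a real here. *)

From Stdlib Require Import List Lia Cantor Classical ClassicalEpsilon
  FunctionalExtensionality PropExtensionality ProofIrrelevance RelationClasses.
From mathcomp Require Import ssreflect ssrfun ssrbool.
Require Import Defs.

Set Implicit Arguments.
Unset Strict Implicit.
Unset Printing Implicit Defensive.

Arguments prf_ax {T} G p _.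
Arguments prf_hyp {T} G {p} _.
Arguments prf_impI {T G p q} _.
Arguments prf_impE {T G p q} _ _.
Arguments prf_raa {T G p} _.
Arguments prf_all1I {T G p} _.
Arguments prf_all1E {T G p} t _.
Arguments prf_all2I {T G p} _.
Arguments prf_all2E {T G p} Y _.
Arguments prf_eqI {T G} t.
Arguments prf_eqE {T G} p {t u} _ _.

(** An open code is entered through a witness [(N, a, r)] that works for all [n >= N], so inclusion
    of a ball in the [i]-th open set is naturally Sigma-0-2, while the sets [D_i] have to be Pi-0-1.
    The witness is therefore sought below the code of the string, and strings are made to exceed it
    by proposing balls at late positions.

    Membership in [D_i] can be refuted at a finite stage but never confirmed, so the strings built
    at stage [n] are guesses. One step settles by Sigma-0-1 induction alone: it yields least
    elements of Pi-0-1 properties, and collection refutes all smaller strings by a common stage. But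
    the settling of step [i + 1] presupposes that of step [i], and to have settled is a Sigma-0-2
    property; this is the one place where Sigma-0-2 induction enters.

    A model may be nonstandard, so Rocq's own induction says nothing about its numbers. Every
    induction inside a model must exhibit a formula of the right complexity, and a large part of the
    development serves to make this automatic. *)

Definition scons {A : Type} (x : A) (f : nat -> A) (n : nat) : A :=
  match n with 0 => x | S k => f k end.

(** * Composition of substitutions *)

Lemma tsubst_comp s s' t :
  tsubst s (tsubst s' t) = tsubst (fun n => tsubst s (s' n)) t.
Proof. by elim: t => //= t -> u ->. Qed.

Lemma tsubst_id t : tsubst tvar t = t.
Proof. by elim: t => //= t -> u ->. Qed.

Lemma up1_comp s s' :
  (fun n => tsubst (up1 s) (up1 s' n)) = up1 (fun n => tsubst s (s' n)).
Proof.
apply: functional_extensionality; case=> //= n.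
by rewrite /tshift !tsubst_comp.
Qed.

Lemma up2_comp r r' : (fun n => up2 r (up2 r' n)) = up2 (fun n => r (r' n)).
Proof. by apply: functional_extensionality; case. Qed.

Lemma up1_id : up1 tvar = tvar.
Proof. by apply: functional_extensionality; case. Qed.

Lemma up2_id : up2 (fun n => n) = fun n => n.
Proof. by apply: functional_extensionality; case. Qed.

Lemma fsubst_comp p s s' r r' :
  fsubst s r (fsubst s' r' p) =
  fsubst (fun n => tsubst s (s' n)) (fun n => r (r' n)) p.
Proof.
elim: p s s' r r' => [t u|t u|t X||p IHp q IHq|p IH|p IH] s s' r r' /=;
  rewrite ?tsubst_comp ?IHp ?IHq ?IH ?up1_comp ?up2_comp //.
Qed.

Lemma fsubst_id p : fsubst tvar (fun n => n) p = p.
Proof.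
elim: p => [t u|t u|t X||p IHp q IHq|p IH|p IH] /=;
  rewrite ?tsubst_id ?up1_id ?up2_id ?IHp ?IHq ?IH //.
Qed.

Lemma fsubst_inst1 s r t p :
  fsubst s r (inst1 t p) = fsubst (scons (tsubst s t) s) r p.
Proof.
rewrite /inst1 fsubst_comp; congr fsubst.
by apply: functional_extensionality; case.
Qed.

Lemma inst1_up s r t p :
  inst1 t (fsubst (up1 s) r p) = fsubst (scons t s) r p.
Proof.
rewrite /inst1 fsubst_comp; congr fsubst.
apply: functional_extensionality; case=> //= n.
by rewrite /tshift tsubst_comp tsubst_id.
Qed.

Lemma fsubst_inst2 s r Y p :
  fsubst s r (inst2 Y p) = fsubst s (scons (r Y) r) p.
Proof.
rewrite /inst2 fsubst_comp; congr fsubst.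
by apply: functional_extensionality; case.
Qed.

Lemma inst2_up s r Y p :
  inst2 Y (fsubst s (up2 r) p) = fsubst s (scons Y r) p.
Proof.
rewrite /inst2 fsubst_comp.
have -> : (fun n => tsubst tvar (s n)) = s.
  by apply: functional_extensionality => n; rewrite tsubst_id.
congr fsubst; by apply: functional_extensionality; case.
Qed.

(** * Quotients through chosen representatives *)

Section Quotient.
Variables (T : Type) (R : T -> T -> Prop).
Hypothesis R_equiv : Equivalence R.

Definition canon (t : T) : T := epsilon (inhabits t) (R t).

Lemma canonP t : R t (canon t).
Proof. by apply: epsilon_spec; exists t; apply: Equivalence_Reflexive. Qed.

(** For related elements the predicates [R t] and [R u] are equal by extensionality, so [epsilon]
    makes the same choice for both. *)
Lemma canon_eq t u : canon t = canon u <-> R t u.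
Proof.
split=> [H|H].
  apply: (Equivalence_Transitive _ (canon t)) (canonP t) _; rewrite H.
  exact: Equivalence_Symmetric (canonP u).
rewrite /canon (proof_irrelevance _ (inhabits t) (inhabits u)); congr epsilon.
apply: functional_extensionality => v; apply: propositional_extensionality.
split=> Hv; first exact: Equivalence_Transitive (Equivalence_Symmetric _ _ H) Hv.
exact: Equivalence_Transitive H Hv.
Qed.

(** Since [sat] reads [Eq] as equality of the domain, provably equal terms have to become identical
    in the term model. The same construction later gives the fractions. *)
Definition quot : Type := {t | canon t = t}.

Lemma canonK t : canon (canon t) = canon t.
Proof. by apply/canon_eq/Equivalence_Symmetric/canonP. Qed.

Definition cls (t : T) : quot := exist _ (canon t) (canonK t).
Definition qrepr (x : quot) : T := proj1_sig x.

Lemma cls_eq t u : cls t = cls u <-> R t u.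
Proof.
rewrite -canon_eq; split=> [[]|H] //.
by apply: eq_sig_hprop => [x|] //; apply: proof_irrelevance.
Qed.

Lemma clsK (x : quot) : cls (qrepr x) = x.
Proof.
case: x => t Ht; apply: eq_sig_hprop => [y|] //; exact: proof_irrelevance.
Qed.

End Quotient.

(** * Models and satisfaction *)

Record model := Model {
  dom : Type;
  sets : Type;
  m0 : dom;
  m1 : dom;
  madd : dom -> dom -> dom;
  mmul : dom -> dom -> dom;
  mlt : dom -> dom -> Prop;
  mmem : dom -> sets -> Prop }.

Section Satisfaction.
Variable M : model.

Fixpoint eval (rho : nat -> dom M) (t : term) : dom M :=
  match t with
  | tvar n => rho n
  | tzero => m0 M
  | tone => m1 M
  | tadd t u => madd (eval rho t) (eval rho u)
  | tmul t u => mmul (eval rho t) (eval rho u)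
  end.

Fixpoint sat (rho : nat -> dom M) (sigma : nat -> sets M) (p : form) : Prop :=
  match p with
  | Eq t u => eval rho t = eval rho u
  | Lt t u => mlt (eval rho t) (eval rho u)
  | Mem t X => mmem (eval rho t) (sigma X)
  | Bot => False
  | Imp p q => sat rho sigma p -> sat rho sigma q
  | All1 p => forall x, sat (scons x rho) sigma p
  | All2 p => forall X, sat rho (scons X sigma) p
  end.

Definition models (T : form -> Prop) : Prop :=
  forall p, T p -> forall rho sigma, sat rho sigma p.

Lemma eval_subst rho s t :
  eval rho (tsubst s t) = eval (fun n => eval rho (s n)) t.
Proof. by elim: t => //= t -> u ->. Qed.

Lemma eval_up1 rho s x :
  (fun n => eval (scons x rho) (up1 s n)) =
  scons x (fun n => eval rho (s n)).
Proof.
apply: functional_extensionality; case=> //= n.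
by rewrite /tshift eval_subst.
Qed.

Lemma sat_subst p rho sigma s r :
  sat rho sigma (fsubst s r p) <->
  sat (fun n => eval rho (s n)) (fun n => sigma (r n)) p.
Proof.
elim: p rho sigma s r => [t u|t u|t X||p IHp q IHq|p IH|p IH] rho sigma s r /=.
- by rewrite !eval_subst.
- by rewrite !eval_subst.
- by rewrite !eval_subst.
- by [].
- by rewrite IHp IHq.
- split=> H x; move: (H x); by rewrite IH eval_up1.
- have E X : (fun n => scons X sigma (up2 r n)) = scons X (fun n => sigma (r n)).
    by apply: functional_extensionality; case.
  split=> H X; move: (H X); by rewrite IH E.
Qed.

End Satisfaction.

(** * Substitution in derivations *)

Lemma prf_weak T G p : prf T G p -> forall G', incl G G' -> prf T G' p.
Proof.
elim=> {G p}.
- by move=> *; apply: prf_ax.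
- by move=> G p Hp G' HG; apply: prf_hyp; apply: HG.
- move=> G p q _ IH G' HG; apply/prf_impI/IH.
  by move=> x [->|Hx]; [left | right; apply: HG].
- by move=> G p q _ IH _ IH' G' HG; apply: prf_impE (IH _ HG) (IH' _ HG).
- move=> G p _ IH G' HG; apply/prf_raa/IH.
  by move=> x [->|Hx]; [left | right; apply: HG].
- by move=> G p _ IH G' HG; apply/prf_all1I/IH/incl_map.
- by move=> G p t _ IH G' HG; apply/prf_all1E/IH.
- by move=> G p _ IH G' HG; apply/prf_all2I/IH/incl_map.
- by move=> G p t _ IH G' HG; apply/prf_all2E/IH.
- by move=> *; apply: prf_eqI.
- by move=> G p t u _ IH _ IH' G' HG; apply: prf_eqE (IH _ HG) (IH' _ HG).
Qed.

Lemma tsubst_bound t :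
  exists n, forall s s', (forall i, i < n -> s i = s' i) ->
  tsubst s t = tsubst s' t.
Proof.
elim: t => [k|||t [n Hn] u [m Hm]|t [n Hn] u [m Hm]] /=; try by exists 0.
- by exists (S k) => s s'; apply; lia.
- exists (n + m) => s s' H; congr tadd; [apply: Hn|apply: Hm] => i Hi;
    apply: H; lia.
- exists (n + m) => s s' H; congr tmul; [apply: Hn|apply: Hm] => i Hi;
    apply: H; lia.
Qed.

(** Freshness is expressed as insensitivity to what a substitution does from index [n] on, which is
    the form in which it gets applied; one bound serves both sorts of variables. *)
Definition vars_below (n : nat) (p : form) : Prop :=
  forall s s' r r', (forall i, i < n -> s i = s' i) ->
  (forall i, i < n -> r i = r' i) -> fsubst s r p = fsubst s' r' p.

Lemma vars_belowW n m p : n <= m -> vars_below n p -> vars_below m p.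
Proof. by move=> Hnm H s s' r r' Hs Hr; apply: H => i Hi; [apply: Hs|apply: Hr]; lia. Qed.

Lemma vars_below_ex p : exists n, vars_below n p.
Proof.
elim: p => [t u|t u|t X||p [n Hn] q [m Hm]|p [n Hn]|p [n Hn]].
- have [n Hn] := tsubst_bound t; have [m Hm] := tsubst_bound u.
  exists (n + m) => s s' r r' Hs Hr /=.
  by congr Eq; [apply: Hn|apply: Hm] => i Hi; apply: Hs; lia.
- have [n Hn] := tsubst_bound t; have [m Hm] := tsubst_bound u.
  exists (n + m) => s s' r r' Hs Hr /=.
  by congr Lt; [apply: Hn|apply: Hm] => i Hi; apply: Hs; lia.
- have [n Hn] := tsubst_bound t.
  exists (n + S X) => s s' r r' Hs Hr /=.
  by congr Mem; [apply: Hn => i Hi; apply: Hs|apply: Hr]; lia.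
- by exists 0.
- exists (n + m) => s s' r r' Hs Hr /=.
  by congr Imp; [apply: Hn|apply: Hm] => i Hi; [apply: Hs|apply: Hr|apply: Hs|apply: Hr]; lia.
- exists n => s s' r r' Hs Hr /=; congr All1; apply: Hn => // -[|i] Hi //=.
  by rewrite Hs //; lia.
- exists n => s s' r r' Hs Hr /=; congr All2; apply: Hn => // -[|i] Hi //=.
  by rewrite Hr //; lia.
Qed.

Lemma vars_below_list G : exists n, forall p, In p G -> vars_below n p.
Proof.
elim: G => [|p G [n Hn]]; first by exists 0.
have [m Hm] := vars_below_ex p.
exists (n + m) => q [<-|Hq]; first by apply: vars_belowW Hm; lia.
by apply: vars_belowW (Hn _ Hq); lia.
Qed.

Section Derivations.
Variable T : form -> Prop.

Fixpoint all1s n p := match n with 0 => p | S n => all1s n (All1 p) end.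
Fixpoint all2s n p := match n with 0 => p | S n => all2s n (All2 p) end.

Lemma prf_all1s n p : prf T nil p -> prf T nil (all1s n p).
Proof. by elim: n p => //= n IH p Hp; apply/IH/prf_all1I. Qed.

Lemma prf_all2s n p : prf T nil p -> prf T nil (all2s n p).
Proof. by elim: n p => //= n IH p Hp; apply/IH/prf_all2I. Qed.

Lemma all1sE n p s r : prf T nil (fsubst tvar r (all1s n p)) ->
  prf T nil (fsubst (fun i => if Nat.ltb i n then s i else tvar (i - n)) r p).
Proof.
elim: n p s => [|n IH] p s /=.
  by congr (prf _ _ (fsubst _ _ _)); apply: functional_extensionality => i; rewrite PeanoNat.Nat.sub_0_r.
move=> /(IH _ (fun i => s (S i))) /= /(prf_all1E (s 0)).
rewrite inst1_up; congr (prf _ _ (fsubst _ _ _)).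
by apply: functional_extensionality; case.
Qed.

Lemma all2sE n p s r : prf T nil (fsubst s (fun i => i) (all2s n p)) ->
  prf T nil (fsubst s (fun i => if Nat.ltb i n then r i else i - n) p).
Proof.
elim: n p r => [|n IH] p r /=.
  by congr (prf _ _ (fsubst _ _ _)); apply: functional_extensionality => i; rewrite PeanoNat.Nat.sub_0_r.
move=> /(IH _ (fun i => r (S i))) /= /(prf_all2E (r 0)).
rewrite inst2_up; congr (prf _ _ (fsubst _ _ _)).
by apply: functional_extensionality; case.
Qed.

(** The axiom set is arbitrary and need not be closed under substitution. Generalizing all variables
    below a bound and instantiating the quantifiers again, set variables before number variables,
    has the effect of a simultaneous substitution. *)
Lemma prf_subst_nil p s r : prf T nil p -> prf T nil (fsubst s r p).
Proof.
move=> Hp; have [n Hn] := vars_below_ex p.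
have := prf_all2s n Hp; rewrite -{1}(fsubst_id (all2s n p)) => /(@all2sE _ _ _ r).
set r' := fun i => if Nat.ltb i n then r i else i - n.
move=> Hq.
have /(@all1sE n _ s (fun i => i)) : prf T nil (fsubst tvar (fun i => i)
    (all1s n (fsubst tvar r' p))).
  by rewrite fsubst_id; apply: prf_all1s.
rewrite fsubst_comp; congr (prf _ _ _); apply: Hn => i /PeanoNat.Nat.ltb_lt Hi.
  by rewrite -[LHS]/(if Nat.ltb i n then s i else tvar (i - n)) Hi.
by rewrite /r' Hi.
Qed.

Lemma map_fshift1 s r G :
  map fshift1 (map (fsubst s r) G) = map (fsubst (up1 s) r) (map fshift1 G).
Proof.
rewrite !map_map; apply: map_ext => p; rewrite /fshift1 !fsubst_comp; by congr fsubst.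
Qed.

Lemma map_fshift2 s r G :
  map fshift2 (map (fsubst s r) G) = map (fsubst s (up2 r)) (map fshift2 G).
Proof.
rewrite !map_map; apply: map_ext => p; rewrite /fshift2 !fsubst_comp; congr fsubst.
by apply: functional_extensionality => n; rewrite tsubst_id.
Qed.

Lemma prf_subst G p : prf T G p ->
  forall s r, prf T (map (fsubst s r) G) (fsubst s r p).
Proof.
elim=> {G p} /=.
- move=> G p Hp s r; apply: (@prf_weak _ nil) => //.
  by apply: prf_subst_nil; apply: prf_ax.
- by move=> G p Hp s r; apply/prf_hyp/in_map.
- by move=> G p q _ IH s r; apply/prf_impI/IH.
- by move=> G p q _ IH _ IH' s r; apply: prf_impE (IH s r) (IH' s r).
- by move=> G p _ IH s r; apply/prf_raa/IH.
- by move=> G p _ IH s r; apply: prf_all1I; rewrite map_fshift1; apply: IH.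
- move=> G p t _ IH s r; rewrite fsubst_inst1 -inst1_up.
  exact/prf_all1E/IH.
- by move=> G p _ IH s r; apply: prf_all2I; rewrite map_fshift2; apply: IH.
- move=> G p Y _ IH s r; rewrite fsubst_inst2 -inst2_up.
  exact/prf_all2E/IH.
- by move=> *; apply: prf_eqI.
- move=> G p t u _ IH _ IH' s r; rewrite fsubst_inst1 -inst1_up.
  by apply: prf_eqE (IH s r) _; rewrite inst1_up -fsubst_inst1.
Qed.

(** The renaming sends [k] to the variable about to be bound and shifts all others. On formulas with
    variables below [k] it acts as [fshift1], and it undoes the instantiation of [q]. *)
Lemma prf_fresh1 G q k : (forall p, In p G -> vars_below k p) ->
  vars_below k q -> prf T G (inst1 (tvar k) q) -> prf T G (All1 q).
Proof.
move=> HG Hq /prf_subst H; apply: prf_all1I.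
have {H} := H (fun n => if Nat.eqb n k then tvar 0 else tvar (S n)) (fun n => n).
rewrite fsubst_inst1.
have -> : map fshift1 G = map (fsubst
    (fun n => if Nat.eqb n k then tvar 0 else tvar (S n)) (fun n => n)) G.
  apply: map_ext_in => p Hp; apply: HG => // i Hi.
  by have /PeanoNat.Nat.eqb_neq -> : i <> k by lia.
congr (prf _ _ _); rewrite -[RHS]fsubst_id; apply: Hq => // -[|i] Hi /=.
  by rewrite PeanoNat.Nat.eqb_refl.
by have /PeanoNat.Nat.eqb_neq -> : i <> k by lia.
Qed.

Lemma prf_fresh2 G q k : (forall p, In p G -> vars_below k p) ->
  vars_below k q -> prf T G (inst2 k q) -> prf T G (All2 q).
Proof.
move=> HG Hq /prf_subst H; apply: prf_all2I.
have {H} := H tvar (fun n => if Nat.eqb n k then 0 else S n).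
rewrite fsubst_inst2.
have -> : map fshift2 G = map (fsubst tvar
    (fun n => if Nat.eqb n k then 0 else S n)) G.
  apply: map_ext_in => p Hp; apply: HG => // i Hi.
  by have /PeanoNat.Nat.eqb_neq -> : i <> k by lia.
congr (prf _ _ _); rewrite -[RHS]fsubst_id; apply: Hq => // -[|i] Hi /=.
  by rewrite PeanoNat.Nat.eqb_refl.
by have /PeanoNat.Nat.eqb_neq -> : i <> k by lia.
Qed.

(** * Completeness *)

Definition consistent G := ~ prf T G Bot.

Lemma consistent_neg G p : consistent G -> ~ consistent (p :: G) ->
  consistent (Neg p :: G).
Proof.
move=> HG /NNPP Hp Hn; apply: HG; exact: prf_impE (prf_impI Hp) (prf_raa Hn).
Qed.

Lemma consistent_witness G p q : consistent G -> In (Neg p) G ->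
  (prf T G q -> prf T G p) -> consistent (Neg q :: G).
Proof.
move=> HG Hp H Hq; apply: HG.
exact: prf_impE (prf_hyp _ Hp) (H (prf_raa Hq)).
Qed.

(** Variables play the part of Henkin constants: a stage is a finite list, so some variable occurs
    nowhere in it. Conditioning on consistency makes a step exist for every list. *)
Definition henkin_step p G G' : Prop :=
  incl G G' /\ (consistent G -> consistent G' /\ (In p G' \/
    In (Neg p) G' /\
    (forall q, p = All1 q -> exists k, In (Neg (inst1 (tvar k) q)) G') /\
    (forall q, p = All2 q -> exists k, In (Neg (inst2 k q)) G'))).

Lemma henkin_step_ex p G : exists G', henkin_step p G G'.
Proof.
case: (classic (consistent G)) => [HG|HG]; last by exists G; split.
case: (classic (consistent (p :: G))) => [Hp|Hp].
  exists (p :: G); split; first by move=> x; right.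
  by move=> _; split=> //; left; left.
have HN := consistent_neg HG Hp.
have [n Hn] := vars_below_list (Neg p :: G).
case E : p HN Hn => [t u|t u|t X||p1 p2|q|q] HN Hn;
  try by (exists (Neg p :: G); rewrite E; split;
    [move=> x; right | move=> _; split=> //; right; split; [left|split]]).
- have [m Hm] := vars_below_ex q.
  (* [n] bounds the variables of the list and [m] those of [q], so the variable [n + m] is fresh. *)
  exists (Neg (inst1 (tvar (n + m)) q) :: Neg (All1 q) :: G).
  split; first by move=> x; right; right.
  move=> _; split.
    apply: consistent_witness HN _ _; first by left.
    by apply: prf_fresh1 => [x Hx|]; [apply: vars_belowW (Hn _ Hx)|apply: vars_belowW Hm]; lia.
  right; split; first by right; left.
  by split=> // _ [<-]; exists (n + m); left.
- have [m Hm] := vars_below_ex q.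
  exists (Neg (inst2 (n + m) q) :: Neg (All2 q) :: G).
  split; first by move=> x; right; right.
  move=> _; split.
    apply: consistent_witness HN _ _; first by left.
    by apply: prf_fresh2 => [x Hx|]; [apply: vars_belowW (Hn _ Hx)|apply: vars_belowW Hm]; lia.
  right; split; first by right; left.
  by split=> // _ [<-]; exists (n + m); left.
Qed.

Definition cpair (n m : nat) : nat := to_nat (n, m).
Arguments cpair : simpl never.

Lemma cpair_inj n m n' m' : cpair n m = cpair n' m' -> n = n' /\ m = m'.
Proof. by move=> /to_nat_inj [-> ->]. Qed.

Fixpoint term_code (t : term) : nat :=
  match t with
  | tvar n => cpair 0 n
  | tzero => cpair 1 0
  | tone => cpair 2 0
  | tadd t u => cpair 3 (cpair (term_code t) (term_code u))
  | tmul t u => cpair 4 (cpair (term_code t) (term_code u))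
  end.

(** The codes schedule the formulas: the step from stage [form_code p] is the one that decides [p],
    which makes sense because codes are injective. *)
Fixpoint form_code (p : form) : nat :=
  match p with
  | Eq t u => cpair 0 (cpair (term_code t) (term_code u))
  | Lt t u => cpair 1 (cpair (term_code t) (term_code u))
  | Mem t X => cpair 2 (cpair (term_code t) X)
  | Bot => cpair 3 0
  | Imp p q => cpair 4 (cpair (form_code p) (form_code q))
  | All1 p => cpair 5 (form_code p)
  | All2 p => cpair 6 (form_code p)
  end.

Lemma term_code_inj t u : term_code t = term_code u -> t = u.
Proof.
elim: t u => [n|||t IHt t' IHt'|t IHt t' IHt'] [m|||u u'|u u'] /= /cpair_inj [] //.
- by move=> _ ->.
- by move=> _ /cpair_inj [/IHt -> /IHt' ->].
- by move=> _ /cpair_inj [/IHt -> /IHt' ->].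
Qed.

Lemma form_code_inj p q : form_code p = form_code q -> p = q.
Proof.
elim: p q => [t u|t u|t X||p IHp p' IHp'|p IH|p IH]
  [t' u'|t' u'|t' X'||q q'|q|q] /= /cpair_inj [] //.
- by move=> _ /cpair_inj [/term_code_inj -> /term_code_inj ->].
- by move=> _ /cpair_inj [/term_code_inj -> /term_code_inj ->].
- by move=> _ /cpair_inj [/term_code_inj -> ->].
- by move=> _ /cpair_inj [/IHp -> /IHp' ->].
- by move=> _ /IH ->.
- by move=> _ /IH ->.
Qed.

Variable p0 : form.
Hypothesis p0_unprovable : ~ prf T nil p0.

Definition stage_step n G G' : Prop :=
  incl G G' /\ (consistent G -> consistent G') /\
  forall p, form_code p = n -> henkin_step p G G'.

Lemma stage_step_ex n G : exists G', stage_step n G G'.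
Proof.
case: (classic (exists p, form_code p = n)) => [[p Hp]|Hn].
  have [G' HG'] := henkin_step_ex p G; exists G'.
  have [H1 H2] := HG'; split=> //; split; first by move=> /H2 [].
  by move=> q; rewrite -Hp => /form_code_inj ->.
by exists G; split=> //; split=> // p Hp; case: Hn; exists p.
Qed.

Fixpoint stage (n : nat) : list form :=
  match n with
  | 0 => Neg p0 :: nil
  | S n => epsilon (inhabits nil) (stage_step n (stage n))
  end.

Lemma stageS n : stage_step n (stage n) (stage (S n)).
Proof. exact: epsilon_spec (stage_step_ex n (stage n)). Qed.

Lemma stage_consistent n : consistent (stage n).
Proof.
elim: n => [|n IH] /=; last by apply: (proj1 (proj2 (stageS n))).
by move=> H; apply: p0_unprovable; apply: prf_raa.
Qed.

Lemma stage_incl n m : n <= m -> incl (stage n) (stage m).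
Proof.
elim=> [|k _ IH]; first exact: incl_refl.
exact: incl_tran IH (proj1 (stageS k)).
Qed.

Definition theory p : Prop := exists n, In p (stage n).

Lemma theory_list L : (forall p, In p L -> theory p) -> exists n, incl L (stage n).
Proof.
elim: L => [|p L IH] H; first by exists 0 => p [].
have [|n Hn] := IH; first by move=> q Hq; apply: H; right.
have [|m Hm] := H p; first by left.
exists (n + m) => q [<-|Hq].
  by apply: (@stage_incl m) => //; lia.
by apply: (@stage_incl n); [lia | apply: Hn].
Qed.

Lemma theory_consistent L : (forall p, In p L -> theory p) -> ~ prf T L Bot.
Proof.
move=> /theory_list [n Hn] H; apply: (@stage_consistent n).
exact: prf_weak H _ Hn.
Qed.

Lemma theory_henkin p : theory p \/ theory (Neg p) /\
  (forall q, p = All1 q -> exists k, theory (Neg (inst1 (tvar k) q))) /\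
  (forall q, p = All2 q -> exists k, theory (Neg (inst2 k q))).
Proof.
have [_ [_ /(_ p erefl) [_ /(_ (@stage_consistent _)) [_ H]]]] :=
  stageS (form_code p).
have S_th q : In q (stage (S (form_code p))) -> theory q by exists (S (form_code p)).
case: H => [H|[H [H1 H2]]]; first by left; apply: S_th.
right; split; first exact: S_th.
by split=> q /[dup] Hq => [/H1|/H2] [k Hk]; exists k; apply: S_th.
Qed.

Lemma theory_neg p : theory (Neg p) <-> ~ theory p.
Proof.
split=> [Hn Hp|Hp]; last by case: (theory_henkin p) => [|[]].
apply: (@theory_consistent (Neg p :: p :: nil)).
  by move=> q [<-|[<-|[]]].
by apply: prf_impE (@prf_hyp _ _ p _); [apply: prf_hyp; left | right; left].
Qed.

Lemma theory_closed L p : (forall q, In q L -> theory q) -> prf T L p -> theory p.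
Proof.
move=> HL Hp; apply: NNPP => /theory_neg Hn.
apply: (@theory_consistent (Neg p :: L)) => [q [<-|/HL]|] //.
apply: prf_impE (prf_hyp _ _) _; first by left.
by apply: prf_weak Hp _ _ => x; right.
Qed.

Lemma theory_imp p q : theory (Imp p q) <-> (theory p -> theory q).
Proof.
split=> [H Hp|H].
  apply: (@theory_closed (Imp p q :: p :: nil)) => [r [<-|[<-|[]]]|] //.
  by apply: prf_impE (@prf_hyp _ _ p _); [apply: prf_hyp; left | right; left].
case: (classic (theory p)) => [/H Hq|/theory_neg Hp].
  apply: (@theory_closed (q :: nil)) => [r [<-|[]]|] //.
  by apply/prf_impI/prf_hyp; right; left.
apply: (@theory_closed (Neg p :: nil)) => [r [<-|[]]|] //.
apply/prf_impI/prf_raa; apply: prf_impE (@prf_hyp _ _ p _).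
  by apply: prf_hyp; right; right; left.
by right; left.
Qed.

(** If [All1 p] were missing, its negation would have entered together with a variable at which the
    instance is refuted. *)
Lemma theory_all1 p : theory (All1 p) <-> forall t, theory (inst1 t p).
Proof.
split=> [H t|H].
  apply: (@theory_closed (All1 p :: nil)) => [r [<-|[]]|] //.
  by apply/prf_all1E/prf_hyp; left.
case: (theory_henkin (All1 p)) => // [[_ [/(_ p erefl) [k /theory_neg]]]].
by case.
Qed.

Lemma theory_all2 p : theory (All2 p) <-> forall X, theory (inst2 X p).
Proof.
split=> [H X|H].
  apply: (@theory_closed (All2 p :: nil)) => [r [<-|[]]|] //.
  by apply/prf_all2E/prf_hyp; left.
case: (theory_henkin (All2 p)) => // [[_ [_ /(_ p erefl) [k /theory_neg]]]].
by case.
Qed.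

Lemma theory_eqE p t u : theory (Eq t u) -> theory (inst1 t p) -> theory (inst1 u p).
Proof.
move=> Htu Ht; apply: (@theory_closed (Eq t u :: inst1 t p :: nil)).
  by move=> q [<-|[<-|[]]].
by apply: (@prf_eqE _ _ _ t); apply: prf_hyp; [left | right; left].
Qed.

Lemma theory_eq_refl t : theory (Eq t t).
Proof. by apply: (@theory_closed nil) => //; apply: prf_eqI. Qed.

Lemma inst1_shift t u : tsubst (fun n => match n with 0 => t | S k => tvar k end)
  (tshift u) = u.
Proof. by rewrite /tshift tsubst_comp tsubst_id. Qed.

Lemma theory_eq_sym t u : theory (Eq t u) -> theory (Eq u t).
Proof.
move=> H; have := @theory_eqE (Eq (tvar 0) (tshift t)) _ _ H.
by rewrite /inst1 /= !inst1_shift; apply; apply: theory_eq_refl.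
Qed.

Lemma theory_eq_trans t u v : theory (Eq t u) -> theory (Eq u v) -> theory (Eq t v).
Proof.
move=> H H'; have := @theory_eqE (Eq (tshift t) (tvar 0)) _ _ H'.
by rewrite /inst1 /= !inst1_shift; apply.
Qed.

Lemma theory_equiv : Equivalence (fun t u => theory (Eq t u)).
Proof.
split; [exact: theory_eq_refl | exact: theory_eq_sym | exact: theory_eq_trans].
Qed.

Local Notation tcls := (cls theory_equiv).

(** Sets need no quotient, as the language has no equality between them; they are the set variables
    themselves. *)
Definition term_model : model := {|
  dom := quot (fun t u => theory (Eq t u));
  sets := nat;
  m0 := tcls tzero;
  m1 := tcls tone;
  madd x y := tcls (tadd (qrepr x) (qrepr y));
  mmul x y := tcls (tmul (qrepr x) (qrepr y));
  mlt x y := theory (Lt (qrepr x) (qrepr y));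
  mmem x X := theory (Mem (qrepr x) X) |}.

Lemma theory_binop (op : term -> term -> term) :
  (forall s t u, tsubst s (op t u) = op (tsubst s t) (tsubst s u)) ->
  forall t u, tcls (op (qrepr (tcls t)) (qrepr (tcls u))) = tcls (op t u).
Proof.
move=> Hop t u; apply/cls_eq/theory_eq_sym.
apply: (@theory_eq_trans _ (op (qrepr (tcls t)) u)).
  have := @theory_eqE (Eq (tshift (op t u)) (op (tvar 0) (tshift u))) _ _ (canonP theory_equiv t).
  rewrite /inst1 /= !Hop !inst1_shift; apply; exact: theory_eq_refl.
have := @theory_eqE (Eq (tshift (op (qrepr (tcls t)) u)) (op (tshift (qrepr (tcls t))) (tvar 0))) _ _ (canonP theory_equiv u).
rewrite /inst1 /= !Hop !inst1_shift; apply; exact: theory_eq_refl.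
Qed.

Lemma eval_cls s t : eval (M := term_model) (fun n => tcls (s n)) t = tcls (tsubst s t).
Proof.
elim: t => //= t -> u ->; apply: (theory_binop (op := _)) => //.
Qed.

Lemma theory_canon_inst p t : theory (inst1 (qrepr (tcls t)) p) <-> theory (inst1 t p).
Proof.
split; apply: theory_eqE; last exact: canonP theory_equiv t.
exact: theory_eq_sym (canonP theory_equiv t).
Qed.

Lemma scons_cls t s : scons (tcls t) (fun n => tcls (s n)) = fun n => tcls (scons t s n).
Proof. by apply: functional_extensionality; case. Qed.

(** The induction needs arbitrary substitutions, because a number quantifier extends [s] by any
    term; every element of the domain is the class of a term. *)
Lemma truth p s r :
  sat (M := term_model) (fun n => tcls (s n)) r p <-> theory (fsubst s r p).
Proof.
elim: p s r => [t u|t u|t X||p IHp q IHq|p IH|p IH] s r.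
- by rewrite /= !eval_cls cls_eq.
- rewrite /= !eval_cls /=; set t' := tsubst s t; set u' := tsubst s u.
  have := theory_canon_inst (Lt (tvar 0) (tshift (qrepr (tcls u')))) t'.
  have := theory_canon_inst (Lt (tshift t') (tvar 0)) u'.
  by rewrite /inst1 /= !inst1_shift => <- <-.
- rewrite /= !eval_cls /=; set t' := tsubst s t.
  by have := theory_canon_inst (Mem (tvar 0) (r X)) t'.
- split=> // H; case: (@theory_consistent (Bot :: nil)) => [q [<-|[]]|] //.
  by apply: prf_hyp; left.
- by rewrite /= theory_imp IHp IHq.
- rewrite /= theory_all1; split=> H t.
    by rewrite inst1_up -IH -scons_cls; apply: H.
  by rewrite -(clsK theory_equiv t) scons_cls IH -inst1_up; apply: H.
- rewrite /= theory_all2; split=> H Y; move: (H Y);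
    by rewrite inst2_up IH.
Qed.

Lemma term_model_models : models term_model T.
Proof.
move=> p Hp rho sigma.
have -> : rho = fun n => tcls (qrepr (rho n)).
  by apply: functional_extensionality => n; rewrite clsK.
apply/truth; apply: (@theory_closed nil) => //.
by apply/prf_subst_nil/prf_ax.
Qed.

Lemma term_model_refutes :
  ~ sat (M := term_model) (fun n => tcls (tvar n)) (fun n => n) p0.
Proof.
by rewrite truth fsubst_id -theory_neg; exists 0; left.
Qed.

End Derivations.

Theorem completeness T p :
  (forall M, models M T -> forall rho sigma, sat (M := M) rho sigma p) ->
  derivable T p.
Proof.
move=> H; apply: NNPP => Hp; have := @term_model_refutes T p Hp; apply.
exact/H/term_model_models.
Qed.

From HB Require Import structures.
From mathcomp Require Import all_boot all_order all_algebra ring lra.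
From mathcomp Require boolp.

(** * Arithmetic in models *)

(** The field [rca_set] provides a valuation of the set variables for formulas that have no set
    parameters. *)
Record rca_model := RCAModel {
  rca_base :> model;
  rca_set : sets rca_base;
  rca_sat : models rca_base RCA0 }.

Definition num (M : rca_model) : Type := dom M.

Lemma bounded_subst p s r : bounded p -> bounded (fsubst s r p).
Proof.
move=> Hp; elim: Hp s r => {p} /= [t u|t u|t X||p q _ IHp _ IHq|t p _ IH] s r.
- exact: bd_eq.
- exact: bd_lt.
- exact: bd_mem.
- exact: bd_bot.
- by apply: bd_imp; [apply: IHp | apply: IHq].
have -> : tsubst (up1 s) (tshift t) = tshift (tsubst s t).
  by rewrite /tshift !tsubst_comp.
exact/bd_all/IH.
Qed.

Section Connectives.
Variables (M : model) (rho : nat -> dom M) (sigma : nat -> sets M).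

Lemma sat_Iff p q :
  sat rho sigma (Iff p q) <-> (sat rho sigma p <-> sat rho sigma q).
Proof. by rewrite /=; tauto. Qed.

Lemma sat_Or p q :
  sat rho sigma (Or p q) <-> sat rho sigma p \/ sat rho sigma q.
Proof. by rewrite /=; tauto. Qed.

Lemma sat_Ex1 p :
  sat rho sigma (Ex1 p) <-> exists x, sat (scons x rho) sigma p.
Proof.
split=> [H|[x Hx] /(_ x)]; last exact.
by apply: NNPP => Hn; apply: H => x Hx; apply: Hn; exists x.
Qed.

Lemma sat_Ex2 p :
  sat rho sigma (Ex2 p) <-> exists X, sat rho (scons X sigma) p.
Proof.
split=> [H|[x Hx] /(_ x)]; last exact.
by apply: NNPP => Hn; apply: H => x Hx; apply: Hn; exists x.
Qed.

Lemma sat_inst1 t p :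
  sat rho sigma (inst1 t p) <-> sat (scons (eval rho t) rho) sigma p.
Proof.
rewrite sat_subst.
by have -> : (fun n => eval rho (match n with 0 => t | S k => tvar k end)) =
  scons (eval rho t) rho by apply: functional_extensionality; case.
Qed.

Lemma sat_fshift1 x p : sat (scons x rho) sigma (fshift1 p) <-> sat rho sigma p.
Proof. exact: sat_subst. Qed.

Lemma sat_induction p : sat rho sigma (induction_for p) ->
  sat (scons (m0 M) rho) sigma p ->
  (forall x, sat (scons x rho) sigma p ->
             sat (scons (madd x (m1 M)) rho) sigma p) ->
  forall x, sat (scons x rho) sigma p.
Proof.
move=> /= H H0 HS x; apply: H; first exact/sat_inst1.
move=> y Hy; rewrite sat_subst.
have -> : (fun n => eval (scons y rho) (match n with
    | 0 => tadd (tvar 0) tone | S k => tvar (S k) end)) =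
  scons (madd y (m1 M)) rho by apply: functional_extensionality; case.
exact: HS.
Qed.

End Connectives.

Section BasicArithmetic.
Variable M : rca_model.
Implicit Types (x y z : dom M) (rho : nat -> dom M) (sigma : nat -> sets M).

Lemma Sigma01_induction rho sigma p : Sigma01 p ->
  sat (scons (m0 M) rho) sigma p ->
  (forall x, sat (scons x rho) sigma p ->
             sat (scons (madd x (m1 M)) rho) sigma p) ->
  forall x, sat (scons x rho) sigma p.
Proof.
move=> Hp; apply: sat_induction; apply: (@rca_sat M).
by apply: RCA0_induction.
Qed.

(** [Sigma01] asks for a leading existential quantifier, so a vacuous one is prefixed. *)
Lemma bounded_induction rho sigma p : bounded p ->
  sat (scons (m0 M) rho) sigma p ->
  (forall x, sat (scons x rho) sigma p ->
             sat (scons (madd x (m1 M)) rho) sigma p) ->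
  forall x, sat (scons x rho) sigma p.
Proof.
move=> Hp H0 HS x.
have E y : sat (scons y rho) sigma (Ex1 (fshift1 p)) <-> sat (scons y rho) sigma p.
  rewrite sat_Ex1; split=> [[z /sat_fshift1]|H] //.
  by exists y; apply/sat_fshift1.
apply/E; apply: Sigma01_induction; first by constructor; apply: bounded_subst.
- exact/E.
- by move=> y /E Hy; apply/E/HS.
Qed.

Lemma eq_induction (t u : term) rho :
  let P x := eval (scons x rho) t = eval (scons x rho) u in
  P (m0 M) -> (forall x, P x -> P (madd x (m1 M))) -> forall x, P x.
Proof.
by move=> P; apply: (@bounded_induction rho (fun=> rca_set M) (Eq t u)); apply: bd_eq.
Qed.

Local Notation "0" := (m0 M).
Local Notation "1" := (m1 M).
Local Notation "x + y" := (@madd M x y).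
Local Notation "x * y" := (@mmul M x y).
Local Notation "x < y" := (@mlt M x y).

Lemma basic p rho : basic_axiom p -> sat rho (fun=> rca_set M) p.
Proof. by move=> Hp; apply: (@rca_sat M); apply: RCA0_basic. Qed.

Lemma msucc_neq0 x : x + 1 <> 0.
Proof. exact: basic (fun=> x) ax_succ_ne0. Qed.

Lemma msucc_inj x y : x + 1 = y + 1 -> x = y.
Proof. exact: basic (scons x (fun=> y)) ax_succ_inj. Qed.

Lemma maddx0 x : x + 0 = x.
Proof. exact: basic (fun=> x) ax_add0. Qed.

Lemma maddxS x y : x + (y + 1) = x + y + 1.
Proof. exact: basic (scons x (fun=> y)) ax_addS. Qed.

Lemma mmulx0 x : x * 0 = 0.
Proof. exact: basic (fun=> x) ax_mul0. Qed.

Lemma mmulxS x y : x * (y + 1) = x * y + x.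
Proof. exact: basic (scons x (fun=> y)) ax_mulS. Qed.

Lemma mltx0 x : ~ x < 0.
Proof. exact: basic (fun=> x) ax_lt0. Qed.

Lemma mltxS x y : x < y + 1 <-> x < y \/ x = y.
Proof.
have /sat_Iff H := basic (scons x (fun=> y)) ax_ltS.
by apply: iff_trans H _; apply: sat_Or.
Qed.

Local Notation v0 := (tvar 0).
Local Notation v1 := (tvar 1).
Local Notation v2 := (tvar 2).
Local Notation env2 x y := (scons x (fun=> y)).

Lemma madd0x x : 0 + x = x.
Proof.
apply: (@eq_induction (tadd tzero v0) v0 (fun=> 0)); first exact: maddx0.
by move=> y /= {2}<-; apply: maddxS.
Qed.

Lemma maddSx x y : x + 1 + y = x + y + 1.
Proof.
apply: (@eq_induction (tadd (tadd v1 tone) v0) (tadd (tadd v1 v0) tone) (fun=> x)).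
  by rewrite /= !maddx0.
by move=> z /= H; rewrite !maddxS H.
Qed.

Lemma maddC x y : x + y = y + x.
Proof.
apply: (@eq_induction (tadd v1 v0) (tadd v0 v1) (fun=> x)) => /=.
  by rewrite maddx0 madd0x.
by move=> z H; rewrite maddxS maddSx H.
Qed.

Lemma maddA x y z : x + (y + z) = x + y + z.
Proof.
apply: (@eq_induction (tadd v1 (tadd v2 v0)) (tadd (tadd v1 v2) v0) (env2 x y)) => /=.
  by rewrite !maddx0.
by move=> t H; rewrite !maddxS H.
Qed.

Lemma maddAC x y z : x + y + z = x + z + y.
Proof. by rewrite -maddA (maddC y) maddA. Qed.

Lemma mmul0x x : 0 * x = 0.
Proof.
apply: (@eq_induction (tmul tzero v0) tzero (fun=> 0)) => /=.
  exact: mmulx0.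
by move=> y H; rewrite mmulxS H maddx0.
Qed.

Lemma mmulSx x y : (x + 1) * y = x * y + y.
Proof.
apply: (@eq_induction (tmul (tadd v1 tone) v0) (tadd (tmul v1 v0) v0) (fun=> x)) => /=.
  by rewrite !mmulx0 maddx0.
by move=> z H; rewrite !mmulxS H !maddA (maddAC _ x z).
Qed.

Lemma mmulC x y : x * y = y * x.
Proof.
apply: (@eq_induction (tmul v1 v0) (tmul v0 v1) (fun=> x)) => /=.
  by rewrite mmulx0 mmul0x.
by move=> z H; rewrite mmulxS mmulSx H.
Qed.

Lemma mmulDx x y z : (x + y) * z = x * z + y * z.
Proof.
apply: (@eq_induction (tmul (tadd v1 v2) v0) (tadd (tmul v1 v0) (tmul v2 v0)) (env2 x y)) => /=.
  by rewrite !mmulx0 maddx0.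
by move=> t H; rewrite !mmulxS H !maddA; congr madd; rewrite -!maddA (maddC x).
Qed.

Lemma mmulA x y z : x * (y * z) = x * y * z.
Proof.
apply: (@eq_induction (tmul v1 (tmul v2 v0)) (tmul (tmul v1 v2) v0) (env2 x y)) => /=.
  by rewrite !mmulx0.
by move=> t H; rewrite !mmulxS -H mmulC mmulDx (mmulC x) (mmulC x).
Qed.

Lemma mmul1x x : 1 * x = x.
Proof. by rewrite -(madd0x 1) mmulSx mmul0x madd0x. Qed.

Lemma m1_neq0 : 1 <> 0.
Proof. rewrite -(madd0x 1); exact: msucc_neq0. Qed.

Lemma madd_cancel x y z : x + z = y + z -> x = y.
Proof.
apply: (@bounded_induction (env2 x y) (fun=> rca_set M)
  (Imp (Eq (tadd v1 v0) (tadd v2 v0)) (Eq v1 v2))) => /=.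
- by apply: bd_imp; apply: bd_eq.
- by rewrite !maddx0.
- by move=> t H; rewrite !maddxS => /msucc_inj.
Qed.

(** The induction formula has the quantifier over [z] in front of the implication, because [Sigma01]
    admits only a bounded formula after its existential quantifier. *)
Lemma mlt_ex x y : x < y -> exists z, x + (z + 1) = y.
Proof.
have /sat_Ex1 [z Hz] : sat (env2 y x) (fun=> rca_set M)
    (Ex1 (Imp (Lt v2 v1) (Eq (tadd v2 (tadd v0 tone)) v1))).
  apply: (@Sigma01_induction (fun=> x)) => [||t].
  - by constructor; apply: bd_imp; [apply: bd_lt | apply: bd_eq].
  - by rewrite sat_Ex1; exists 0 => /= /mltx0.
  rewrite !sat_Ex1 => -[z /= Hz].
  case: (classic (x < t)) => [/Hz H|Hn]; first by exists (z + 1) => /= _; rewrite maddxS H.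
  by exists 0 => /= /mltxS [] // ->; rewrite madd0x.
by move=> Hxy; exists z; apply: Hz.
Qed.

Lemma mltDS x z : x < x + (z + 1).
Proof.
apply: (@bounded_induction (fun=> x) (fun=> rca_set M)
  (Lt v1 (tadd v1 (tadd v0 tone)))) => /=.
- exact: bd_lt.
- by rewrite madd0x; apply/mltxS; right.
- by move=> y Hy; rewrite maddxS; apply/mltxS; left.
Qed.

Lemma mltP x y : x < y <-> exists z, x + (z + 1) = y.
Proof. by split=> [/mlt_ex|[z <-]]; last exact: mltDS. Qed.

Lemma m0_or_succ x : x = 0 \/ exists y, x = y + 1.
Proof.
have /sat_Or [] : sat (env2 x x) (fun=> rca_set M) (Or (Eq v0 tzero) (Lt tzero v0)).
- apply: (@bounded_induction (fun=> x)) => [||y].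
  + by apply: bd_imp; [apply: bd_imp|]; constructor.
  + by rewrite sat_Or; left.
  + move=> _; rewrite sat_Or; right => /=.
    by apply/mltP; exists y; rewrite madd0x.
- by move=> /= ->; left.
- by move=> /= /mltP [z <-]; right; exists z; rewrite madd0x.
Qed.

Lemma mlt_total x y : x < y \/ x = y \/ y < x.
Proof.
have /sat_Or [|/sat_Or] : sat (env2 x y) (fun=> rca_set M)
    (Or (Lt v0 v1) (Or (Eq v0 v1) (Lt v1 v0))); try tauto.
apply: (@bounded_induction (fun=> y)) => [||z].
- by repeat constructor.
- rewrite sat_Or; case: (m0_or_succ y) => [->|[z ->]]; last first.
    by left => /=; apply/mltP; exists z; rewrite madd0x.
  by right; rewrite sat_Or; left.
- rewrite !sat_Or /= => -[/mltP [t <-]|[H|H]].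
  + case: (m0_or_succ t) => [->|[u ->]]; first by right; left; rewrite madd0x.
    by left; apply/mltP; exists u; rewrite -!maddA (maddC 1) -!maddA.
  + by right; right; apply/mltxS; right.
  + by right; right; apply/mltxS; left.
Qed.

Lemma mlt_irr x : ~ x < x.
Proof.
by move=> /mltP [z]; rewrite -{2}(madd0x x) maddC => /madd_cancel /msucc_neq0.
Qed.

End BasicArithmetic.

Import Order.TTheory GRing.Theory Num.Theory.
Local Open Scope ring_scope.

HB.instance Definition _ (M : rca_model) := boolp.gen_eqMixin (num M).
HB.instance Definition _ (M : rca_model) := boolp.gen_choiceMixin (num M).
HB.instance Definition _ (M : rca_model) :=
  GRing.isNmodule.Build (num M) (@maddA M) (@maddC M) (@madd0x M).
Lemma m1_neq0_bool (M : rca_model) : (m1 M : num M) != 0.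
Proof. by apply/eqP; apply: m1_neq0. Qed.
HB.instance Definition _ (M : rca_model) :=
  GRing.Nmodule_isComNzSemiRing.Build (num M) (@mmulA M) (@mmulC M)
    (@mmul1x M) (@mmulDx M) (@mmul0x M) (@m1_neq0_bool M).

Definition nlt (M : rca_model) (x y : num M) : Prop := @mlt M x y.
Notation "x ≺ y" := (nlt x y) (at level 70, no associativity).
Notation "x ≼ y" := (nlt x y \/ x = y) (at level 70, no associativity).

Section Cancellation.
Variable M : rca_model.
Implicit Types x y z : num M.

Lemma num_addIr x y z : x + z = y + z -> x = y.
Proof. exact: madd_cancel. Qed.

Lemma num_addIl x y z : z + x = z + y -> x = y.
Proof. by rewrite ![z + _]addrC; apply: num_addIr. Qed.

Lemma num_add1_neq0 x : x + 1 <> 0.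
Proof. exact: msucc_neq0. Qed.

Lemma num_addS_neq x z : x + (z + 1) <> x.
Proof. by rewrite -[RHS]addr0 => /num_addIl /num_add1_neq0. Qed.

(** This takes the place of subtraction, which numbers lack. *)
Lemma num_cases x y : (exists z, y = x + (z + 1)) \/ x = y \/ (exists z, x = y + (z + 1)).
Proof.
case: (mlt_total x y) => [/mltP [z <-]|[->|/mltP [z <-]]].
- by left; exists z.
- by right; left.
- by right; right; exists z.
Qed.

Lemma num_mulIS x y z : x * (z + 1) = y * (z + 1) -> x = y.
Proof.
case: (num_cases x y) => [[t ->]|[->|[t ->]]] // H.
(* With [y = x + (t + 1)] the two products differ by the successor of [t * z + t + z]. *)
- by case: (@num_addS_neq (x * (z + 1)) (t * z + t + z)); rewrite [RHS]H; ring.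
- by case: (@num_addS_neq (y * (z + 1)) (t * z + t + z)); rewrite -[RHS]H; ring.
Qed.

Lemma num_lt_irr x : ~ x ≺ x.
Proof. exact: mlt_irr. Qed.

Lemma num_lt_total x y : x ≺ y \/ x = y \/ y ≺ x.
Proof. exact: mlt_total. Qed.

Lemma num_lt0 x : ~ x ≺ 0.
Proof. exact: mltx0. Qed.

Lemma num_ltS x y : x ≺ y + 1 <-> x ≼ y.
Proof. exact: mltxS. Qed.

Lemma num_ltP x y : x ≺ y <-> exists z : num M, x + (z + 1) = y.
Proof. exact: mltP. Qed.

Lemma num_0_or_succ x : x = 0 \/ exists y, x = y + 1.
Proof. exact: m0_or_succ. Qed.

Lemma num_add_eq0 x y : x + y = 0 -> x = 0.
Proof.
case: (num_0_or_succ x) => [->|[z ->]] // H; case: (@num_add1_neq0 (z + y)).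
by rewrite -[RHS]H; ring.
Qed.

Lemma num_mulS_eq0 x z : x * (z + 1) = 0 -> x = 0.
Proof. by move=> H; apply: (@num_mulIS _ _ z); rewrite mul0r. Qed.

End Cancellation.

(** * The ordered field of fractions *)

Section Fractions.
Variable M : rca_model.
Local Notation N := (num M).

(* [(m, n, d)] represents the fraction [(m - n) / (d + 1)]. *)
Definition frac : Type := (N * N * N)%type.

Definition frel (a b : frac) : Prop :=
  let: (m, n, d) := a in let: (m', n', d') := b in
  m * (d' + 1) + n' * (d + 1) = m' * (d + 1) + n * (d' + 1).

Lemma frel_equiv : Equivalence frel.
Proof.
split.
- by move=> [[m n] d] /=.
- by move=> [[m n] d] [[m' n'] d'] /= H; rewrite -H.
- move=> [[m n] d] [[m' n'] d'] [[m'' n''] d''] /= H H'.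
  (* In the absence of subtraction, both sides are multiplied by [d' + 1] and increased by the terms
     of the middle fraction, until both hypotheses can be substituted; then everything added is
     cancelled. *)
  apply: (@num_mulIS _ _ _ d').
  apply: (@num_addIr _ _ _ ((n' * (d + 1) + m' * (d + 1)) * (d'' + 1))).
  transitivity ((m * (d' + 1) + n' * (d + 1)) * (d'' + 1) +
    (m' * (d'' + 1) + n'' * (d' + 1)) * (d + 1)); first by ring.
  by rewrite H H'; ring.
Qed.

Definition ratio : Type := quot frel.

Definition ratio_of (m n d : N) : ratio := cls frel_equiv (m, n, d).

Lemma ratioP (x : ratio) : exists m n d, x = ratio_of m n d.
Proof.
rewrite -(clsK frel_equiv x); case: (qrepr x) => [[m n] d].
by exists m, n, d.
Qed.

Lemma ratio_eq m n d m' n' d' : ratio_of m n d = ratio_of m' n' d' <->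
  m * (d' + 1) + n' * (d + 1) = m' * (d + 1) + n * (d' + 1).
Proof. exact: cls_eq. Qed.

Lemma repr_ratio m n d : exists m' n' d', qrepr (ratio_of m n d) = (m', n', d') /\
  m * (d' + 1) + n' * (d + 1) = m' * (d + 1) + n * (d' + 1).
Proof.
have := canonP frel_equiv (m, n, d); rewrite -[canon _ _]/(qrepr (ratio_of m n d)).
by case: (qrepr _) => [[m' n'] d'] /= H; exists m', n', d'.
Qed.

Definition radd (x y : ratio) : ratio :=
  let: (m, n, d) := qrepr x in let: (m', n', d') := qrepr y in
  ratio_of (m * (d' + 1) + m' * (d + 1)) (n * (d' + 1) + n' * (d + 1))
           (d * d' + d + d').
Definition ropp (x : ratio) : ratio :=
  let: (m, n, d) := qrepr x in ratio_of n m d.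
Definition rmul (x y : ratio) : ratio :=
  let: (m, n, d) := qrepr x in let: (m', n', d') := qrepr y in
  ratio_of (m * m' + n * n') (m * n' + n * m') (d * d' + d + d').
Definition rzero : ratio := ratio_of 0 0 0.
Definition rone : ratio := ratio_of 1 0 0.

Lemma raddE m n d m' n' d' : radd (ratio_of m n d) (ratio_of m' n' d') =
  ratio_of (m * (d' + 1) + m' * (d + 1)) (n * (d' + 1) + n' * (d + 1))
           (d * d' + d + d').
Proof.
have [a [b [c [E H]]]] := repr_ratio m n d.
have [a' [b' [c' [E' H']]]] := repr_ratio m' n' d'; rewrite /radd E E'.
apply/ratio_eq.
transitivity ((a * (d + 1) + n * (c + 1)) * ((c' + 1) * (d' + 1)) +
  (a' * (d' + 1) + n' * (c' + 1)) * ((c + 1) * (d + 1))); first by ring.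
by rewrite -H -H'; ring.
Qed.

Lemma roppE m n d : ropp (ratio_of m n d) = ratio_of n m d.
Proof.
have [a [b [c [E H]]]] := repr_ratio m n d; rewrite /ropp E.
by apply/ratio_eq; transitivity (m * (c + 1) + b * (d + 1)); [ring | rewrite H; ring].
Qed.

Lemma rmulE m n d m' n' d' : rmul (ratio_of m n d) (ratio_of m' n' d') =
  ratio_of (m * m' + n * n') (m * n' + n * m') (d * d' + d + d').
Proof.
have [a [b [c [E H]]]] := repr_ratio m n d.
have [a' [b' [c' [E' H']]]] := repr_ratio m' n' d'; rewrite /rmul E E'.
(* Only one factor is exchanged at a time. *)
transitivity (ratio_of (m * a' + n * b') (m * b' + n * a') (d * c' + d + c'));
  apply/ratio_eq.
- transitivity (((a * (d + 1) + n * (c + 1)) * a' +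
    (m * (c + 1) + b * (d + 1)) * b') * (c' + 1)); first by ring.
  by rewrite -H {2}H; ring.
- transitivity (((a' * (d' + 1) + n' * (c' + 1)) * m +
    (m' * (c' + 1) + b' * (d' + 1)) * n) * (d + 1)); first by ring.
  by rewrite -H' {2}H'; ring.
Qed.

Lemma raddA : associative radd.
Proof.
move=> x y z; have [m [n [d ->]]] := ratioP x; have [m' [n' [d' ->]]] := ratioP y.
have [m'' [n'' [d'' ->]]] := ratioP z.
by rewrite !raddE; apply/ratio_eq; ring.
Qed.

Lemma raddC : commutative radd.
Proof.
move=> x y; have [m [n [d ->]]] := ratioP x; have [m' [n' [d' ->]]] := ratioP y.
by rewrite !raddE; apply/ratio_eq; ring.
Qed.

Lemma radd0r : left_id rzero radd.
Proof.
by move=> x; have [m [n [d ->]]] := ratioP x; rewrite raddE; apply/ratio_eq; ring.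
Qed.

Lemma raddNr : left_inverse rzero ropp radd.
Proof.
by move=> x; have [m [n [d ->]]] := ratioP x; rewrite roppE raddE; apply/ratio_eq; ring.
Qed.

Lemma rmulA : associative rmul.
Proof.
move=> x y z; have [m [n [d ->]]] := ratioP x; have [m' [n' [d' ->]]] := ratioP y.
have [m'' [n'' [d'' ->]]] := ratioP z.
by rewrite !rmulE; apply/ratio_eq; ring.
Qed.

Lemma rmulC : commutative rmul.
Proof.
move=> x y; have [m [n [d ->]]] := ratioP x; have [m' [n' [d' ->]]] := ratioP y.
by rewrite !rmulE; apply/ratio_eq; ring.
Qed.

Lemma rmul1r : left_id rone rmul.
Proof.
by move=> x; have [m [n [d ->]]] := ratioP x; rewrite rmulE; apply/ratio_eq; ring.
Qed.

Lemma rmulDl : left_distributive rmul radd.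
Proof.
move=> x y z; have [m [n [d ->]]] := ratioP x; have [m' [n' [d' ->]]] := ratioP y.
have [m'' [n'' [d'' ->]]] := ratioP z.
by rewrite !rmulE !raddE !rmulE; apply/ratio_eq; ring.
Qed.

Definition rnonneg (x : ratio) : Prop := exists a d, x = ratio_of a 0 d.

Lemma rnonneg_add x y : rnonneg x -> rnonneg y -> rnonneg (radd x y).
Proof.
move=> [a [d ->]] [a' [d' ->]]; rewrite raddE.
by exists (a * (d' + 1) + a' * (d + 1)), (d * d' + d + d'); apply/ratio_eq; ring.
Qed.

Lemma rnonneg_mul x y : rnonneg x -> rnonneg y -> rnonneg (rmul x y).
Proof.
move=> [a [d ->]] [a' [d' ->]]; rewrite rmulE.
by exists (a * a'), (d * d' + d + d'); apply/ratio_eq; ring.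
Qed.

Lemma rnonneg_anti x : rnonneg x -> rnonneg (ropp x) -> x = rzero.
Proof.
move=> [a [d ->]] [a' [d']]; rewrite roppE => /ratio_eq H.
have /num_mulS_eq0 -> : a * (d' + 1) = 0.
  by apply: (@num_add_eq0 _ _ (a' * (d + 1))); rewrite addrC -[RHS](mul0r (d' + 1)) -H; ring.
by apply/ratio_eq; ring.
Qed.

Lemma rnonneg_total x : rnonneg x \/ rnonneg (ropp x).
Proof.
have [m [n [d ->]]] := ratioP x; rewrite roppE.
case: (num_cases m n) => [[z ->]|[->|[z ->]]].
- by right; exists (z + 1), d; apply/ratio_eq; ring.
- by left; exists 0, d; apply/ratio_eq; ring.
- by left; exists (z + 1), d; apply/ratio_eq; ring.
Qed.

Lemma rone_neq0 : rone <> rzero.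
Proof.
rewrite /rone /rzero => /ratio_eq H; apply: (@num_add1_neq0 M 0).
transitivity (1 * (0 + 1) + 0 * (0 + 1) : N); first by ring.
by rewrite H; ring.
Qed.

Lemma rinv_ex x : x <> rzero -> exists y, rmul y x = rone.
Proof.
have [m [n [d ->]]] := ratioP x => Hx.
case: (num_cases m n) => [[z E]|[E|[z E]]].
(* The fraction is [-(z + 1) / (d + 1)] here, with inverse [-(d + 1) / (z + 1)]. *)
- exists (ratio_of 0 (d + 1) z); rewrite rmulE E; apply/ratio_eq; ring.
- by case: Hx; rewrite E; apply/ratio_eq; ring.
- exists (ratio_of (d + 1) 0 z); rewrite rmulE E; apply/ratio_eq; ring.
Qed.

Definition rinv (x : ratio) : ratio :=
  if boolp.asbool (x = rzero) then rzero
  else epsilon (inhabits rzero) (fun y => rmul y x = rone).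

Lemma rinv0 : rinv rzero = rzero.
Proof. by rewrite /rinv; case: boolp.asboolP. Qed.

Lemma rmulVr x : x <> rzero -> rmul (rinv x) x = rone.
Proof.
move=> Hx; rewrite /rinv; case: boolp.asboolP => // _.
exact: epsilon_spec (rinv_ex Hx).
Qed.

Definition rle (x y : ratio) : bool := boolp.asbool (rnonneg (radd y (ropp x))).

End Fractions.

HB.instance Definition _ (M : rca_model) := boolp.gen_eqMixin (ratio M).
HB.instance Definition _ (M : rca_model) := boolp.gen_choiceMixin (ratio M).
HB.instance Definition _ (M : rca_model) :=
  GRing.isZmodule.Build (ratio M) (@raddA M) (@raddC M) (@radd0r M) (@raddNr M).
Lemma rone_neq0_bool (M : rca_model) : rone M != 0.
Proof. by apply/eqP/rone_neq0. Qed.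
HB.instance Definition _ (M : rca_model) :=
  GRing.Zmodule_isComNzRing.Build (ratio M) (@rmulA M) (@rmulC M) (@rmul1r M)
    (@rmulDl M) (rone_neq0_bool M).
Lemma rmulVr_bool (M : rca_model) (x : ratio M) : x != 0 -> rinv x * x = 1.
Proof. by move=> /eqP; apply: rmulVr. Qed.
HB.instance Definition _ (M : rca_model) :=
  GRing.ComNzRing_isField.Build (ratio M) (@rmulVr_bool M) (@rinv0 M).

Section Order.
Variable M : rca_model.
Implicit Types x y : ratio M.

Lemma rle0 x : rle 0 x = boolp.asbool (rnonneg x).
Proof. by rewrite /rle -[radd x _]/(x - 0) subr0. Qed.

Lemma rle0N x : rle x 0 = boolp.asbool (rnonneg (- x)).
Proof. by rewrite /rle -[radd 0 _]/(0 - x) sub0r. Qed.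

Lemma rle0_add x y : rle 0 x -> rle 0 y -> rle 0 (x + y).
Proof.
by rewrite !rle0 => /boolp.asboolP Hx /boolp.asboolP Hy; apply/boolp.asboolP/rnonneg_add.
Qed.

Lemma rle0_mul x y : rle 0 x -> rle 0 y -> rle 0 (x * y).
Proof.
by rewrite !rle0 => /boolp.asboolP Hx /boolp.asboolP Hy; apply/boolp.asboolP/rnonneg_mul.
Qed.

Lemma rle0_anti x : rle 0 x -> rle x 0 -> x = 0.
Proof.
by rewrite rle0 rle0N => /boolp.asboolP Hx /boolp.asboolP Hy; apply: rnonneg_anti.
Qed.

Lemma rsub_ge0 x y : rle 0 (y - x) = rle x y.
Proof. by rewrite rle0. Qed.

Lemma rle0_total x : rle 0 x || rle x 0.
Proof.
rewrite rle0 rle0N.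
by case: (rnonneg_total x) => /boolp.asboolP -> //; rewrite orbT.
Qed.

Definition rlt x y : bool := (y != x) && rle x y.
Definition rnorm x : ratio M := if rle 0 x then x else - x.

Lemma rnormN x : rnorm (- x) = rnorm x.
Proof.
have := rle0_total x; rewrite /rnorm [rle 0 (- x)]rle0 -rle0N.
case E : (rle 0 x) => /=; case E' : (rle x 0) => //= _; last by rewrite opprK.
by rewrite (rle0_anti E E') oppr0.
Qed.

Lemma rge0_norm x : rle 0 x -> rnorm x = x.
Proof. by rewrite /rnorm => ->. Qed.

Lemma rlt_def x y : rlt x y = (y != x) && rle x y.
Proof. by []. Qed.

End Order.

HB.instance Definition _ (M : rca_model) :=
  Num.IntegralDomain_isLeReal.Build (ratio M) (@rle0_add M) (@rle0_mul M)
    (@rle0_anti M) (@rsub_ge0 M) (@rle0_total M) (@rnormN M) (@rge0_norm M)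
    (@rlt_def M).

(** * The numbers inside their field of fractions *)

Section Embedding.
Variable M : rca_model.
Implicit Types x y z : num M.

Definition nu x : ratio M := ratio_of x 0 0.

Lemma nuD x y : nu (x + y) = nu x + nu y.
Proof. by rewrite -[nu x + nu y]/(radd (nu x) (nu y)) raddE; apply/ratio_eq; ring. Qed.

Lemma nuM x y : nu (x * y) = nu x * nu y.
Proof. by rewrite -[nu x * nu y]/(rmul (nu x) (nu y)) rmulE; apply/ratio_eq; ring. Qed.

Lemma nu0 : nu 0 = 0. Proof. by []. Qed.
Lemma nu1 : nu 1 = 1. Proof. by []. Qed.

Lemma nu_inj x y : nu x = nu y -> x = y.
Proof. by move=> /ratio_eq H; apply: (@num_mulIS _ _ _ 0); move: H; rewrite !mul0r !addr0. Qed.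

Lemma rle_nonneg (u v : ratio M) : reflect (rnonneg (v - u)) (u <= v).
Proof. exact: boolp.asboolP. Qed.

Lemma nu_ge0 x : 0 <= nu x.
Proof. by apply/rle_nonneg; rewrite subr0; exists x, 0. Qed.

Lemma nu_lt x y : nlt x y <-> nu x < nu y.
Proof.
have pos z : 0 < nu z + 1 by rewrite ltr_wpDl ?nu_ge0.
split=> [/num_ltP [z]|H].
  move=> /(congr1 nu); rewrite !nuD nu1 => <-.
  by rewrite ltrDl pos.
case: (num_cases x y) => [[z E]|[E|[z E]]]; first by apply/num_ltP; exists z.
  by rewrite E ltxx in H.
by rewrite E !nuD nu1 gtrDl ltNge ltW ?pos in H.
Qed.

Lemma nu_le x y : nlt x y \/ x = y <-> nu x <= nu y.
Proof.
rewrite nu_lt le_eqVlt; split=> [[->|->]|/orP [/eqP/nu_inj ->|]]; rewrite ?eqxx ?orbT //.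
- by right.
- by left.
Qed.

(** The gap of 1 passes the discreteness of the numbers on to [lra]. *)
Lemma nu_ltS x y : nlt x y <-> nu x + 1 <= nu y.
Proof.
rewrite -nu1 -nuD -nu_le; split=> [/num_ltP [z]|].
  move=> <-.
  case: (num_0_or_succ z) => [->|[t ->]]; first by right; rewrite add0r.
  by left; apply/num_ltP; exists t; ring.
by case=> [/nu_lt|<-]; rewrite nu_lt !nuD nu1; [lra|rewrite ltrDl ltr01].
Qed.

Lemma nu_nlt x y : ~ nlt x y <-> nu y <= nu x.
Proof. by rewrite nu_lt; split=> [/negP|/le_gtF ->]; rewrite -?leNgt. Qed.

Lemma ratio_nu m n d : ratio_of m n d = (nu m - nu n) / (nu d + 1).
Proof.
have H : nu d + 1 != 0 by rewrite gt_eqF // ltr_wpDl ?nu_ge0.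
apply: (mulIf H); rewrite mulfVK // -nu1 -nuD.
rewrite -[LHS]/(rmul _ _) -[nu m - nu n]/(radd _ (ropp _)) roppE raddE rmulE.
by apply/ratio_eq; ring.
Qed.

Lemma ratio_nuP (u : ratio M) : exists m n d, u = (nu m - nu n) / (nu d + 1).
Proof. by have [m [n [d ->]]] := ratioP u; exists m, n, d; apply: ratio_nu. Qed.

Lemma nu_den_gt0 x : 0 < nu x + 1.
Proof. by rewrite ltr_wpDl ?nu_ge0. Qed.

(** The Archimedean property holds relative to the numbers of the model, standard or not:
    [(m - n) / (d + 1)] is at most [m]. *)
Lemma ratio_bound (u : ratio M) : exists n, u <= nu n.
Proof.
have [m [n [d ->]]] := ratio_nuP u; exists m.
rewrite ler_pdivrMr ?nu_den_gt0 //.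
have := nu_ge0 m; have := nu_ge0 n; have := nu_ge0 d; nra.
Qed.

End Embedding.

Ltac nuhyp :=
  repeat match goal with
  | H : ~ nlt _ _ |- _ => move/nu_nlt in H
  | H : nlt _ _ |- _ => move/nu_ltS in H
  | H : nlt _ _ \/ _ = _ |- _ => move/nu_le in H
  | H : ?a = ?b :> num _ |- _ => apply (congr1 (@nu _)) in H
  | H : is_true _ |- _ => first [rewrite nuD in H | rewrite nuM in H | rewrite nu1 in H | rewrite nu0 in H]
  | H : _ = _ :> ratio _ |- _ => first [rewrite nuD in H | rewrite nuM in H | rewrite nu1 in H | rewrite nu0 in H]
  end.

Ltac nugoal :=
  match goal with
  | |- ~ nlt _ _ => apply/nu_nlt
  | |- nlt _ _ => apply/nu_lt
  | |- nlt _ _ \/ _ = _ => apply/nu_le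
  | |- _ = _ :> num _ => apply: nu_inj
  | |- _ => idtac
  end; rewrite ?nuD ?nuM ?nu1 ?nu0.

Ltac nupos :=
  repeat match goal with
  | |- context [nu ?x] => lazymatch goal with
      | H : is_true (0 <= nu x) |- _ => fail
      | _ => pose proof (nu_ge0 x) end
  | _ : context [nu ?x] |- _ => lazymatch goal with
      | H : is_true (0 <= nu x) |- _ => fail
      | _ => pose proof (nu_ge0 x) end
  end.

(* Linear arithmetic over the numbers of a model, through the embedding into
   its fractions. *)
Ltac nlin := nuhyp; nugoal; nupos; lra.

(** * The pairing function *)

Section Pairing.
Variable M : rca_model.
Implicit Types x y : num M.

Definition npair x y : num M := (x + y) * (x + y) + x.

(** [(x + y)^2 + x] is less than [(x + y + 1)^2]. *)
Lemma npair_lt x y x' y' : nlt (x + y) (x' + y') -> nlt (npair x y) (npair x' y').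
Proof.
rewrite nu_ltS nu_lt /npair !(nuD (_ * _)) !nuM; set s := nu (x + y); set s' := nu (x' + y').
have := nu_ge0 y; have := nu_ge0 x'; have := nu_ge0 (x + y).
have : nu (x + y) = nu x + nu y by rewrite nuD.
rewrite -/s; nra.
Qed.

Lemma npair_inj x y x' y' : npair x y = npair x' y' -> x = x' /\ y = y'.
Proof.
move=> H.
have E : x + y = x' + y'.
  case: (num_lt_total (x + y) (x' + y')) => [/npair_lt|[//|/npair_lt]];
  by rewrite H => /num_lt_irr.
have E' : x = x' by move: H; rewrite /npair E; apply: num_addIl.
by split=> //; rewrite E' in E; apply: num_addIl E.
Qed.

Lemma npair_ge1 x y : nlt x (npair x y) \/ x = npair x y.
Proof.
by apply/nu_le; rewrite /npair nuD nuM lerDr mulr_ge0 ?nu_ge0.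
Qed.

Lemma npair_ge2 x y : nlt y (npair x y) \/ y = npair x y.
Proof.
case: (num_0_or_succ y) => [->|[z ->]].
  by apply/nu_le; rewrite nu0 nu_ge0.
apply/nu_le; rewrite /npair (nuD (_ * _)) nuM; set u := nu (x + (z + 1)).
have : u = nu x + nu (z + 1) by rewrite -nuD.
have := nu_ge0 x; have : 1 <= nu (z + 1) by rewrite nuD nu1 lerDr nu_ge0.
nra.
Qed.

End Pairing.

(** * Definable predicates in a model *)

Section Contexts.
Variable M : rca_model.
Local Notation N := (num M).
Implicit Types rho : nat -> N.

Fixpoint ctx (n : nat) : Type :=
  match n with 0%N => unit | n.+1 => (ctx n * N)%type end.

(* The last component of a context is the variable with index 0; the variables
   beyond the context are parameters. *)
Fixpoint vapp n : ctx n -> (nat -> N) -> nat -> N :=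
  match n with
  | 0%N => fun _ rho => rho
  | n.+1 => fun v rho => scons v.2 (vapp v.1 rho)
  end.

(* A context map each of whose components is a variable or a constant. *)
Definition reindexing m n (f : ctx m -> ctx n) : Prop :=
  forall rho, exists rho' g, forall w i, vapp (f w) rho i = vapp w rho' (g i).

Lemma vapp_ge m (w : ctx m) rho i : vapp w rho (m + i)%N = rho i.
Proof. by elim: m w => //= m IH [w x]; apply: IH. Qed.

Lemma vapp_lt m (w : ctx m) rho rho' i : (i < m)%N -> vapp w rho i = vapp w rho' i.
Proof. by elim: m w i => //= m IH [w x] [|i] //= Hi; apply: IH. Qed.

Lemma vapp_addC m (w : ctx m) c rho i : (m <= i)%N ->
  vapp w (scons c rho) i.+1 = vapp w rho i.
Proof.
move=> Hi; rewrite -(subnKC Hi) -addnS !vapp_ge //.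
Qed.

Lemma reindexing_nil m : reindexing (fun _ : ctx m => tt : ctx 0).
Proof. by move=> rho; exists rho, (addn m) => w i; rewrite vapp_ge. Qed.

Lemma reindexing_fst m n (f : ctx m -> ctx n) :
  reindexing f -> reindexing (fun w : ctx m.+1 => f w.1).
Proof.
move=> H rho; have [rho' [g Hg]] := H rho.
by exists rho', (fun i => (g i).+1) => w i /=.
Qed.

Definition is_var m (x : ctx m -> N) : Prop :=
  exists2 k, (k < m)%N & forall w rho, x w = vapp w rho k.

Lemma is_var_fst m (x : ctx m -> N) :
  is_var x -> is_var (fun w : ctx m.+1 => x w.1).
Proof. by move=> [k Hk H]; exists k.+1 => // w rho /=; apply: H. Qed.

Lemma reindexing_var m n (f : ctx m -> ctx n) x : reindexing f -> is_var x ->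
  reindexing (fun w => (f w, x w) : ctx n.+1).
Proof.
move=> H [k Hk Hx] rho; have [rho' [g Hg]] := H rho.
exists rho', (fun i => if i is j.+1 then g j else k) => w [|i] //=.
Qed.

Lemma reindexing_const m n (f : ctx m -> ctx n) c : reindexing f ->
  reindexing (fun w => (f w, c) : ctx n.+1).
Proof.
move=> H rho; have [rho' [g Hg]] := H rho.
(* The constant becomes the parameter at index [m], the first one beyond the context, so the old
   parameters move up by one. *)
exists (scons c rho'), (fun i => if i is j.+1
  then if (g j < m)%N then g j else (g j).+1 else m) => w [|i] /=.
  by rewrite -[X in vapp _ _ X]addn0 vapp_ge.
rewrite Hg; case: ltnP => Hi; first exact: vapp_lt.
by rewrite vapp_addC.
Qed.

Lemma reindexing_weak m n (f : ctx m -> ctx n) g :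
  (forall w rho i, vapp (f w) rho i = vapp w rho (g i)) -> reindexing f.
Proof. by move=> H rho; exists rho, g. Qed.

Lemma reindexing_cst m n (u : ctx n) : reindexing (fun _ : ctx m => u).
Proof.
elim: n u => [|n IH] [] //; first exact: reindexing_nil.
by move=> u c; apply: reindexing_const.
Qed.

End Contexts.

Ltac isvar := first
  [ by exists 0%N | by exists 1%N | by exists 2 | by exists 3 | by exists 4 | by exists 5].

Ltac reidx := solve [repeat first
  [ exact: reindexing_nil | exact: reindexing_cst
  | by apply: (reindexing_weak (g := id))
  | by apply: (reindexing_weak (g := S))
  | by apply: (reindexing_weak (g := (fun i => i.+2)))
  | by apply: (reindexing_weak (g := (fun i => i.+3)))
  | by apply: (reindexing_weak (g := (fun i => i.+4)))
  | apply: reindexing_var; [|isvar]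
  | apply: reindexing_const ]].

Section Definability.
Variable M : rca_model.
Local Notation N := (num M).
Local Notation ctx := (ctx M).
Implicit Types (rho : nat -> N) (sigma : nat -> sets M) (X : sets M).

(** The defining formula is merely asserted to exist, so later arguments handle Rocq predicates
    instead of de Bruijn indices; [rho] and [sigma] hold the parameters. *)
Definition D0 n (P : ctx n -> Prop) : Prop :=
  exists p rho sigma, bounded p /\ forall v, P v <-> sat (M := M) (vapp v rho) sigma p.

Lemma D0_iff n (P Q : ctx n -> Prop) : (forall v, P v <-> Q v) -> D0 Q -> D0 P.
Proof.
move=> H [p [rho [sigma [Hp HQ]]]]; exists p, rho, sigma; split=> // v.
by rewrite H.
Qed.

Lemma D0_reindex m n (f : ctx m -> ctx n) P :
  reindexing f -> D0 P -> D0 (fun w => P (f w)).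
Proof.
move=> Hf [p [rho [sigma [Hp HP]]]]; have [rho' [g Hg]] := Hf rho.
exists (fsubst (fun i => tvar (g i)) (fun i => i) p), rho', sigma.
split; first exact: bounded_subst.
move=> w; rewrite HP sat_subst /=.
suff -> : vapp (f w) rho = fun i => vapp w rho' (g i) by [].
by apply: functional_extensionality => i.
Qed.

Lemma D0_False n : D0 (fun _ : ctx n => False).
Proof. by exists Bot, (fun=> 0), (fun=> rca_set M); split=> //; apply: bd_bot. Qed.

(* Two formulas are given common parameters by interleaving their lists of
   parameters. *)
Definition interleave A (f g : nat -> A) (i : nat) : A :=
  if odd i then g i./2 else f i./2.

Fixpoint skip n (g : nat -> nat) (i : nat) : nat :=
  match n, i with
  | 0%N, _ => g i
  | n.+1, 0%N => 0%N
  | n.+1, i.+1 => (skip n g i).+1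
  end.

Lemma vapp_skip n (v : ctx n) rho g i :
  vapp v rho (skip n g i) = vapp v (fun j => rho (g j)) i.
Proof. by elim: n v i => //= n IH [v x] [|i] //=; apply: IH. Qed.

Lemma sat_skip n (v : ctx n) rho sigma g h p :
  sat (M := M) (vapp v rho) sigma (fsubst (fun i => tvar (skip n g i)) h p) <->
  sat (M := M) (vapp v (fun j => rho (g j))) (fun j => sigma (h j)) p.
Proof.
rewrite sat_subst /=.
suff -> : (fun i => vapp v rho (skip n g i)) = vapp v (fun j => rho (g j)) by [].
by apply: functional_extensionality => i; rewrite vapp_skip.
Qed.

Lemma D0_common m n (P : ctx m -> Prop) (Q : ctx n -> Prop) : D0 P -> D0 Q ->
  exists p q rho sigma, bounded p /\ bounded q /\
    (forall v, P v <-> sat (M := M) (vapp v rho) sigma p) /\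
    (forall v, Q v <-> sat (M := M) (vapp v rho) sigma q).
Proof.
move=> [p [rho [sigma [Hp HP]]]] [q [rho' [sigma' [Hq HQ]]]].
pose h0 (i : nat) := i.*2; pose h1 (i : nat) := i.*2.+1.
have E0 A (f g : nat -> A) : (fun i => interleave f g (h0 i)) = f.
  by apply: functional_extensionality => i; rewrite /interleave /h0 odd_double doubleK.
have E1 A (f g : nat -> A) : (fun i => interleave f g (h1 i)) = g.
  by apply: functional_extensionality => i; rewrite /interleave /h1 /= odd_double uphalf_double.
exists (fsubst (fun i => tvar (skip m h0 i)) h0 p),
  (fsubst (fun i => tvar (skip n h1 i)) h1 q),
  (interleave rho rho'), (interleave sigma sigma').
split; first exact: bounded_subst.
split; first exact: bounded_subst.
by split=> v; rewrite sat_skip ?E0 ?E1.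
Qed.

Lemma D0_imp n (P Q : ctx n -> Prop) : D0 P -> D0 Q -> D0 (fun v => P v -> Q v).
Proof.
move=> HP HQ; have [p [q [rho [sigma [Hp [Hq [EP EQ]]]]]]] := D0_common HP HQ.
exists (Imp p q), rho, sigma; split; first exact: bd_imp.
by move=> v; rewrite EP EQ.
Qed.

Lemma D0_ball n (P : ctx n.+1 -> Prop) b : is_var b -> D0 P ->
  D0 (fun v => forall x, x ≺ b v -> P (v, x)).
Proof.
move=> [k _ Hb] [p [rho [sigma [Hp HP]]]].
exists (All1 (Imp (Lt (tvar 0) (tshift (tvar k))) p)), rho, sigma.
split; first exact: bd_all.
by move=> v /=; rewrite (Hb v rho); split=> H x Hx; apply/(HP (v, x))/H.
Qed.

Lemma D0_not n (P : ctx n -> Prop) : D0 P -> D0 (fun v => ~ P v).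
Proof. by move=> H; apply: D0_imp => //; apply: D0_False. Qed.

Lemma D0_and n (P Q : ctx n -> Prop) : D0 P -> D0 Q -> D0 (fun v => P v /\ Q v).
Proof.
move=> HP HQ; apply: (@D0_iff _ _ (fun v => ~ (P v -> ~ Q v))).
  by move=> v; split; tauto.
exact/D0_not/D0_imp/D0_not.
Qed.

Lemma D0_or n (P Q : ctx n -> Prop) : D0 P -> D0 Q -> D0 (fun v => P v \/ Q v).
Proof.
move=> HP HQ; apply: (@D0_iff _ _ (fun v => ~ P v -> Q v)).
  by move=> v; split; tauto.
exact/D0_imp/HQ/D0_not.
Qed.

Lemma D0_bex n (P : ctx n.+1 -> Prop) b : is_var b -> D0 P ->
  D0 (fun v => exists x, x ≺ b v /\ P (v, x)).
Proof.
move=> Hb HP; apply: (@D0_iff _ _ (fun v => ~ forall x, x ≺ b v -> ~ P (v, x))).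
  move=> v; split=> [[x [Hx Hv]] /(_ x Hx)|H] //.
  by apply: NNPP => Hn; apply: H => x Hx Hv; apply: Hn; exists x.
by apply/D0_not/(@D0_ball _ (fun w => ~ P w)) => //; apply: D0_not.
Qed.

Lemma D0_eq : D0 (fun v : ctx 2 => v.1.2 = v.2).
Proof.
exists (Eq (tvar 1) (tvar 0)), (fun=> 0), (fun=> rca_set M).
by split; [apply: bd_eq | move=> v].
Qed.

Lemma D0_lt : D0 (fun v : ctx 2 => v.1.2 ≺ v.2).
Proof.
exists (Lt (tvar 1) (tvar 0)), (fun=> 0), (fun=> rca_set M).
by split; [apply: bd_lt | move=> v].
Qed.

Lemma D0_add : D0 (fun v : ctx 3 => v.2 = v.1.1.2 + v.1.2).
Proof.
exists (Eq (tvar 0) (tadd (tvar 2) (tvar 1))), (fun=> 0), (fun=> rca_set M).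
by split; [apply: bd_eq | move=> v].
Qed.

Lemma D0_mul : D0 (fun v : ctx 3 => v.2 = v.1.1.2 * v.1.2).
Proof.
exists (Eq (tvar 0) (tmul (tvar 2) (tvar 1))), (fun=> 0), (fun=> rca_set M).
by split; [apply: bd_eq | move=> v].
Qed.

Lemma D0_mem X : D0 (fun v : ctx 1 => @mmem M v.2 X).
Proof.
exists (Defs.Mem (tvar 0) 0), (fun=> 0), (fun=> X).
by split; [apply: bd_mem | move=> v].
Qed.

(** * Sigma-1 predicates *)

Definition Sg1 n (P : ctx n -> Prop) : Prop :=
  exists R : ctx n.+1 -> Prop, D0 R /\ forall v, P v <-> exists x, R (v, x).

Lemma Sg1_iff n (P Q : ctx n -> Prop) : (forall v, P v <-> Q v) -> Sg1 Q -> Sg1 P.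
Proof. by move=> H [R [HR HQ]]; exists R; split=> // v; rewrite H. Qed.

Lemma Sg1_D0 n (P : ctx n -> Prop) : D0 P -> Sg1 P.
Proof.
move=> HP; exists (fun w => P w.1); split.
  by apply: (@D0_reindex _ _ (fun w : ctx n.+1 => w.1)) HP; reidx.
by move=> v; split=> [H|[x]] //; exists 0.
Qed.

Lemma Sg1_reindex m n (f : ctx m -> ctx n) P :
  reindexing f -> Sg1 P -> Sg1 (fun w => P (f w)).
Proof.
move=> Hf [R [HR HP]]; exists (fun w => R (f w.1, w.2)); split=> //.
apply: D0_reindex HR; apply: reindexing_var; last isvar.
exact: reindexing_fst.
Qed.

Lemma num_lt_add1 (x y : N) : x ≺ x + y + 1.
Proof. nlin. Qed.

Lemma Sg1_ex n (P : ctx n.+1 -> Prop) : Sg1 P -> Sg1 (fun v => exists x, P (v, x)).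
Proof.
move=> [R [HR HP]].
(* One unbounded quantifier is made a bound for both witnesses, which leaves a bounded matrix. *)
exists (fun w : ctx n.+1 => exists x, x ≺ w.2 /\ exists y, y ≺ w.2 /\ R (w.1, x, y)); split.
  apply: (@D0_bex n.+1 (fun w => exists y, y ≺ w.1.2 /\ R (w.1.1, w.2, y)) (fun w => w.2)).
    isvar.
  apply: (@D0_bex n.+2 (fun w => R (w.1.1.1, w.1.2, w.2)) (fun w => w.1.2)).
    isvar.
  apply: (@D0_reindex _ _ (fun w : ctx n.+3 => (w.1.1.1, w.1.2, w.2) : ctx n.+2)) HR.
  reidx.
move=> v; split=> [[x /HP [y Hy]]|[z [x [_ [y [_ Hy]]]]]]; last by exists x; apply/HP; exists y.
exists (x + y + 1); exists x; split; first exact: num_lt_add1.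
by exists y; split=> //; rewrite [x + y]addrC; apply: num_lt_add1.
Qed.

Lemma Sg1_and n (P Q : ctx n -> Prop) : Sg1 P -> Sg1 Q -> Sg1 (fun v => P v /\ Q v).
Proof.
move=> [R [HR HP]] [S [HS HQ]].
apply: (@Sg1_iff _ _ (fun v => exists x, exists y, R (v, x) /\ S (v, y))).
  move=> v; rewrite HP HQ; split=> [[[x Hx] [y Hy]]|[x [y [Hx Hy]]]]; first by exists x, y.
  by split; [exists x | exists y].
apply: (@Sg1_ex n (fun w => exists y, R w /\ S (w.1, y))).
apply: (@Sg1_ex n.+1 (fun w => R w.1 /\ S (w.1.1, w.2))).
apply/Sg1_D0/D0_and.
  by apply: (@D0_reindex n.+2 n.+1 (fun w => w.1) R) HR; reidx.
apply: (@D0_reindex _ _ (fun w : ctx n.+2 => (w.1.1, w.2) : ctx n.+1)) HS.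
reidx.
Qed.

Lemma Sg1_or n (P Q : ctx n -> Prop) : Sg1 P -> Sg1 Q -> Sg1 (fun v => P v \/ Q v).
Proof.
move=> [R [HR HP]] [S [HS HQ]]; exists (fun w => R w \/ S w); split; first exact: D0_or.
move=> v; rewrite HP HQ; split=> [[[x Hx]|[x Hx]]|[x [Hx|Hx]]].
- by exists x; left.
- by exists x; right.
- by left; exists x.
- by right; exists x.
Qed.

Lemma Sg1_induction (P : N -> Prop) : Sg1 (fun v : ctx 1 => P v.2) ->
  P 0 -> (forall x, P x -> P (x + 1)) -> forall x, P x.
Proof.
move=> [R [[p [rho [sigma [Hp HR]]]] HP]] H0 HS x.
have E y : P y <-> sat (M := M) (scons y rho) sigma (Ex1 p).
  rewrite sat_Ex1 (HP (tt, y)); by split=> -[z Hz]; exists z; apply/(HR (tt, y, z)).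
apply/E; apply: Sigma01_induction; first by constructor.
- exact/E.
- by move=> y /E /HS /E.
Qed.

(** Induction on an initial part [c] of the range: its bound is enlarged by the value found at [c]
    to serve [c + 1]. *)
Lemma collection (R : N -> N -> Prop) b : D0 (fun w : ctx 2 => R w.1.2 w.2) ->
  (forall x, x ≺ b -> exists y, R x y) ->
  exists z, forall x, x ≺ b -> exists y, y ≺ z /\ R x y.
Proof.
move=> HR Hb.
have [//|z Hz] : (b ≺ b \/ b = b) -> exists z, forall x, x ≺ b -> exists y, y ≺ z /\ R x y;
  [| by right | by exists z].
apply: (@Sg1_induction (fun c => (c ≺ b \/ c = b) ->
  exists z, forall x, x ≺ c -> exists y, y ≺ z /\ R x y)) => [|_|c IH Hc].
(* Classically [z] may be quantified before the guard, which yields a Sigma-0-1 form. *)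
- apply: (@Sg1_iff _ _ (fun v : ctx 1 => exists z, ((v.2 ≺ b \/ v.2 = b) ->
    forall x, x ≺ v.2 -> exists y, y ≺ z /\ R x y))).
    move=> v; split=> [H|[z Hz] /Hz H]; last by exists z.
    case: (classic (v.2 ≺ b \/ v.2 = b)) => [/H [z Hz]|Hn]; last by exists 0.
    by exists z.
  apply: (@Sg1_ex 1 (fun w => (w.1.2 ≺ b \/ w.1.2 = b) ->
    forall x, x ≺ w.1.2 -> exists y, y ≺ w.2 /\ R x y)).
  apply: Sg1_D0.
  have Hv : reindexing (fun w : ctx 2 => (tt, w.1.2, b) : ctx 2).
    reidx.
  apply: D0_imp.
    by apply: D0_or; [apply: D0_reindex Hv D0_lt | apply: D0_reindex Hv D0_eq].
  apply: (@D0_ball 2 (fun w => exists y, y ≺ w.1.2 /\ R w.2 y) (fun w => w.1.2)).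
    isvar.
  apply: (@D0_bex 3 (fun w => R w.1.2 w.2) (fun w => w.1.2)).
    isvar.
  apply: (@D0_reindex _ _ (fun w : ctx 4 => (tt, w.1.2, w.2) : ctx 2)) HR.
  reidx.
- by exists 0 => x /num_lt0.
- have Hcb : c ≺ b by case: Hc => [|<-]; [move=> H; nlin | apply/num_ltS; right].
  have [|z Hz] := IH; first by left.
  have [y Hy] := Hb c Hcb.
  exists (z + y + 1) => x /num_ltS [/Hz [t [Ht Hxt]]|->].
    by exists t; split=> //; nlin.
  by exists y; split=> //; nlin.
Qed.

(** Collection bounds the witnesses for all [x] below [b] at once, which brings the unbounded
    quantifier to the front. *)
Lemma Sg1_ball_var n (P : ctx n.+1 -> Prop) b : is_var b -> Sg1 P ->
  Sg1 (fun v => forall x, x ≺ b v -> P (v, x)).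
Proof.
move=> Hb [R [HR HP]].
apply: (@Sg1_iff _ _ (fun v => exists z, forall x, x ≺ b v -> exists y, y ≺ z /\ R (v, x, y))).
  move=> v; split=> [H|[z Hz] x /Hz [y [_ Hy]]]; last by apply/HP; exists y.
  apply: (@collection (fun x y => R (v, x, y))).
    apply: (@D0_reindex _ _ (fun w : ctx 2 => (v, w.1.2, w.2) : ctx n.+2)) HR.
    reidx.
  by move=> x /H /HP.
apply: (@Sg1_ex n (fun w => forall x, x ≺ b w.1 -> exists y, y ≺ w.2 /\ R (w.1, x, y))).
apply: Sg1_D0.
apply: (@D0_ball n.+1 (fun w => exists y, y ≺ w.1.2 /\ R (w.1.1, w.2, y)) (fun w => b w.1)).
  exact: is_var_fst.
apply: (@D0_bex n.+2 (fun w => R (w.1.1.1, w.1.2, w.2)) (fun w => w.1.2)).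
  isvar.
apply: (@D0_reindex _ _ (fun w : ctx n.+3 => (w.1.1.1, w.1.2, w.2) : ctx n.+2)) HR.
reidx.
Qed.

End Definability.

(** * Delta-1 predicates and functions *)

Section Computability.
Variable M : rca_model.
Local Notation N := (num M).
Local Notation ctx := (@ctx M).

Definition Dc n (P : ctx n -> Prop) : Prop := Sg1 P /\ Sg1 (fun v => ~ P v).

(** A Sigma-0-1 graph suffices: the function is total, so a wrong value is recognized by finding the
    right one. *)
Definition Cf n (f : ctx n -> N) : Prop := Sg1 (fun w : ctx n.+1 => w.2 = f w.1).

Lemma Dc_D0 n (P : ctx n -> Prop) : D0 P -> Dc P.
Proof. by move=> H; split; apply: Sg1_D0 => //; apply: D0_not. Qed.

Lemma Dc_iff n (P Q : ctx n -> Prop) : (forall v, P v <-> Q v) -> Dc Q -> Dc P.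
Proof.
by move=> H [H1 H2]; split; [apply: Sg1_iff H1 | apply: Sg1_iff H2] => v; rewrite H.
Qed.

Lemma Dc_not n (P : ctx n -> Prop) : Dc P -> Dc (fun v => ~ P v).
Proof. by move=> [H1 H2]; split=> //; apply: Sg1_iff H1 => v; tauto. Qed.

Lemma Dc_and n (P Q : ctx n -> Prop) : Dc P -> Dc Q -> Dc (fun v => P v /\ Q v).
Proof.
move=> [H1 H2] [H3 H4]; split; first exact: Sg1_and.
by apply: Sg1_iff (Sg1_or H2 H4) => v; split; tauto.
Qed.

Lemma Dc_or n (P Q : ctx n -> Prop) : Dc P -> Dc Q -> Dc (fun v => P v \/ Q v).
Proof.
move=> [H1 H2] [H3 H4]; split; first exact: Sg1_or.
by apply: Sg1_iff (Sg1_and H2 H4) => v; split; tauto.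
Qed.

Lemma Dc_imp n (P Q : ctx n -> Prop) : Dc P -> Dc Q -> Dc (fun v => P v -> Q v).
Proof.
move=> HP HQ; apply: (@Dc_iff _ _ (fun v => ~ P v \/ Q v)); first by move=> v; tauto.
exact: Dc_or (Dc_not HP) HQ.
Qed.

Lemma Dc_equiv n (P Q : ctx n -> Prop) : Dc P -> Dc Q -> Dc (fun v => P v <-> Q v).
Proof. by move=> HP HQ; apply: Dc_and; apply: Dc_imp. Qed.

Lemma Sg1_subst n (P : ctx n.+1 -> Prop) f : Cf f -> Sg1 P -> Sg1 (fun v => P (v, f v)).
Proof.
move=> Hf HP; apply: (@Sg1_iff _ _ _ (fun v => exists y, y = f v /\ P (v, y))).
  by move=> v; split=> [H|[y [->]]] //; exists (f v).
by apply: (@Sg1_ex _ n (fun w => w.2 = f w.1 /\ P w)); apply: Sg1_and.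
Qed.

Lemma Sg1_ball n (P : ctx n -> N -> Prop) f : Cf f -> Sg1 (fun w : ctx n.+1 => P w.1 w.2) ->
  Sg1 (fun v => forall x, x ≺ f v -> P v x).
Proof.
move=> Hf HP; apply: (Sg1_subst (P := fun w => forall x, x ≺ w.2 -> P w.1 x) Hf).
apply: (@Sg1_ball_var _ n.+1 (fun w => P w.1.1 w.2)); first isvar.
by apply: (@Sg1_reindex _ n.+2 n.+1 (fun w => (w.1.1, w.2))) HP; reidx.
Qed.

Lemma Cf_reindex m n (g : ctx m -> ctx n) f : reindexing g -> Cf f -> Cf (fun w => f (g w)).
Proof.
move=> Hg Hf; apply: (@Sg1_reindex _ m.+1 n.+1 (fun w => (g w.1, w.2))) Hf.
apply: reindexing_var; last isvar.
exact: reindexing_fst.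
Qed.

Lemma Cf_weak n (f : ctx n -> N) : Cf f -> Cf (fun w : ctx n.+1 => f w.1).
Proof. by apply: Cf_reindex; reidx. Qed.

Lemma Cf_var n (x : ctx n -> N) : is_var x -> Cf x.
Proof.
move=> Hx; apply: Sg1_D0.
apply: (@D0_reindex _ n.+1 2 (fun w => (tt, w.2, x w.1)) (fun w => w.1.2 = w.2)); last exact: D0_eq.
by apply: reindexing_var; [reidx | apply: is_var_fst].
Qed.

Lemma Cf_const n c : Cf (fun _ : ctx n => c).
Proof.
apply: Sg1_D0.
apply: (@D0_reindex _ n.+1 2 (fun w => (tt, w.2, c)) (fun w => w.1.2 = w.2)); last exact: D0_eq.
by reidx.
Qed.

Section Application.
Variable n : nat.
Implicit Types f g h k : ctx n -> N.

Lemma Sg1_app1 (P : N -> Prop) f :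
  Sg1 (fun w : ctx 1 => P w.2) -> Cf f -> Sg1 (fun v => P (f v)).
Proof.
move=> HP Hf; apply: (Sg1_subst (P := fun w : ctx n.+1 => P w.2) Hf).
by apply: (@Sg1_reindex _ n.+1 1 (fun w => (tt, w.2))) HP; reidx.
Qed.

Lemma Sg1_app2 (P : N -> N -> Prop) f g :
  Sg1 (fun w : ctx 2 => P w.1.2 w.2) -> Cf f -> Cf g -> Sg1 (fun v => P (f v) (g v)).
Proof.
move=> HP Hf Hg; apply: (Sg1_subst (P := fun w : ctx n.+1 => P (f w.1) w.2) Hg).
apply: (Sg1_subst (P := fun w : ctx n.+2 => P w.2 w.1.2) (Cf_weak Hf)).
by apply: (@Sg1_reindex _ n.+2 2 (fun w => (tt, w.2, w.1.2))) HP; reidx.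
Qed.

Lemma Sg1_app3 (P : N -> N -> N -> Prop) f g h :
  Sg1 (fun w : ctx 3 => P w.1.1.2 w.1.2 w.2) -> Cf f -> Cf g -> Cf h ->
  Sg1 (fun v => P (f v) (g v) (h v)).
Proof.
move=> HP Hf Hg Hh; apply: (Sg1_subst (P := fun w : ctx n.+1 => P (f w.1) (g w.1) w.2) Hh).
apply: (Sg1_subst (P := fun w : ctx n.+2 => P (f w.1.1) w.2 w.1.2) (Cf_weak Hg)).
apply: (Sg1_subst (P := fun w : ctx n.+3 => P w.2 w.1.2 w.1.1.2) (Cf_weak (Cf_weak Hf))).
by apply: (@Sg1_reindex _ n.+3 3 (fun w => (tt, w.2, w.1.2, w.1.1.2))) HP; reidx.
Qed.

Lemma Sg1_app4 (P : N -> N -> N -> N -> Prop) f g h k :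
  Sg1 (fun w : ctx 4 => P w.1.1.1.2 w.1.1.2 w.1.2 w.2) -> Cf f -> Cf g -> Cf h -> Cf k ->
  Sg1 (fun v => P (f v) (g v) (h v) (k v)).
Proof.
move=> HP Hf Hg Hh Hk.
apply: (Sg1_subst (P := fun w : ctx n.+1 => P (f w.1) (g w.1) (h w.1) w.2) Hk).
apply: (Sg1_subst (P := fun w : ctx n.+2 => P (f w.1.1) (g w.1.1) w.2 w.1.2) (Cf_weak Hh)).
apply: (Sg1_subst (P := fun w : ctx n.+3 => P (f w.1.1.1) w.2 w.1.2 w.1.1.2) (Cf_weak (Cf_weak Hg))).
apply: (Sg1_subst (P := fun w : ctx n.+4 => P w.2 w.1.2 w.1.1.2 w.1.1.1.2) (Cf_weak (Cf_weak (Cf_weak Hf)))).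
by apply: (@Sg1_reindex _ n.+4 4 (fun w => (tt, w.2, w.1.2, w.1.1.2, w.1.1.1.2))) HP; reidx.
Qed.

Lemma Cf_app1 (F : N -> N) f : Cf (fun w : ctx 1 => F w.2) -> Cf f -> Cf (fun v => F (f v)).
Proof.
move=> HF Hf; rewrite /Cf.
apply: (Sg1_subst (P := fun w : ctx n.+2 => w.1.2 = F w.2) (Cf_weak Hf)).
by apply: (@Sg1_reindex _ n.+2 2 (fun w => (tt, w.2, w.1.2))) HF; reidx.
Qed.

Lemma Cf_app2 (F : N -> N -> N) f g :
  Cf (fun w : ctx 2 => F w.1.2 w.2) -> Cf f -> Cf g -> Cf (fun v => F (f v) (g v)).
Proof.
move=> HF Hf Hg; rewrite /Cf.
apply: (Sg1_subst (P := fun w : ctx n.+2 => w.1.2 = F (f w.1.1) w.2) (Cf_weak Hg)).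
apply: (Sg1_subst (P := fun w : ctx n.+3 => w.1.1.2 = F w.2 w.1.2) (Cf_weak (Cf_weak Hf))).
by apply: (@Sg1_reindex _ n.+3 3 (fun w => (tt, w.2, w.1.2, w.1.1.2))) HF; reidx.
Qed.

Lemma Cf_app3 (F : N -> N -> N -> N) f g h :
  Cf (fun w : ctx 3 => F w.1.1.2 w.1.2 w.2) -> Cf f -> Cf g -> Cf h ->
  Cf (fun v => F (f v) (g v) (h v)).
Proof.
move=> HF Hf Hg Hh; rewrite /Cf.
apply: (Sg1_subst (P := fun w : ctx n.+2 => w.1.2 = F (f w.1.1) (g w.1.1) w.2) (Cf_weak Hh)).
apply: (Sg1_subst (P := fun w : ctx n.+3 => w.1.1.2 = F (f w.1.1.1) w.2 w.1.2) (Cf_weak (Cf_weak Hg))).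
apply: (Sg1_subst (P := fun w : ctx n.+4 => w.1.1.1.2 = F w.2 w.1.2 w.1.1.2) (Cf_weak (Cf_weak (Cf_weak Hf)))).
by apply: (@Sg1_reindex _ n.+4 4 (fun w => (tt, w.2, w.1.2, w.1.1.2, w.1.1.1.2))) HF; reidx.
Qed.

Lemma Dc_app1 (P : N -> Prop) f :
  Dc (fun w : ctx 1 => P w.2) -> Cf f -> Dc (fun v => P (f v)).
Proof. by move=> [H1 H2] Hf; split; [apply: Sg1_app1 | apply: (@Sg1_app1 (fun x => ~ P x))]. Qed.

Lemma Dc_app2 (P : N -> N -> Prop) f g :
  Dc (fun w : ctx 2 => P w.1.2 w.2) -> Cf f -> Cf g -> Dc (fun v => P (f v) (g v)).
Proof.
by move=> [H1 H2] Hf Hg; split; [apply: Sg1_app2 | apply: (@Sg1_app2 (fun x y => ~ P x y))].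
Qed.

Lemma Dc_app3 (P : N -> N -> N -> Prop) f g h :
  Dc (fun w : ctx 3 => P w.1.1.2 w.1.2 w.2) -> Cf f -> Cf g -> Cf h ->
  Dc (fun v => P (f v) (g v) (h v)).
Proof.
by move=> [H1 H2] Hf Hg Hh; split;
  [apply: Sg1_app3 | apply: (@Sg1_app3 (fun x y z => ~ P x y z))].
Qed.

Lemma Dc_app4 (P : N -> N -> N -> N -> Prop) f g h k :
  Dc (fun w : ctx 4 => P w.1.1.1.2 w.1.1.2 w.1.2 w.2) -> Cf f -> Cf g -> Cf h -> Cf k ->
  Dc (fun v => P (f v) (g v) (h v) (k v)).
Proof.
by move=> [H1 H2] Hf Hg Hh Hk; split;
  [apply: Sg1_app4 | apply: (@Sg1_app4 (fun x y z t => ~ P x y z t))].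
Qed.

Lemma Cf_add f g : Cf f -> Cf g -> Cf (fun v => f v + g v).
Proof. by apply: (@Cf_app2 +%R); apply: Sg1_D0; apply: D0_add. Qed.

Lemma Cf_mul f g : Cf f -> Cf g -> Cf (fun v => f v * g v).
Proof. by apply: (@Cf_app2 *%R); apply: Sg1_D0; apply: D0_mul. Qed.

Lemma Dc_eq f g : Cf f -> Cf g -> Dc (fun v => f v = g v).
Proof. by apply: (@Dc_app2 (fun x y => x = y)); apply/Dc_D0/D0_eq. Qed.

Lemma Dc_lt f g : Cf f -> Cf g -> Dc (fun v => f v ≺ g v).
Proof. by apply: (@Dc_app2 (fun x y => x ≺ y)); apply/Dc_D0/D0_lt. Qed.

Lemma Dc_mem f (X : sets M) : Cf f -> Dc (fun v => @mmem M (f v) X).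
Proof. by apply: (@Dc_app1 (fun x => @mmem M x X)); apply/Dc_D0/D0_mem. Qed.

Lemma Dc_ball (P : ctx n -> N -> Prop) f : Cf f -> Dc (fun w : ctx n.+1 => P w.1 w.2) ->
  Dc (fun v => forall x, x ≺ f v -> P v x).
Proof.
move=> Hf [H1 H2]; split; first exact: Sg1_ball.
apply: (@Sg1_iff _ _ _ (fun v => exists x, x ≺ f v /\ ~ P v x)).
  move=> v; split=> [H|[x [Hx Hn]] /(_ x Hx)] //; apply: NNPP => Hn; apply: H => x Hx.
  by apply: NNPP => HP; apply: Hn; exists x.
apply: (@Sg1_ex _ n (fun w => w.2 ≺ f w.1 /\ ~ P w.1 w.2)); apply: Sg1_and => //.
have : Dc (fun w : ctx 2 => w.1.2 ≺ w.2) by apply/Dc_D0/D0_lt.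
move=> [H _]; apply: (Sg1_subst (P := fun w : ctx n.+2 => w.1.2 ≺ w.2) (Cf_weak Hf)).
by apply: (@Sg1_reindex _ n.+2 2 (fun w => (tt, w.1.2, w.2))) H; reidx.
Qed.

Lemma Dc_bex (P : ctx n -> N -> Prop) f : Cf f -> Dc (fun w : ctx n.+1 => P w.1 w.2) ->
  Dc (fun v => exists x, x ≺ f v /\ P v x).
Proof.
move=> Hf HP; apply: (@Dc_iff _ _ (fun v => ~ forall x, x ≺ f v -> ~ P v x)).
  move=> v; split=> [[x [Hx Hv]] /(_ x Hx)|H] //.
  by apply: NNPP => Hn; apply: H => x Hx Hv; apply: Hn; exists x.
by apply/Dc_not/(@Dc_ball (fun v x => ~ P v x)) => //; apply: Dc_not.
Qed.

Lemma Cf_if (P : ctx n -> Prop) f g : Dc P -> Cf f -> Cf g ->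
  Cf (fun v => if boolp.asbool (P v) then f v else g v).
Proof.
move=> [H1 H2] Hf Hg.
apply: (@Sg1_iff _ n.+1 _ (fun w => (P w.1 /\ w.2 = f w.1) \/ (~ P w.1 /\ w.2 = g w.1))).
  by move=> w; case: boolp.asboolP => H; tauto.
apply: Sg1_or; apply: Sg1_and => //.
  by apply: (@Sg1_reindex _ n.+1 n (fun w => w.1)) H1; reidx.
by apply: (@Sg1_reindex _ n.+1 n (fun w => w.1)) H2; reidx.
Qed.

End Application.

Lemma Sg1_fix n (P : ctx n.+1 -> Prop) v : Sg1 P -> Sg1 (fun w : ctx 1 => P (v, w.2)).
Proof. by move=> HP; apply: (@Sg1_reindex _ 1 n.+1 (fun w => (v, w.2))) HP; reidx. Qed.

Lemma Dc_fix n (P : ctx n.+1 -> Prop) v : Dc P -> Dc (fun w : ctx 1 => P (v, w.2)).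
Proof.
move=> [H1 H2]; split; first exact: Sg1_fix.
exact: (@Sg1_fix n (fun w => ~ P w)).
Qed.

(** The induction runs over the Sigma-0-1 statement that all numbers below [x] lack the property.
    Thus [Q] may be properly Pi-0-1, as it is in [stable_step]. *)
Lemma least_number (Q : N -> Prop) : Sg1 (fun w : ctx 1 => ~ Q w.2) ->
  (exists x, Q x) -> exists x, Q x /\ forall y, y ≺ x -> ~ Q y.
Proof.
move=> HQ [x0 Hx0]; apply: NNPP => Hn.
suff H x : forall y, y ≺ x -> ~ Q y by apply: (H (x0 + 1) x0) => //; apply/num_ltS; right.
apply: (@Sg1_induction _ (fun x => forall y, y ≺ x -> ~ Q y)) x => [|y /num_lt0|x IH y] //.
  apply: (@Sg1_ball 1 (fun _ y => ~ Q y) (fun v => v.2)).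
    by apply: Cf_var; isvar.
  by apply: (@Sg1_reindex _ 2 1 (fun w => (tt, w.2))) HQ; reidx.
move=> /num_ltS [/IH|->] // Hx; apply: Hn; by exists x.
Qed.

Definition mu (Q : N -> Prop) : N :=
  epsilon (inhabits 0) (fun x => Q x /\ forall y, y ≺ x -> ~ Q y).

Lemma muP (Q : N -> Prop) : Dc (fun w : ctx 1 => Q w.2) -> (exists x, Q x) ->
  Q (mu Q) /\ forall y, y ≺ mu Q -> ~ Q y.
Proof.
by move=> [_ H] /(least_number H); apply: (epsilon_spec (inhabits 0)).
Qed.

Lemma Cf_mu n (Q : ctx n -> N -> Prop) : Dc (fun w : ctx n.+1 => Q w.1 w.2) ->
  (forall v, exists x, Q v x) -> Cf (fun v => mu (Q v)).
Proof.
move=> HQ Hex.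
apply: (@Sg1_iff _ n.+1 _ (fun w => Q w.1 w.2 /\ forall y, y ≺ w.2 -> ~ Q w.1 y)).
  move=> w; have [H1 H2] := muP (Dc_fix w.1 HQ) (Hex w.1); split=> [->|[H3 H4]] //.
  by case: (num_lt_total w.2 (mu (Q w.1))) => [/H2|[|/H4]].
apply: Sg1_and; first exact: (proj1 HQ).
apply: (@Sg1_ball n.+1 (fun w y => ~ Q w.1 y) (fun w => w.2)).
  by apply: Cf_var; isvar.
by apply: (@Sg1_reindex _ n.+2 n.+1 (fun w => (w.1.1, w.2)) (fun w => ~ Q w.1 w.2)) (proj2 HQ); reidx.
Qed.

(** An instance of the scheme evaluates its two formulas under one valuation, hence the appeal to
    [D0_common]; the Pi-0-1 form of [P] comes from its complement. *)
Lemma comprehension (P : N -> Prop) : Dc (fun w : ctx 1 => P w.2) ->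
  exists X : sets M, forall x : N, @mmem M x X <-> P x.
Proof.
move=> [[R [HR HP]] [S [HS HQ]]].
have [p [q [rho [sigma [Hp [Hq [EP EQ]]]]]]] := D0_common HR HS.
have Hp1 x : sat (M := M) (scons x rho) sigma (Ex1 p) <-> P x.
  by rewrite sat_Ex1 (HP (tt, x)); split=> -[z Hz]; exists z; apply/(EP (tt, x, z)).
have Hq1 x : sat (M := M) (scons x rho) sigma (All1 (Neg q)) <-> P x.
  split=> [H|H z].
    apply: NNPP => /(HQ (tt, x)) [z /EQ Hz]; exact: H Hz.
  move=> /(EQ (tt, x, z)) Hz; have : ~ P x by apply/(HQ (tt, x)); exists z.
  by [].
have := @rca_sat M _ (RCA0_comprehension _ (delta01_comprehension_intro _ _
  (Sigma01_intro _ Hp) (Pi01_intro _ (bd_imp _ _ Hq bd_bot)))) rho sigma.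
move=> H; have /sat_Ex2 [X HX] : sat (M := M) rho sigma
    (Ex2 (All1 (Iff (Defs.Mem (tvar 0) 0) (fshift2 (Ex1 p))))).
  apply: H => x; rewrite -/(sat (M := M) (scons x rho) sigma (Iff (Ex1 p) (All1 (Neg q)))).
  by rewrite sat_Iff Hp1 Hq1.
exists X => x; have /sat_Iff := (HX x : sat (M := M) (scons x rho) (scons X sigma)
  (Iff (Defs.Mem (tvar 0) 0) (fshift2 (Ex1 p)))).
by rewrite [X in _ <-> X]sat_subst Hp1.
Qed.

(** The condition on the complement makes [Q] Pi-0-1, so the quantifier over [y] in front of it
    gives a Sigma-0-2 formula. *)
Lemma Sigma02_ind (Q : N -> N -> Prop) : models M ISigma02 ->
  Sg1 (fun w : ctx 2 => ~ Q w.1.2 w.2) ->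
  (exists y, Q 0 y) -> (forall x, (exists y, Q x y) -> exists y, Q (x + 1) y) ->
  forall x, exists y, Q x y.
Proof.
move=> HM [R [[r [rho [sigma [Hr HR]]]] HQ]] H0 HS x.
have E y : (exists z, Q y z) <-> sat (M := M) (scons y rho) sigma (Ex1 (All1 (Neg r))).
  have HQ' z : Q y z <-> forall t, ~ R (tt, y, z, t).
    split=> [Hz t Ht|H]; first by apply: (proj2 (HQ (tt, y, z))) => //; exists t.
    by apply: NNPP => /(HQ (tt, y, z)) [t /H].
  rewrite sat_Ex1; split=> -[z Hz]; exists z.
    by move=> t /(HR (tt, y, z, t)); apply: (proj1 (HQ' z)).
  by apply: (proj2 (HQ' z)) => t /HR; apply: Hz.
apply/E; apply: sat_induction.
- by apply: HM; constructor; constructor; constructor; apply: bd_imp => //; apply: bd_bot.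
- exact/E.
- by move=> y /E /HS /E.
Qed.

End Computability.

(** * The semantic counterparts of the definitions *)

(* The language has only falsum, implication and universal quantifiers.  The
   definitions are interpreted over an abstract choice of the remaining
   connectives: with the encoded ones the interpretation is convertible to [sat],
   and the encoded ones are equal to the usual ones. *)
Record logic (M : rca_model) := Logic {
  c_and : Prop -> Prop -> Prop;
  c_or : Prop -> Prop -> Prop;
  c_iff : Prop -> Prop -> Prop;
  c_ex1 : (num M -> Prop) -> Prop;
  c_ex2 : (sets M -> Prop) -> Prop }.

Section Encoded.
Variable M : rca_model.

Definition std : logic M := {|
  c_and := and; c_or := or; c_iff := iff;
  c_ex1 := @ex (num M); c_ex2 := @ex (sets M) |}.

Definition enc : logic M :=
  let conj P Q := (P -> Q -> False) -> False in {|
  c_and := conj;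
  c_or P Q := (P -> False) -> Q;
  c_iff P Q := conj (P -> Q) (Q -> P);
  c_ex1 P := (forall x, P x -> False) -> False;
  c_ex2 P := (forall X, P X -> False) -> False |}.

Lemma enc_std : enc = std.
Proof.
have E A (P : A -> Prop) : ((forall x, P x -> False) -> False) = exists x, P x.
  apply: propositional_extensionality; split=> [H|[x Hx] /(_ x)]; last exact.
  by apply: NNPP => Hn; apply: H => x Hx; apply: Hn; exists x.
rewrite /enc /std; congr Logic.
- by do 2!apply: functional_extensionality => ?; apply: propositional_extensionality; tauto.
- by do 2!apply: functional_extensionality => ?; apply: propositional_extensionality; tauto.
- by do 2!apply: functional_extensionality => ?; apply: propositional_extensionality; tauto.
- by apply: functional_extensionality => P; rewrite E.
- by apply: functional_extensionality => P; rewrite E.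
Qed.

End Encoded.

Section Semantics.
Variables (M : rca_model) (L : logic M).
Local Notation N := (num M).
Local Notation "P ∧ Q" := (c_and L P Q) (at level 80, right associativity).
Local Notation "P ∨ Q" := (c_or L P Q) (at level 85, right associativity).
Local Notation "P ⇔ Q" := (c_iff L P Q) (at level 95, no associativity).
Local Notation "'Ex' x .. y , P" := (c_ex1 L (fun x => .. (c_ex1 L (fun y => P)) ..))
  (at level 200, x binder, y binder).
Local Notation "'EX' x , P" := (c_ex2 L (fun x : sets M => P)) (at level 200).
Local Notation "x ∈ X" := (@mmem M x X) (at level 70).
Local Notation "x ⪯ y" := (x ≺ y ∨ x = y) (at level 70).

Definition ntriple (x y z : N) : N := npair x (npair y z).

Definition sfin_mem (i s : N) : Prop :=
  Ex k m n, s = ntriple k m n ∧ i ≺ k ∧ Ex c, n = c * (m * (i + 1) + 1).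

Definition sis_triple (s : N) : Prop := Ex k m n, s = ntriple k m n.

Definition sfin_set (s : N) : Prop :=
  sis_triple s ∧ forall s' : N, s' ≺ s -> sis_triple s' ->
    ~ (forall i : N, sfin_mem i s' ⇔ sfin_mem i s).

Definition sbin_seq (s l : N) : Prop :=
  sfin_set s ∧
  (forall x : N, sfin_mem x s ->
    Ex i b, i ≺ l ∧ (b = 0 ∨ b = 1) ∧ x = npair i b) ∧
  (forall i : N, i ≺ l -> (sfin_mem (npair i 0) s ⇔ ~ sfin_mem (npair i 1) s)).

Definition sin_bin (s : N) : Prop := Ex l, sbin_seq s l.

Definition sextends (s t : N) : Prop := forall x : N, sfin_mem x s -> sfin_mem x t.

Definition sinitial_segment (G : sets M) (k s : N) : Prop :=
  sbin_seq s k ∧ forall i : N, i ≺ k -> (sfin_mem (npair i 1) s ⇔ i ∈ G).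

Definition sin_D (X : sets M) (i s : N) : Prop :=
  sin_bin s ∧ forall n : N, ntriple s i n ∈ X.

Definition sPi01G : Prop := forall X : sets M,
  (forall i s : N, sin_bin s -> Ex t, sin_D X i t ∧ sextends s t) ->
  EX G, forall i : N, Ex k s, sinitial_segment G k s ∧ sin_D X i s.

Definition srep_rel (R : N -> N -> Prop) (p q : N) : Prop :=
  Ex m n d m' n' d', p = ntriple m n d ∧ q = ntriple m' n' d' ∧
    R (m * (d' + 1) + n' * (d + 1)) (m' * (d + 1) + n * (d' + 1)).

Definition ssame_value : N -> N -> Prop := srep_rel (fun t u => t = u).
Definition srat_lt : N -> N -> Prop := srep_rel (fun t u => t ≺ u).
Definition srat_le : N -> N -> Prop := srep_rel (fun t u => t ⪯ u).

Definition sis_rat (q : N) : Prop :=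
  sis_triple q ∧ forall q' : N, q' ≺ q -> ~ ssame_value q' q.

Definition srat_pos (q : N) : Prop := sis_rat q ∧ srat_lt (ntriple 0 0 0) q.

Definition srat_add (p q s : N) : Prop :=
  sis_rat s ∧
  Ex m n d m' n' d', p = ntriple m n d ∧ q = ntriple m' n' d' ∧
    ssame_value s (ntriple (m * (d' + 1) + m' * (d + 1))
                           (n * (d' + 1) + n' * (d + 1))
                           (d * d' + d + d')).

Definition srat_dist (p q s : N) : Prop :=
  sis_rat s ∧ srat_le (ntriple 0 0 0) s ∧ (srat_add s q p ∨ srat_add s p q).

Definition sset_seq (x : sets M) : N -> N -> Prop := fun n q => npair n q ∈ x.
Definition sconst_seq (a : N) : N -> N -> Prop := fun _ q => q = a.
Definition sdist_seq (x y : N -> N -> Prop) : N -> N -> Prop :=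
  fun n s => Ex p q, x n p ∧ y n q ∧ srat_dist p q s.

Definition sis_real (x : sets M) : Prop :=
  (forall z : N, z ∈ x -> Ex n q, sis_rat q ∧ z = npair n q) ∧
  (forall n : N, Ex q, npair n q ∈ x ∧ forall q' : N, npair n q' ∈ x -> q' = q) ∧
  (forall e : N, srat_pos e -> Ex n0, forall m n : N, n0 ⪯ m -> n0 ⪯ n ->
    forall p q s : N, npair m p ∈ x -> npair n q ∈ x -> srat_dist p q s ->
      srat_lt s e).

Definition sreal_le (x y : N -> N -> Prop) : Prop :=
  forall e : N, srat_pos e -> Ex n0, forall n : N, n0 ⪯ n ->
    forall p q s : N, x n p -> y n q -> srat_add q e s -> srat_le p s.

Definition sreal_eq (x y : N -> N -> Prop) : Prop := sreal_le x y ∧ sreal_le y x.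
Definition sreal_lt (x y : N -> N -> Prop) : Prop := sreal_le x y ∧ ~ sreal_eq x y.

Definition sin_ball (x : sets M) (a r : N) : Prop :=
  sreal_lt (sdist_seq (sconst_seq a) (sset_seq x)) (sconst_seq r).

Definition sof_sv (U : sets M) : N -> Prop := fun z => z ∈ U.
Definition ssection (W : sets M) (i : N) : N -> Prop := fun z => npair i z ∈ W.

Definition sopen_code (U : N -> Prop) : Prop :=
  forall z, U z -> Ex n a r, sis_rat a ∧ srat_pos r ∧ z = ntriple n a r.

Definition sin_open (x : sets M) (U : N -> Prop) : Prop :=
  Ex n0 a r, sis_rat a ∧ srat_pos r ∧ sin_ball x a r ∧
    forall n : N, n0 ⪯ n -> U (ntriple n a r).

Definition sdense (A : sets M -> Prop) : Prop :=
  forall V : sets M, sopen_code (sof_sv V) ->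
    (EX x, sis_real x ∧ sin_open x (sof_sv V)) ->
    EX y, sis_real y ∧ A y ∧ sin_open y (sof_sv V).

Definition sBaire : Prop := forall W : sets M,
  (forall i : N, sopen_code (ssection W i)) ->
  (forall i : N, sdense (fun x => sin_open x (ssection W i))) ->
  sdense (fun x => forall i : N, sin_open x (ssection W i)).

End Semantics.

Lemma sat_Baire (M : rca_model) rho sigma :
  sat (M := M) rho sigma Baire_category_theorem <-> sBaire (std M).
Proof. by rewrite -enc_std. Qed.

Lemma sat_Pi01G (M : rca_model) rho sigma :
  sat (M := M) rho sigma Pi01G <-> sPi01G (std M).
Proof. by rewrite -enc_std. Qed.

(** An entry point, redefined as more functions and predicates are shown to be computable. *)
Ltac dc_hook := fail.

Ltac dc_step :=
  cbv beta;
  lazymatch goal with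
  | |- Dc (fun _ => _ /\ _) => apply Dc_and
  | |- Dc (fun _ => _ \/ _) => apply Dc_or
  | |- Dc (fun _ => _ <-> _) => apply Dc_equiv
  | |- Dc (fun _ => ~ _) => apply Dc_not
  | |- Dc (fun _ => forall x, x ≺ _ -> _) => apply Dc_ball
  | |- Dc (fun _ => exists x, x ≺ _ /\ _) => apply Dc_bex
  | |- Dc (fun _ => _ -> _) => apply Dc_imp
  | |- Dc (fun _ => _ = _) => apply Dc_eq
  | |- Dc (fun _ => _ ≺ _) => apply Dc_lt
  | |- Dc (fun _ => mmem _ _) => apply Dc_mem
  | |- Dc _ => dc_hook
  | |- Cf (fun _ => if boolp.asbool _ then _ else _) => apply Cf_if
  | |- Cf (fun _ => ?c) => apply Cf_const
  | |- Cf (fun _ => snd _) => apply Cf_var; isvar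
  | |- Cf snd => apply Cf_var; isvar
  | |- Cf (fun _ => _ + _) => apply Cf_add
  | |- Cf (fun _ => _ * _) => apply Cf_mul
  | |- Cf _ => first [ assumption | dc_hook ]
  end.

Ltac dc := repeat dc_step.

(** * Decoding pairs *)

Section Decoding.
Variable M : rca_model.
Local Notation N := (num M).
Implicit Types x y z s : N.

Lemma num_lt_le x : x ≺ x + 1. Proof. nlin. Qed.

Lemma Cf_npair n (f g : ctx M n -> N) : Cf f -> Cf g -> Cf (fun v => npair (f v) (g v)).
Proof. by move=> Hf Hg; apply: Cf_add => //; apply: Cf_mul; apply: Cf_add. Qed.

Lemma Cf_ntriple n (f g h : ctx M n -> N) :
  Cf f -> Cf g -> Cf h -> Cf (fun v => ntriple (f v) (g v) (h v)).
Proof. by move=> Hf Hg Hh; apply: Cf_npair => //; apply: Cf_npair. Qed.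

(* Numbers that are not pairs decode to values out of reach. *)
Definition pr1 s : N :=
  mu (fun x => (exists y, y ≺ s + 1 /\ s = npair x y) \/ x = s + 1).
Definition pr2 s : N :=
  mu (fun y => (exists x, x ≺ s + 1 /\ s = npair x y) \/ y = s + 1).

Lemma num_lt_le_trans x y z : x ≺ y -> y ≼ z -> x ≺ z.
Proof. move=> H H'; nlin. Qed.

Lemma num_le_lt_trans x y z : x ≼ y -> y ≺ z -> x ≺ z.
Proof. move=> H H'; nlin. Qed.

Lemma num_le_lt x y : x ≼ y -> x ≺ y + 1.
Proof. by move/num_ltS. Qed.

Lemma pr1_npair x y : pr1 (npair x y) = x.
Proof.
set s := npair x y.
have [||H _] := @muP M (fun x => (exists y, y ≺ s + 1 /\ s = npair x y) \/ x = s + 1).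
- by dc; apply: Cf_npair; dc.
- by exists (s + 1); right.
case: H => [[y' [_ /npair_inj [-> _]]]|E] //.
have [||_ H] := @muP M (fun x => (exists y, y ≺ s + 1 /\ s = npair x y) \/ x = s + 1).
- by dc; apply: Cf_npair; dc.
- by exists (s + 1); right.
case: (H x); last by left; exists y; split=> //; apply/num_le_lt/npair_ge2.
by rewrite -/(pr1 s) in E; rewrite -/(pr1 s) E; apply/num_le_lt/npair_ge1.
Qed.

Lemma pr2_npair x y : pr2 (npair x y) = y.
Proof.
set s := npair x y.
have [||H _] := @muP M (fun y => (exists x, x ≺ s + 1 /\ s = npair x y) \/ y = s + 1).
- by dc; apply: Cf_npair; dc.
- by exists (s + 1); right.
case: H => [[y' [_ /npair_inj [_ ->]]]|E] //.
have [||_ H] := @muP M (fun y => (exists x, x ≺ s + 1 /\ s = npair x y) \/ y = s + 1).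
- by dc; apply: Cf_npair; dc.
- by exists (s + 1); right.
case: (H y); last by left; exists x; split=> //; apply/num_le_lt/npair_ge1.
by rewrite -/(pr2 s) in E; rewrite -/(pr2 s) E; apply/num_le_lt/npair_ge2.
Qed.

Lemma Cf_pr1 n (f : ctx M n -> N) : Cf f -> Cf (fun v => pr1 (f v)).
Proof.
apply: (@Cf_app1 M n pr1).
apply: (@Cf_mu M 1 (fun v x => (exists y, y ≺ v.2 + 1 /\ v.2 = npair x y) \/ x = v.2 + 1)).
  by dc; apply: Cf_npair; dc.
by move=> v; exists (v.2 + 1); right.
Qed.

Lemma Cf_pr2 n (f : ctx M n -> N) : Cf f -> Cf (fun v => pr2 (f v)).
Proof.
apply: (@Cf_app1 M n pr2).
apply: (@Cf_mu M 1 (fun v y => (exists x, x ≺ v.2 + 1 /\ v.2 = npair x y) \/ y = v.2 + 1)).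
  by dc; apply: Cf_npair; dc.
by move=> v; exists (v.2 + 1); right.
Qed.

End Decoding.

Ltac dc_hook ::= lazymatch goal with
  | |- Cf (fun _ => npair _ _) => apply Cf_npair
  | |- Cf (fun _ => ntriple _ _ _) => apply Cf_ntriple
  | |- Cf (fun _ => pr1 _) => apply Cf_pr1
  | |- Cf (fun _ => pr2 _) => apply Cf_pr2
  end.

(** * Finite sets coded by divisibility *)

Section FiniteSets.
Variable M : rca_model.
Local Notation N := (num M).
Local Notation L := (std M).
Implicit Types x y z i j k m n s t : N.

Lemma is_tripleE s : sis_triple L s <-> s = ntriple (pr1 s) (pr1 (pr2 s)) (pr2 (pr2 s)).
Proof.
split=> [[k [m [n ->]]]|->]; last by do 3!eexists.
by rewrite /ntriple pr1_npair !pr2_npair pr1_npair.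
Qed.

Lemma Dc_is_triple q (f : ctx M q -> N) : Cf f -> Dc (fun v => sis_triple L (f v)).
Proof.
by move=> Hf; apply: Dc_iff (fun v => is_tripleE (f v)) _; dc.
Qed.

Definition dvd x y : Prop := exists c, y = c * x.

Lemma dvd_mull x y z : dvd x y -> dvd x (z * y).
Proof. by move=> [c ->]; exists (z * c); rewrite mulrA. Qed.

Lemma dvd_mulr x y z : dvd x y -> dvd x (y * z).
Proof. by rewrite mulrC; apply: dvd_mull. Qed.

Lemma dvd_refl x : dvd x x.
Proof. by exists 1; rewrite mul1r. Qed.

Lemma dvd_sub x y z : dvd x (y + z) -> dvd x y -> dvd x z.
Proof.
move=> [c Hc] [d Hd]; case: (num_cases d c) => [[t E]|[E|[t E]]].
- by exists (t + 1); apply: (@num_addIl _ _ _ y); rewrite Hc {1}Hd E mulrDl.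
- by exists 0; apply: (@num_addIl _ _ _ y); rewrite Hc {1}Hd E mul0r addr0.
- exists 0; rewrite mul0r; apply: (@num_add_eq0 _ _ ((t + 1) * x)).
  apply: (@num_addIl _ _ _ (c * x)); rewrite addr0 -[RHS]Hc Hd E; ring.
Qed.

(** Decidability is read off from this bounded form. The cofactor [c] cannot exceed the multiple,
    because the modulus is at least 1. *)
Lemma fin_memE i s : sfin_mem L i s <-> sis_triple L s /\ i ≺ pr1 s /\
  exists c, c ≺ pr2 (pr2 s) + 1 /\
    pr2 (pr2 s) = c * (pr1 (pr2 s) * (i + 1) + 1).
Proof.
split=> [[k [m [n [-> [Hi [c Hc]]]]]]|[/is_tripleE E [Hi [c [_ Hc]]]]]; last first.
  by exists (pr1 s), (pr1 (pr2 s)), (pr2 (pr2 s)); split=> //; split=> //; exists c.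
rewrite /ntriple !pr2_npair !pr1_npair; split; first by exists k, m, n.
split=> //; exists c; split=> //.
apply: num_le_lt; rewrite Hc; apply/nu_le; rewrite !(nuD, nuM, nu1).
rewrite mulrDr mulr1 lerDr mulr_ge0 ?nu_ge0 // mulr_ge0 ?nu_ge0 //.
by rewrite ltW ?nu_den_gt0.
Qed.

Lemma fin_mem_triple i k m n :
  sfin_mem L i (ntriple k m n) <-> i ≺ k /\ dvd (m * (i + 1) + 1) n.
Proof.
split=> [[k' [m' [n' [E [Hi Hd]]]]]|[Hi Hd]]; last by exists k, m, n.
by have [-> /npair_inj [-> ->]] := npair_inj E.
Qed.

Lemma fin_mem_lt i s : sfin_mem L i s -> i ≺ s.
Proof.
by move=> [k [m [n [-> [Hi _]]]]]; apply: num_lt_le_trans Hi (npair_ge1 _ _).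
Qed.

Lemma Dc_fin_mem q (f g : ctx M q -> N) :
  Cf f -> Cf g -> Dc (fun v => sfin_mem L (f v) (g v)).
Proof.
move=> Hf Hg; apply: (@Dc_app2 M q (sfin_mem L)) => //.
apply: Dc_iff (fun v => fin_memE _ _) _; dc; apply: Dc_is_triple; dc.
Qed.

(* Divisibility of the modulus by all numbers below [k] makes the moduli
   [m * (i + 1) + 1] pairwise coprime in the following sense. *)
Lemma modulus_coprime k m n i j :
  (forall d, d ≺ k -> dvd (d + 1) m) -> i ≺ k -> j ≺ k -> i <> j ->
  dvd (m * (i + 1) + 1) (n * (m * (j + 1) + 1)) -> dvd (m * (i + 1) + 1) n.
Proof.
move=> Hm Hi Hj Hij; set a := m * (i + 1) + 1 => Ha.
(* [m] is a unit modulo [a], as [a] is 1 more than a multiple of [m]. *)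
have cancel x : dvd a (x * m) -> dvd a x.
  move=> Hx; apply: (@dvd_sub _ (x * m * (i + 1))); last exact: dvd_mulr.
  have -> : x * m * (i + 1) + x = x * a by rewrite /a; ring.
  exact/dvd_mull/dvd_refl.
(* The two moduli differ by [m * (z + 1)]; the factor [z + 1] divides [m] and can be cancelled along
   with it. *)
have key z : z ≺ k -> dvd a (n * m * (z + 1)) -> dvd a n.
  move=> /Hm [q Hq] Hz; apply: (cancel); rewrite Hq.
  have -> : n * (q * (z + 1)) = q * (n * (z + 1)) by ring.
  by apply: dvd_mull; apply: (cancel); have -> : n * (z + 1) * m = n * m * (z + 1) by ring.
case: (num_cases i j) => [[z E]|[//|[z E]]].
- apply: (key z); first nlin.
  apply: (@dvd_sub _ (n * a)); last exact/dvd_mull/dvd_refl.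
  by have -> : n * a + n * m * (z + 1) = n * (m * (j + 1) + 1) by rewrite /a E; ring.
- apply: (key z); first nlin.
  apply: (@dvd_sub _ (n * (m * (j + 1) + 1))) => //.
  have -> : n * (m * (j + 1) + 1) + n * m * (z + 1) = n * a by rewrite /a E; ring.
  exact/dvd_mull/dvd_refl.
Qed.

(** In effect [m + 1] is a factorial. It is obtained by induction because recursion rests on the
    finite sets that are built from it. *)
Lemma common_multiple k : exists m, forall d, d ≺ k -> dvd (d + 1) (m + 1).
Proof.
apply: (@Sg1_induction M (fun k => exists m, forall d, d ≺ k -> dvd (d + 1) (m + 1)))
  => [||{}k [m Hm]].
- apply: (@Sg1_ex M 1 (fun w => forall d, d ≺ w.1.2 -> dvd (d + 1) (w.2 + 1))).
  apply: (@Sg1_ball M 2 (fun w d => dvd (d + 1) (w.2 + 1))); first by dc.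
  apply: (@Sg1_ex M 3 (fun w => w.1.1.2 + 1 = w.2 * (w.1.2 + 1))).
  by apply: (proj1 (_ : Dc _)); dc.
- by exists 0 => d /num_lt0.
- exists (m * k + m + k) => d.
  have -> : m * k + m + k + 1 = (m + 1) * (k + 1) by ring.
  by case/num_ltS=> [/Hm|->]; [apply: dvd_mulr | apply/dvd_mull/dvd_refl].
Qed.

(** By induction on [j], a number [n] is built up as the product of the moduli of those elements of
    [B] that lie below [j] and [k]; coprimality keeps other moduli from dividing it. *)
Lemma finite_set (B : N -> Prop) k : Dc (fun w : ctx M 1 => B w.2) ->
  exists s, sis_triple L s /\ forall i, sfin_mem L i s <-> i ≺ k /\ B i.
Proof.
move=> HB; have [m0 Hm0] := common_multiple k; pose m := m0 + 1.
have Hm i j n := @modulus_coprime k m n i j Hm0.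
suff H j : exists n, forall i, i ≺ k -> (dvd (m * (i + 1) + 1) n <-> i ≺ j /\ B i).
  have [n Hn] := H k; exists (ntriple k m n); split; first by exists k, m, n.
  move=> i; rewrite fin_mem_triple; split=> [[Hi /Hn]|[Hi Bi]]; first by apply.
  by split=> //; apply/Hn.
apply: (@Sg1_induction M (fun j => exists n, forall i, i ≺ k ->
  (dvd (m * (i + 1) + 1) n <-> i ≺ j /\ B i))) j => [||j [n Hn]].
- have E i n : dvd (m * (i + 1) + 1) n <-> exists c, c ≺ n + 1 /\ n = c * (m * (i + 1) + 1).
    split=> [[c Hc]|[c []]]; exists c => //; split=> //; apply: num_le_lt; rewrite Hc.
    apply/nu_le; rewrite !(nuD, nuM, nu1) mulrDr mulr1 lerDr.
    by rewrite mulr_ge0 ?nu_ge0 // -?nuD -?nuM nu_ge0.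
  apply: (@Sg1_ex M 1 (fun w => forall i, i ≺ k ->
    (dvd (m * (i + 1) + 1) w.2 <-> i ≺ w.1.2 /\ B i))).
  apply: (proj1 (_ : Dc _)); dc.
    by apply: Dc_iff (fun v => E _ _) _; dc.
  by apply: (@Dc_app1 M _ B) => //; dc.
- exists 1 => i Hi; split=> [[c Hc]|[/num_lt0]] //; exfalso.
  case: (num_0_or_succ c) Hc => [->|[d ->]] Hc.
    by apply: (@m1_neq0 M); rewrite -[LHS]/(1 : N) Hc mul0r.
  move/(congr1 (@nu _)): Hc; rewrite /m !(nuD, nuM, nu1).
  have := nu_ge0 d; have := nu_ge0 m0; have := nu_ge0 i.
  move: (nu d) (nu m0) (nu i) => u v w Hw Hv Hu.
  have := mulr_ge0 Hv Hw; move: (v * w) => vw Hvw E.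
  have : (u + 1) * ((v + 1) * (w + 1) + 1) = 1 by [].
  have -> : (v + 1) * (w + 1) + 1 = 2 + (v + w + v * w) by ring.
  have := mulr_ge0 Hv Hw; move: (v * w) => z Hz; nra.
- case: (classic (j ≺ k /\ B j)) => [[Hj Bj]|Hn'].
    exists (n * (m * (j + 1) + 1)) => i Hi; split=> [H|[/num_ltS [Hij|->] Bi]].
    + case: (classic (i = j)) => [->|Hij]; first by split=> //; apply: num_lt_le.
      have [] := proj1 (Hn i Hi) (Hm _ _ _ Hi Hj Hij H).
      by move=> Hlt Bi; split=> //; nlin.
    + by apply: dvd_mulr; apply/Hn.
    + exact/dvd_mull/dvd_refl.
  exists n => i Hi; rewrite Hn //; split=> -[H Bi]; split=> //; first nlin.
  by case/num_ltS: H => // Ei; case: Hn'; rewrite -Ei.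
Qed.

Lemma finite_set_adjoin s p : exists t, sis_triple L t /\
  forall i, sfin_mem L i t <-> sfin_mem L i s \/ i = p.
Proof.
have [|t [Ht H]] := @finite_set (fun i => sfin_mem L i s \/ i = p) (s + p + 1).
  by dc; apply: Dc_fin_mem; dc.
exists t; split=> // i; rewrite H; split=> [[]|Hi] //; split=> //.
by case: Hi => [/fin_mem_lt Hi|->]; nlin.
Qed.

End FiniteSets.

Ltac dc_hook ::= lazymatch goal with
  | |- Cf (fun _ => npair _ _) => apply Cf_npair
  | |- Cf (fun _ => ntriple _ _ _) => apply Cf_ntriple
  | |- Cf (fun _ => pr1 _) => apply Cf_pr1
  | |- Cf (fun _ => pr2 _) => apply Cf_pr2
  | |- Dc (fun _ => sis_triple _ _) => apply Dc_is_triple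
  | |- Dc (fun _ => sfin_mem _ _ _) => apply Dc_fin_mem
  end.

(** * Primitive recursion *)

Section Recursion.
Variable M : rca_model.
Local Notation N := (num M).
Local Notation L := (std M).
Variables (a : N -> N) (g : N -> N -> N -> N).
Hypothesis Ca : Cf (fun w : ctx M 1 => a w.2).
Hypothesis Cg : Cf (fun w : ctx M 3 => g w.1.1.2 w.1.2 w.2).

(* [s] codes the graph of the recursion with parameter [p] up to [x], where its
   value is [y]. *)
Definition computation (p x s y : N) : Prop :=
  sfin_mem L (npair 0 (a p)) s /\
  (forall i, i ≺ x -> exists u, u ≺ s /\ (sfin_mem L (npair i u) s /\
     sfin_mem L (npair (i + 1) (g p i u)) s)) /\
  (forall i, i ≺ x + 1 -> forall u, u ≺ s -> forall u', u' ≺ s ->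
     sfin_mem L (npair i u) s -> sfin_mem L (npair i u') s -> u = u') /\
  sfin_mem L (npair x y) s.

Lemma Dc_computation n (f1 f2 f3 f4 : ctx M n -> N) : Cf f1 -> Cf f2 -> Cf f3 -> Cf f4 ->
  Dc (fun v => computation (f1 v) (f2 v) (f3 v) (f4 v)).
Proof.
apply: (@Dc_app4 M n computation).
rewrite /computation; dc; by [apply: (@Cf_app1 M _ a); dc | apply: (@Cf_app3 M _ g); dc].
Qed.

(** The second clause keeps [s] free of entries beyond [x], so the entry added for [x + 1] cannot
    clash with an older one. *)
Lemma computation_ex p x : exists s y, computation p x s y /\
  forall q, q ≺ s -> sfin_mem L q s -> pr1 q ≺ x + 1.
Proof.
apply: (@Sg1_induction M (fun x => exists s y, computation p x s y /\
  forall q, q ≺ s -> sfin_mem L q s -> pr1 q ≺ x + 1)) x => [||x [s [y [[H0 [HS [HF Hy]]] Hb]]]].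
- apply: (@Sg1_ex M 1 (fun w => exists y, computation p w.1.2 w.2 y /\
    forall q, q ≺ w.2 -> sfin_mem L q w.2 -> pr1 q ≺ w.1.2 + 1)).
  apply: (@Sg1_ex M 2 (fun w => computation p w.1.1.2 w.1.2 w.2 /\
    forall q, q ≺ w.1.2 -> sfin_mem L q w.1.2 -> pr1 q ≺ w.1.1.2 + 1)).
  by apply: (proj1 (_ : Dc _)); dc; apply: Dc_computation; dc.
- have [|s [_ Hs]] := @finite_set M (fun q => q = npair 0 (a p)) (npair 0 (a p) + 1); first by dc.
  have {}Hs q : sfin_mem L q s <-> q = npair 0 (a p).
    by rewrite Hs; split=> [[]|->] //; split=> //; apply: num_lt_le.
  exists s, (a p); split; last by move=> q _ /Hs ->; rewrite pr1_npair; apply: num_lt_le.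
  split; first exact/Hs.
  split; first by move=> i /num_lt0.
  split; last exact/Hs.
  by move=> i _ u _ u' _ /Hs /npair_inj [_ ->] /Hs /npair_inj [_ ->].
- have [t [_ Ht]] := finite_set_adjoin s (npair (x + 1) (g p x y)).
  have sub q : sfin_mem L q s -> sfin_mem L q t by move=> H; apply/Ht; left.
  have old i u : i ≺ x + 1 -> sfin_mem L (npair i u) t -> sfin_mem L (npair i u) s.
    by move=> Hi /Ht [//|/npair_inj [E _]]; rewrite E in Hi; case: (num_lt_irr Hi).
  have new u : sfin_mem L (npair (x + 1) u) t -> u = g p x y.
    move=> /Ht [H|/npair_inj [_ ->]] //.
    by have := Hb _ (fin_mem_lt H) H; rewrite pr1_npair => /num_lt_irr.
  exists t, (g p x y); split; last first.
    move=> q _ /Ht [H|->]; last by rewrite pr1_npair; apply: num_lt_le.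
    by have := Hb _ (fin_mem_lt H) H => H'; apply/num_ltS; left.
  split; first exact: sub.
  split.
    move=> i /num_ltS [Hi|->].
      have [u [_ [Hu Hu']]] := HS i Hi; exists u; split; last by split; apply: sub.
      exact: num_le_lt_trans (npair_ge2 i u) (fin_mem_lt (sub _ Hu)).
    exists y; split; last by split; [apply: sub | apply/Ht; right].
    exact: num_le_lt_trans (npair_ge2 x y) (fin_mem_lt (sub _ Hy)).
  split; last by apply/Ht; right.
  move=> i /num_ltS [Hi|->] u _ u' _ H H'; last by rewrite (new _ H) (new _ H').
  have {}H := old _ _ Hi H; have {}H' := old _ _ Hi H'.
  apply: (HF i Hi) => //; first exact: num_le_lt_trans (npair_ge2 i u) (fin_mem_lt H).
  exact: num_le_lt_trans (npair_ge2 i u') (fin_mem_lt H').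
Qed.

Lemma computation_fun p x s y i u u' : computation p x s y -> i ≼ x ->
  sfin_mem L (npair i u) s -> sfin_mem L (npair i u') s -> u = u'.
Proof.
move=> [_ [_ [HF _]]] /num_ltS Hi Hu Hu'.
apply: (HF i Hi) => //.
  exact: num_le_lt_trans (npair_ge2 i u) (fin_mem_lt Hu).
exact: num_le_lt_trans (npair_ge2 i u') (fin_mem_lt Hu').
Qed.

Lemma computation_uniq p x s y s' y' :
  computation p x s y -> computation p x s' y' -> y = y'.
Proof.
move=> H H'.
(* Inclusion of entries is a decidable statement about [i], hence fit for induction; [y = y'] then
   follows as [s'] is single-valued. *)
suff E i : i ≺ x + 1 -> forall u, u ≺ s -> sfin_mem L (npair i u) s -> sfin_mem L (npair i u) s'.
  have [_ [_ [_ Hy]]] := H; have [_ [_ [_ Hy']]] := H'.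
  have Hys := num_le_lt_trans (npair_ge2 x y) (fin_mem_lt Hy).
  apply: (computation_fun H' _ (E x (num_lt_le x) y Hys Hy) Hy'); by right.
apply: (@Sg1_induction M (fun i => i ≺ x + 1 -> forall u, u ≺ s ->
  sfin_mem L (npair i u) s -> sfin_mem L (npair i u) s')) i => [||i IH Hi u _ Hu].
- by apply: (proj1 (_ : Dc _)); dc.
- move=> _ u _ Hu; have [H0 _] := H; have [H0' _] := H'.
  by rewrite (computation_fun H _ Hu H0) //; case: (num_0_or_succ x) => [->|[z ->]]; [right|left; nlin].
- have Hix : i ≺ x by nlin.
  have Hix' : i ≼ x by left.
  have Hix1 : i + 1 ≼ x by apply/num_ltS.
  have [_ [HS _]] := H; have [_ [HS' _]] := H'.
  have [t [Hts [Ht Ht1]]] := HS i Hix; have [t' [_ [Ht' Ht1']]] := HS' i Hix.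
  have Ets' := IH (proj2 (num_ltS i x) Hix') t Hts Ht.
  rewrite (computation_fun H Hix1 Hu Ht1).
  by rewrite (computation_fun H' Hix' Ets' Ht').
Qed.

Definition primrec (p x : N) : N :=
  epsilon (inhabits 0) (fun y => exists s, computation p x s y).

Lemma primrecP p x y : y = primrec p x <-> exists s, computation p x s y.
Proof.
have [s [z [Hz _]]] := computation_ex p x.
have [|s' Hs'] := epsilon_spec (inhabits (0 : N)) (fun y => exists s, computation p x s y).
  by exists z, s.
split=> [->|[t Ht]]; first by exists s'.
exact: computation_uniq Ht Hs'.
Qed.

Lemma primrec0 p : primrec p 0 = a p.
Proof.
have /primrecP [s Hs] := erefl (primrec p 0).
have [H0 [_ [_ Hy]]] := Hs.
by apply: (computation_fun Hs _ Hy H0); right.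
Qed.

Lemma primrecS p x : primrec p (x + 1) = g p x (primrec p x).
Proof.
have /primrecP [s Hs] := erefl (primrec p (x + 1)).
have [H0 [HS [HF Hy]]] := Hs.
have [u [Hus [Hu Hu1]]] := HS x (num_lt_le x).
rewrite (computation_fun Hs _ Hy Hu1); last by right.
congr g; apply/primrecP; exists s; split=> //; split; last split=> //.
- by move=> i Hi; apply: HS; apply/num_ltS; left.
- by move=> i Hi; apply: HF; apply/num_ltS; left.
Qed.

Lemma Cf_primrec n (f h : ctx M n -> N) :
  Cf f -> Cf h -> Cf (fun v => primrec (f v) (h v)).
Proof.
apply: (@Cf_app2 M n primrec).
apply: (@Sg1_iff _ 3 _ (fun w => exists s, computation w.1.1.2 w.1.2 s w.2)).
  by move=> w; apply: primrecP.
apply: (@Sg1_ex M 3 (fun w => computation w.1.1.1.2 w.1.1.2 w.2 w.1.2)).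
by apply: (proj1 (_ : Dc _)); apply: Dc_computation; dc.
Qed.

End Recursion.

(** * Binary sequences *)

Section BinarySequences.
Variable M : rca_model.
Local Notation N := (num M).
Local Notation L := (std M).
Implicit Types x y z i j k l s t : N.

(** Elements are smaller than codes, so equality of the two sets need only be tested below [t + s].
    This makes it decidable, and a least code exists. *)
Lemma fin_set_ex s : sis_triple L s ->
  exists t, sfin_set L t /\ forall i, sfin_mem L i t <-> sfin_mem L i s.
Proof.
move=> Hs.
have E t : (forall i, i ≺ t + s -> (sfin_mem L i t <-> sfin_mem L i s)) <->
    forall i, sfin_mem L i t <-> sfin_mem L i s.
  split=> H i => [|_] //; split=> Hi; have Hlt := fin_mem_lt Hi; apply/H => //; nlin.
have [||t [[Ht Hts] Hmin]] := @least_number M (fun t => sis_triple L t /\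
    forall i, i ≺ t + s -> (sfin_mem L i t <-> sfin_mem L i s)).
- by apply: (proj2 (_ : Dc _)); dc.
- by exists s.
move/E in Hts; exists t; split=> //; split=> // t' Ht' Htr' H.
by apply: (Hmin t' Ht'); split=> //; apply/E => i; rewrite -Hts; apply: H.
Qed.

Definition bit s i : Prop := sfin_mem L (npair i 1) s.

Lemma bin_seq_mem s l x : sbin_seq L s l -> sfin_mem L x s <->
  exists i, i ≺ l /\ ((x = npair i 1 /\ bit s i) \/ (x = npair i 0 /\ ~ bit s i)).
Proof.
move=> [_ [H1 H2]]; split=> [Hx|[i [Hi [[->]|[->]]]]] //; last by move/(H2 i Hi).
have [i [b [Hi [Hb E]]]] := H1 x Hx; exists i; split=> //.
case: Hb E => -> E; [right | left]; split=> //; last by rewrite /bit -E.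
by apply/(H2 i Hi); rewrite -E.
Qed.

Lemma m1_neq_m0 : (1 : N) <> 0.
Proof. exact: m1_neq0. Qed.

Lemma bit_lt s l i : sbin_seq L s l -> bit s i -> i ≺ l.
Proof.
move=> Hs /(bin_seq_mem _ Hs) [j [Hj [[/npair_inj [-> _]]|[/npair_inj [_ /m1_neq_m0]]]]] //.
Qed.

(** The pair for the last position is an element, and elements are below the code. *)
Lemma bin_seq_len s l : sbin_seq L s l -> l ≼ s.
Proof.
move=> Hs; case: (num_0_or_succ l) => [->|[j E]].
  by apply/nu_le; rewrite nu0 nu_ge0.
have Hj : j ≺ l by rewrite E; apply: num_lt_le.
have [b Hb] : exists b, sfin_mem L (npair j b) s.
  case: (classic (bit s j)) => Hb; [exists 1 | exists 0] => //.
  by apply/(bin_seq_mem _ Hs); exists j; split=> //; right.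
by rewrite E; apply/num_ltS; have := num_le_lt_trans (npair_ge1 j b) (fin_mem_lt Hb); move=> H; nlin.
Qed.

Lemma bin_seq_ex (B : N -> Prop) l : Dc (fun w : ctx M 1 => B w.2) ->
  exists s, sbin_seq L s l /\ forall i, i ≺ l -> (bit s i <-> B i).
Proof.
move=> HB.
pose F x := x = npair (pr1 x) (pr2 x) /\ pr1 x ≺ l /\
  ((pr2 x = 1 /\ B (pr1 x)) \/ (pr2 x = 0 /\ ~ B (pr1 x))).
(* A pair of a position below [l] and a digit has a smaller sum than [l + 1], so it lies below
   [npair l 1]. *)
have [|s0 [Hs0 H0]] := @finite_set M F (npair l 1).
  by rewrite /F; dc; apply: (@Dc_app1 M _ B) => //; dc.
have [s [Hs H]] := fin_set_ex Hs0.
have {Hs0 s0 H0}H x : sfin_mem L x s <-> F x.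
  rewrite H H0; split=> [[]|Hx] //; split=> //.
  have [E [Hl Hb]] := Hx; rewrite E; apply: npair_lt.
  by case: Hb => -[-> _]; nlin.
have H1 i : i ≺ l -> (sfin_mem L (npair i 1) s <-> B i).
  move=> Hi; rewrite H /F pr1_npair pr2_npair; split=> [[_ [_ [[] //|[]]]]|Bi].
    by move/m1_neq_m0.
  by split=> //; split=> //; left.
have H2 i : i ≺ l -> (sfin_mem L (npair i 0) s <-> ~ B i).
  move=> Hi; rewrite H /F pr1_npair pr2_npair; split=> [[_ [_ [[E]|[]]]]|Bi] //.
    by case: m1_neq_m0.
  by split=> //; split=> //; right.
exists s; split; last exact: H1.
split=> //; split=> [x /H [E [Hl Hb]]|i Hi]; last by rewrite H2 // H1.
by exists (pr1 x), (pr2 x); split=> //; split=> //; case: Hb => -[-> _]; [right | left].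
Qed.

Lemma extends_bits s l t l' : sbin_seq L s l -> sbin_seq L t l' -> l ≼ l' ->
  (forall i, i ≺ l -> (bit s i <-> bit t i)) -> sextends L s t.
Proof.
move=> Hs Ht Hl H x /(bin_seq_mem _ Hs) [i [Hi Hx]]; apply/(bin_seq_mem _ Ht).
exists i; split; first exact: num_lt_le_trans Hi Hl.
by move: Hx; rewrite H.
Qed.

Lemma bits_extends s l t l' i : sbin_seq L s l -> sbin_seq L t l' -> sextends L s t ->
  i ≺ l -> (bit s i <-> bit t i).
Proof.
move=> Hs Ht H Hi; split=> [/H|Hb] //; apply: NNPP => Hn.
have Hs0 : sfin_mem L (npair i 0) s.
  by apply/(bin_seq_mem _ Hs); exists i; split=> //; right.
have /(bin_seq_mem _ Ht) [j [_ [[/npair_inj [_ /esym E] _]|[/npair_inj [<- _]]]]] // := H _ Hs0.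
by case: (m1_neq_m0 E).
Qed.

Lemma extends_len s l t l' : sbin_seq L s l -> sbin_seq L t l' -> sextends L s t -> l ≼ l'.
Proof.
move=> Hs Ht H; case: (num_0_or_succ l) => [->|[i E]].
  by apply/nu_le; rewrite nu0 nu_ge0.
have Hi : i ≺ l by rewrite E; apply: num_lt_le.
have [x [Hx Ex]] : exists x, sfin_mem L x s /\ pr1 x = i.
  case: (classic (bit s i)) => Hb; [exists (npair i 1) | exists (npair i 0)];
  rewrite pr1_npair; split=> //.
  by apply/(bin_seq_mem _ Hs); exists i; split=> //; right.
have [j [Hj Hx']] := proj1 (bin_seq_mem _ Ht) (H _ Hx).
rewrite E; have <- : j = i by case: Hx' Ex => -[-> _]; rewrite pr1_npair.
by apply/nu_le; nuhyp; rewrite nuD nu1.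
Qed.

Lemma fin_setE s : sfin_set L s <-> sis_triple L s /\ forall s', s' ≺ s ->
  sis_triple L s' -> ~ (forall i, i ≺ s -> (sfin_mem L i s' <-> sfin_mem L i s)).
Proof.
split=> -[H1 H2]; split=> // s' Hs' Hs't H; apply: (H2 s' Hs' Hs't) => i; last by move=> _; apply: H.
case: (classic (i ≺ s)) => [/H //|Hn]; split=> /fin_mem_lt Hi; case: Hn => //.
exact: num_lt_le_trans Hi (or_introl Hs').
Qed.

Lemma bin_seqE s l : sbin_seq L s l <-> sfin_set L s /\
  (forall x, x ≺ s -> sfin_mem L x s -> x = npair (pr1 x) (pr2 x) /\ pr1 x ≺ l /\
     (pr2 x = 0 \/ pr2 x = 1)) /\
  (forall i, i ≺ l -> (sfin_mem L (npair i 0) s <-> ~ sfin_mem L (npair i 1) s)).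
Proof.
split=> -[H1 [H2 H3]]; split=> //; split=> // x.
  by move=> _ /H2 [i [b [Hi [Hb ->]]]]; rewrite pr1_npair pr2_npair.
move=> Hx; have [E [Hi Hb]] := H2 x (fin_mem_lt Hx) Hx.
by exists (pr1 x), (pr2 x).
Qed.

Lemma Dc_bin_seq n (f g : ctx M n -> N) : Cf f -> Cf g ->
  Dc (fun v => sbin_seq L (f v) (g v)).
Proof.
apply: (@Dc_app2 M n (sbin_seq L)); apply: Dc_iff (fun v => bin_seqE _ _) _; dc.
- by apply: Dc_iff (fun v => fin_setE _) _; dc.
Qed.

Lemma Dc_in_bin n (f : ctx M n -> N) : Cf f -> Dc (fun v => sin_bin L (f v)).
Proof.
apply: (@Dc_app1 M n (sin_bin L)).
apply: (@Dc_iff _ 1 _ (fun v => exists l, l ≺ v.2 + 1 /\ sbin_seq L v.2 l)).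
  move=> v; split=> [[l Hl]|[l [_ Hl]]]; exists l => //; split=> //.
  exact/num_le_lt/bin_seq_len.
by dc; apply: Dc_bin_seq; dc.
Qed.

Lemma Dc_extends n (f g : ctx M n -> N) : Cf f -> Cf g ->
  Dc (fun v => sextends L (f v) (g v)).
Proof.
apply: (@Dc_app2 M n (sextends L)).
apply: (@Dc_iff _ 2 _ (fun v => forall x, x ≺ v.1.2 -> sfin_mem L x v.1.2 -> sfin_mem L x v.2)).
  by move=> v; split=> H x => [_|Hx]; [apply: H | apply: (H x (fin_mem_lt Hx))].
by dc.
Qed.

End BinarySequences.

(** * Rationals and reals *)

Section Rationals.
Variable M : rca_model.
Local Notation N := (num M).
Local Notation K := (ratio M).
Local Notation L := (std M).
Local Notation triple := (sis_triple L).
Local Notation is_rat := (sis_rat L).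
Implicit Types (p q s x y z i j k : N) (e : K).

Definition rval q : K := ratio_of (pr1 q) (pr1 (pr2 q)) (pr2 (pr2 q)).

Lemma rval_triple (m n d : N) : rval (ntriple m n d) = ratio_of m n d.
Proof. by rewrite /rval /ntriple pr1_npair !pr2_npair pr1_npair. Qed.

Lemma triple_ntriple (m n d : N) : triple (ntriple m n d).
Proof. by exists m, n, d. Qed.

Lemma ratio_le (m n d m' n' d' : N) : ratio_of m n d <= ratio_of m' n' d' <->
  m * (d' + 1) + n' * (d + 1) ≼ m' * (d + 1) + n * (d' + 1).
Proof.
rewrite !ratio_nu ler_pdivrMr ?nu_den_gt0 // mulrAC ler_pdivlMr ?nu_den_gt0 //.
by rewrite nu_le !(nuD, nuM, nu1); split=> H; lra.
Qed.

Lemma ratio_lt (m n d m' n' d' : N) : ratio_of m n d < ratio_of m' n' d' <->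
  m * (d' + 1) + n' * (d + 1) ≺ m' * (d + 1) + n * (d' + 1).
Proof.
rewrite ltNge; split=> [/negP|] H.
  by apply: NNPP => /nu_nlt /nu_le Hn; apply: H; apply/ratio_le.
apply/negP => /ratio_le Hn.
have {}Hn := num_le_lt_trans Hn H; exact: num_lt_irr Hn.
Qed.

Lemma rep_relE (R : N -> N -> Prop) (S : K -> K -> Prop) :
  (forall m n d m' n' d', S (ratio_of m n d) (ratio_of m' n' d') <->
    R (m * (d' + 1) + n' * (d + 1)) (m' * (d + 1) + n * (d' + 1))) ->
  forall p q, srep_rel L R p q <-> triple p /\ triple q /\ S (rval p) (rval q).
Proof.
move=> H p q; split=> [[m [n [d [m' [n' [d' [-> [-> HR]]]]]]]]|].
  by rewrite !rval_triple H; split; [|split]; try apply: triple_ntriple.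
move=> [[m [n [d ->]]] [[m' [n' [d' ->]]]]]; rewrite !rval_triple H => HR.
by exists m, n, d, m', n', d'.
Qed.

Lemma same_valueE p q : ssame_value L p q <-> triple p /\ triple q /\ rval p = rval q.
Proof. by apply: rep_relE => *; apply: ratio_eq. Qed.

Lemma rat_ltE p q : srat_lt L p q <-> triple p /\ triple q /\ rval p < rval q.
Proof. by apply: (rep_relE (S := fun u v => u < v)) => *; apply: ratio_lt. Qed.

Lemma rat_leE p q : srat_le L p q <-> triple p /\ triple q /\ rval p <= rval q.
Proof. by apply: (rep_relE (S := fun u v => u <= v)) => *; apply: ratio_le. Qed.

Lemma is_rat_triple q : is_rat q -> triple q.
Proof. by case. Qed.

Lemma is_rat_inj p q : is_rat p -> is_rat q -> rval p = rval q -> p = q.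
Proof.
move=> [Hp Hpm] [Hq Hqm] E.
case: (num_lt_total p q) => [/Hqm []|[//|/Hpm []]]; exact/same_valueE.
Qed.

Lemma Dc_ratio_eq n (f1 f2 f3 g1 g2 g3 : ctx M n -> N) :
  Cf f1 -> Cf f2 -> Cf f3 -> Cf g1 -> Cf g2 -> Cf g3 ->
  Dc (fun v => ratio_of (f1 v) (f2 v) (f3 v) = ratio_of (g1 v) (g2 v) (g3 v)).
Proof. by move=> *; apply: Dc_iff (fun v => ratio_eq _ _ _ _ _ _) _; dc. Qed.

Lemma is_rat_ex (u : K) : exists2 q, is_rat q & rval q = u.
Proof.
have [m [n [d ->]]] := ratioP u.
have [||q [[Hq E] Hmin]] := @least_number M (fun q => triple q /\ rval q = ratio_of m n d).
- by apply: (proj2 (_ : Dc _)); dc; apply: Dc_ratio_eq; dc.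
- by exists (ntriple m n d); rewrite rval_triple; split=> //; apply: triple_ntriple.
exists q => //; split=> // q' Hq' /same_valueE [Ht [_ E']].
by apply: (Hmin q' Hq'); rewrite -E.
Qed.

Lemma rval0 : rval (ntriple 0 0 0) = 0.
Proof. by rewrite rval_triple. Qed.

Lemma rat_posE q : srat_pos L q <-> is_rat q /\ 0 < rval q.
Proof.
split=> [[H /rat_ltE [_ [_]]]|[H H']]; first by rewrite rval0.
split=> //; apply/rat_ltE; rewrite rval0.
by split; [apply: triple_ntriple | split=> //; apply: is_rat_triple].
Qed.

Lemma rat_addE p q s : srat_add L p q s <->
  is_rat s /\ triple p /\ triple q /\ rval s = rval p + rval q.
Proof.
split=> [[Hs [m [n [d [m' [n' [d' [-> [-> /same_valueE [_ [_ E]]]]]]]]]]]|].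
  split=> //; do 2![split; first exact: triple_ntriple].
  by rewrite E !rval_triple -raddE.
move=> [Hs [[m [n [d ->]]] [[m' [n' [d' ->]]] E]]]; split=> //.
exists m, n, d, m', n', d'; split=> //; split=> //; apply/same_valueE.
split; first exact: is_rat_triple; split; first exact: triple_ntriple.
by rewrite E !rval_triple -raddE.
Qed.

Lemma rat_distE p q s : is_rat p -> is_rat q ->
  srat_dist L p q s <-> is_rat s /\ rval s = `|rval p - rval q|.
Proof.
move=> Hp Hq; split=> [[Hs [/rat_leE [_ [_]]]]|[Hs E]].
  rewrite rval0 => H0 [/rat_addE [_ [_ [_ E]]]|/rat_addE [_ [_ [_ E]]]]; split=> //.
    by rewrite E addrK ger0_norm.
  have -> : rval p - rval q = - rval s by rewrite E; ring.
  by rewrite normrN ger0_norm.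
have Ht := is_rat_triple; split=> //; split.
  by apply/rat_leE; rewrite rval0 E; split; [apply: triple_ntriple | split=> //; apply: Ht].
case: (ger0P (rval p - rval q)) E => _ E; [left | right]; apply/rat_addE;
  (split; [|split; [|split]]) => //; try exact: Ht; rewrite E; ring.
Qed.

End Rationals.

(** * Decidable comparisons between rational expressions *)

Section RatioFunctions.
Variables (M : rca_model) (n : nat).
Local Notation K := (ratio M).

(** Elements of [K] are classes and not numbers of the model, so computability of a function into
    [K] is stated for representatives. *)
Definition Kf (F : ctx M n -> K) : Prop :=
  exists f g h, [/\ Cf f, Cf g, Cf h & forall v, F v = ratio_of (f v) (g v) (h v)].

Lemma Kf_rval f : Cf f -> Kf (fun v => rval (f v)).
Proof.
move=> Hf; exists (fun v => pr1 (f v)), (fun v => pr1 (pr2 (f v))), (fun v => pr2 (pr2 (f v))).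
by split=> //; dc.
Qed.

Lemma Kf_const (c : K) : Kf (fun _ => c).
Proof.
have [a [b [d ->]]] := ratioP c.
by exists (fun _ => a), (fun _ => b), (fun _ => d); split=> //; dc.
Qed.

Lemma Kf_add F G : Kf F -> Kf G -> Kf (fun v => F v + G v).
Proof.
move=> [f [g [h [Hf Hg Hh HF]]]] [f' [g' [h' [Hf' Hg' Hh' HG]]]].
exists (fun v => f v * (h' v + 1) + f' v * (h v + 1)),
  (fun v => g v * (h' v + 1) + g' v * (h v + 1)),
  (fun v => h v * h' v + h v + h' v); split; try by dc.
by move=> v; rewrite HF HG -raddE.
Qed.

Lemma Kf_opp F : Kf F -> Kf (fun v => - F v).
Proof.
move=> [f [g [h [Hf Hg Hh HF]]]]; exists g, f, h; split=> // v.
by rewrite HF; apply: roppE.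
Qed.

Lemma Kf_inv f : Cf f -> Kf (fun v => (nu (f v) + 1)^-1).
Proof.
move=> Hf; exists (fun _ => 1), (fun _ => 0), f; split=> //; try by dc.
by move=> v; rewrite ratio_nu nu1 nu0 subr0 mul1r.
Qed.

Lemma Dc_ltK F G : Kf F -> Kf G -> Dc (fun v => F v < G v).
Proof.
move=> [f [g [h [Hf Hg Hh HF]]]] [f' [g' [h' [Hf' Hg' Hh' HG]]]].
apply: (@Dc_iff M n _ (fun v =>
  f v * (h' v + 1) + g' v * (h v + 1) ≺ f' v * (h v + 1) + g v * (h' v + 1))); last by dc.
by move=> v; rewrite HF HG; apply: ratio_lt.
Qed.

End RatioFunctions.

Ltac kf := repeat lazymatch goal with
  | |- Kf (fun _ => ?c) => apply Kf_const
  | |- Kf (fun _ => _ + _) => apply Kf_add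
  | |- Kf (fun _ => - _) => apply Kf_opp
  | |- Kf (fun _ => rval _) => apply Kf_rval
  | |- Kf (fun _ => (nu _ + 1)^-1) => apply Kf_inv
  end.

(** * Reals as Cauchy functions into the field of fractions *)

Section Reals.
Variable M : rca_model.
Local Notation N := (num M).
Local Notation K := (ratio M).
Local Notation L := (std M).
Local Notation "x ∈ X" := (@mmem M x X) (at level 70).
Implicit Types (p q s x y z i j k : N) (e : K) (X : sets M) (u : N -> K).

Definition cauchy u : Prop := forall e, 0 < e ->
  exists n0, forall m n, n0 ≼ m -> n0 ≼ n -> `|u m - u n| < e.

(** [u] is a plain Rocq function; its definability in the model resides in the set [X]. *)
Definition represents X u : Prop :=
  (forall z, z ∈ X -> exists n q, z = npair n q /\ sis_rat L q /\ rval q = u n) /\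
  (forall n, exists q, npair n q ∈ X).

Lemma represents_mem X u n q : represents X u ->
  npair n q ∈ X <-> sis_rat L q /\ rval q = u n.
Proof.
move=> [H1 H2]; have H m t : npair m t ∈ X -> sis_rat L t /\ rval t = u m.
  by move=> /H1 [m' [t' [/npair_inj [-> ->]]]].
split=> [/H //|[Hq E]].
have [q' Hq'] := H2 n; have [Hr' E'] := H _ _ Hq'.
by have -> : q = q' by apply: is_rat_inj => //; rewrite E E'.
Qed.

Lemma is_realE X : sis_real L X <-> exists u, represents X u /\ cauchy u.
Proof.
split=> [[H1 [H2 H3]]|[u [HX Hu]]].
  pose u n := rval (epsilon (inhabits (0 : N)) (fun q => npair n q ∈ X)).
  have Hu n q : npair n q ∈ X -> sis_rat L q /\ rval q = u n.
    move=> Hq; have [n' [q' [Hr /npair_inj [_ E]]]] := H1 _ Hq.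
    split; first by rewrite E.
    have [q0 [_ Hq0]] := H2 n; have := epsilon_spec (inhabits (0 : N)) (fun q => npair n q ∈ X).
    by rewrite /u (Hq0 q Hq) => H; rewrite (Hq0 _ (H (ex_intro _ q Hq))).
  have HX : represents X u.
    split=> [z Hz|n]; last by have [q [Hq _]] := H2 n; exists q.
    have [n [q [Hr E]]] := H1 z Hz; exists n, q; split=> //.
    by apply: Hu; rewrite -E.
  exists u; split=> // e He; have [t Ht Et] := is_rat_ex e.
  have [|n0 Hn0] := H3 t; first by apply/rat_posE; rewrite Et.
  exists n0 => m n Hm Hn.
  have [p Hp] := proj2 HX m; have [q Hq] := proj2 HX n.
  have [Hpr Ep] := Hu _ _ Hp; have [Hqr Eq] := Hu _ _ Hq.
  have [s Hs Es] := is_rat_ex `|rval p - rval q|.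
  have /rat_ltE [_ [_]] : srat_lt L s t.
    by apply: (Hn0 m n Hm Hn p q s Hp Hq); apply/rat_distE.
  by rewrite Es Et Ep Eq.
have Hmem n q := represents_mem n q HX.
split; last split.
- move=> z /(proj1 HX) [n [q [-> [Hq _]]]]; by exists n, q.
- move=> n; have [q Hq] := proj2 HX n; exists q; split=> // q'.
  move/Hmem: Hq => [Hq E] /Hmem [Hq' E']; apply: is_rat_inj => //; by rewrite E E'.
- move=> t /rat_posE [Ht /Hu [n0 Hn0]]; exists n0 => m n Hm Hn p q s.
  move=> /Hmem [Hp Ep] /Hmem [Hq Eq] /rat_distE [] // Hs Es.
  by apply/rat_ltE; split; [|split]; try exact: is_rat_triple; rewrite Es Ep Eq; apply: Hn0.
Qed.

Lemma num_max x y : exists z, x ≼ z /\ y ≼ z.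
Proof.
by case: (num_lt_total x y) => [H|[->|H]]; [exists y|exists y|exists x]; tauto.
Qed.

Lemma num_le_trans x y z : x ≼ y -> y ≼ z -> x ≼ z.
Proof. by move=> /nu_le H /nu_le H'; apply/nu_le; apply: le_trans H H'. Qed.

(** If no margin [e] worked, then arbitrarily small margins would be missed at indices where [u] is
    already nearly constant. The Cauchy property carries this to all late indices, which is the
    reverse inequality and hence equality. *)
Lemma in_ballE X u (a r : N) : represents X u -> cauchy u -> sis_rat L a -> sis_rat L r ->
  sin_ball L X a r <-> exists e, 0 < e /\ exists n0, forall n, n0 ≼ n -> `|rval a - u n| + e <= rval r.
Proof.
move=> HX Hu Ha Hr; have Hmem n q := represents_mem n q HX.
have Ht := @is_rat_triple M; have Hta := Ht _ Ha; have Htr := Ht _ Hr.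
have dist n s : sdist_seq L (sconst_seq a) (sset_seq X) n s <->
    sis_rat L s /\ rval s = `|rval a - u n|.
  split=> [[p [q [-> [/Hmem [Hq <-]]]]] /rat_distE|[Hs E]]; first exact.
  have [q Hq] := proj2 HX n; exists a, q; split=> //; split=> //.
  have [Hqr Eq] := proj1 (Hmem _ _) Hq.
  by apply/rat_distE => //; rewrite Eq.
have le1 : sreal_le L (sdist_seq L (sconst_seq a) (sset_seq X)) (sconst_seq r) <->
    forall e, 0 < e -> exists n0, forall n, n0 ≼ n -> `|rval a - u n| <= rval r + e.
  split=> H e He.
    have [t Htt Et] := is_rat_ex e; have [|n0 Hn0] := H t; first by apply/rat_posE; rewrite Et.
    exists n0 => n Hn; have [p Hp Ep] := is_rat_ex `|rval a - u n|.
    have [s Hs Es] := is_rat_ex (rval r + e).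
    have /rat_leE [_ [_]] : srat_le L p s.
      apply: (Hn0 n Hn p r s) => //; first exact/dist.
      by apply/rat_addE; rewrite Es Et; split=> //; split=> //; split=> //; apply: Ht.
    by rewrite Ep Es.
  move/rat_posE: He => [Her /H [n0 Hn0]]; exists n0 => n Hn p q s /dist [Hp Ep] -> /rat_addE [Hs [_ [_ Es]]].
  by apply/rat_leE; rewrite Ep Es; split; [|split]; try exact: Ht; apply: Hn0.
have le2 : sreal_le L (sconst_seq r) (sdist_seq L (sconst_seq a) (sset_seq X)) <->
    forall e, 0 < e -> exists n0, forall n, n0 ≼ n -> rval r <= `|rval a - u n| + e.
  split=> H e He.
    have [t Htt Et] := is_rat_ex e; have [|n0 Hn0] := H t; first by apply/rat_posE; rewrite Et.
    exists n0 => n Hn; have [p Hp Ep] := is_rat_ex `|rval a - u n|.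
    have [s Hs Es] := is_rat_ex (`|rval a - u n| + e).
    have /rat_leE [_ [_]] : srat_le L r s.
      apply: (Hn0 n Hn r p s) => //; first exact/dist.
      by apply/rat_addE; rewrite Es Et Ep; split=> //; split=> //; try split=> //; apply: Ht.
    by rewrite Es.
  move/rat_posE: He => [Her /H [n0 Hn0]]; exists n0 => n Hn p q s -> /dist [Hq Eq] /rat_addE [Hs [_ [_ Es]]].
  by apply/rat_leE; rewrite Es Eq; split; [|split]; try exact: Ht; apply: Hn0.
rewrite /sin_ball /sreal_lt /sreal_eq /= le1 le2; split=> [[H1 H2]|[e [He [n0 Hn0]]]].
  apply: NNPP => Hn; apply: H2; split=> // e He; apply: NNPP => Hn'; apply: Hn.
  have He2 : 0 < e / 2 by lra.
  have [n1 Hn1] := Hu _ He2; exists (e / 2); split=> //; exists n1 => m Hm.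
  apply: NNPP => /negP; rewrite -ltNge => Hlt; apply: Hn'; exists n1 => n Hnn.
  have := Hn1 m n Hm Hnn; have := ler_distD (u n) (rval a) (u m).
  rewrite (distrC (u n)); lra.
split=> [e' He'|[_ H]]; first by exists n0 => n /Hn0; lra.
have He2 : 0 < e / 2 by lra.
have [n1 Hn1] := H _ He2; have [n [Hn Hn']] := num_max n0 n1.
have := Hn0 n Hn; have := Hn1 n Hn'; lra.
Qed.

End Reals.

Section MoreDecidability.
Variables (M : rca_model) (n : nat).
Local Notation N := (num M).
Local Notation L := (std M).
Implicit Types f g : ctx M n -> N.

Lemma Dc_is_rat f : Cf f -> Dc (fun v => sis_rat L (f v)).
Proof.
apply: (@Dc_app1 M n (sis_rat L)).
apply: (@Dc_iff M 1 _ (fun v => sis_triple L v.2 /\ forall q, q ≺ v.2 ->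
  ~ (sis_triple L q /\ sis_triple L v.2 /\ rval q = rval v.2))).
  move=> v; split=> -[H1 H2]; split=> // q Hq; last by move/same_valueE; apply: H2.
  by move=> H; apply: (H2 q Hq); apply/same_valueE.
by dc; apply: Dc_ratio_eq; dc.
Qed.

Lemma Dc_bit f g : Cf f -> Cf g -> Dc (fun v => bit (f v) (g v)).
Proof. by move=> Hf Hg; rewrite /bit; dc. Qed.

Lemma Dc_initial_segment (G : sets M) f g : Cf f -> Cf g ->
  Dc (fun v => sinitial_segment L G (f v) (g v)).
Proof.
move=> Hf Hg; apply: (@Dc_app2 M n (sinitial_segment L G)) => //.
apply: (@Dc_iff M 2 _ (fun v => sbin_seq L v.2 v.1.2 /\ forall i, i ≺ v.1.2 ->
  (sfin_mem L (npair i 1) v.2 <-> @mmem M i G))) => //.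
by apply: Dc_and; [apply: Dc_bin_seq; dc | dc].
Qed.

End MoreDecidability.

Ltac dc_hook ::= lazymatch goal with
  | |- Cf (fun _ => npair _ _) => apply Cf_npair
  | |- Cf (fun _ => ntriple _ _ _) => apply Cf_ntriple
  | |- Cf (fun _ => pr1 _) => apply Cf_pr1
  | |- Cf (fun _ => pr2 _) => apply Cf_pr2
  | |- Dc (fun _ => is_true (_ < _)) => apply Dc_ltK; kf
  | |- Dc (fun _ => sis_triple _ _) => apply Dc_is_triple
  | |- Dc (fun _ => sfin_mem _ _ _) => apply Dc_fin_mem
  | |- Dc (fun _ => sis_rat _ _) => apply Dc_is_rat
  | |- Dc (fun _ => bit _ _) => apply Dc_bit
  | |- Dc (fun _ => sin_bin _ _) => apply Dc_in_bin
  | |- Dc (fun _ => sextends _ _ _) => apply Dc_extends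
  end.

Section Collection.
Variable M : rca_model.
Local Notation N := (num M).

(** This carries [collection] from bounded to Delta-0-1 relations, such as the refutation of a
    string by a stage. *)
Lemma Dc_collection (R : N -> N -> Prop) b : Dc (fun w : ctx M 2 => R w.1.2 w.2) ->
  (forall x, x ≺ b -> exists y, R x y) ->
  exists z, forall x, x ≺ b -> exists y, y ≺ z /\ R x y.
Proof.
move=> HR Hb.
suff H c : exists z, forall x, x ≺ c -> x ≺ b -> exists y, y ≺ z /\ R x y.
  by have [z Hz] := H b; exists z => x Hx; apply: Hz.
apply: (@Sg1_induction M (fun c => exists z, forall x, x ≺ c -> x ≺ b ->
  exists y, y ≺ z /\ R x y)) c => [||c [z Hz]].
- apply: (@Sg1_ex M 1 (fun w => forall x, x ≺ w.1.2 -> x ≺ b -> exists y, y ≺ w.2 /\ R x y)).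
  by apply: (proj1 (_ : Dc _)); dc; apply: (@Dc_app2 M _ R) => //; dc.
- by exists 0 => x /num_lt0.
- case: (classic (c ≺ b)) => [/Hb [y Hy]|Hc].
    exists (z + y + 1) => x /num_ltS [Hx Hxb|-> _]; last by exists y; split=> //; nlin.
    have [t [Ht HRt]] := Hz x Hx Hxb; exists t; split=> //; nlin.
  by exists z => x /num_ltS [|->] //; apply: Hz.
Qed.

Lemma mu_eq (Q : N -> Prop) x : Dc (fun w : ctx M 1 => Q w.2) ->
  Q x -> (forall y, y ≺ x -> ~ Q y) -> mu Q = x.
Proof.
move=> HQ Hx Hmin; have [|H1 H2] := muP HQ; first by exists x.
by case: (num_lt_total (mu Q) x) => [/Hmin|[|/H2]].
Qed.

End Collection.

(** * Generic sequences of binary strings *)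

Section LimitGeneric.
Variable M : rca_model.
Local Notation N := (num M).
Local Notation L := (std M).

(* Under [Pi01G] the strings can be taken to be the initial segments of one set;
   under [Sigma02] induction they only converge to one. *)
Definition limit_generic : Prop := forall X : sets M,
  (forall i s : N, sin_bin L s -> exists t, sin_D L X i t /\ sextends L s t) ->
  exists S : N -> N, Cf (fun w : ctx M 1 => S w.2) /\ (forall n, sin_bin L (S n)) /\
    forall i, exists t n0, sin_D L X i t /\ forall n, n0 ≼ n -> sextends L t (S n).

Lemma limit_generic_Pi01G : sPi01G L -> limit_generic.
Proof.
move=> H X /H [G HG].
have ex k : exists s, sinitial_segment L G k s.
  have [|s [Hs Hb]] := @bin_seq_ex M (fun i => @mmem M i G) k; first by dc.
  by exists s; split.
have Hmu k : sinitial_segment L G k (mu (sinitial_segment L G k)).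
  by have [] := @muP M (sinitial_segment L G k) _ (ex k) => //; apply: Dc_initial_segment; dc.
exists (fun n => mu (sinitial_segment L G n)); split.
  apply: (@Cf_mu M 1 (fun v => sinitial_segment L G v.2)); last by move=> v; apply: ex.
  by apply: Dc_initial_segment; dc.
split=> [n|i]; first by exists n; case: (Hmu n).
have [k [s [[Hs Hbs] HD]]] := HG i; exists s, k; split=> // n Hn.
have [Hm Hbm] := Hmu n; apply: (extends_bits Hs Hm Hn) => j Hj.
by rewrite /bit Hbs // Hbm //; apply: num_lt_le_trans Hj Hn.
Qed.

Section Approximation.
Variable X : sets M.
Hypothesis X_dense : forall i s : N, sin_bin L s ->
  exists t, sin_D L X i t /\ sextends L s t.
Variable e : N.
Hypothesis e_bin : sbin_seq L e 0.

(** The alternative [t = n] makes the search for the least candidate end by [n]; a result below [n]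
    is an extension of [s] not refuted at any [m] below [n]. *)
Definition candidate (n i s t : N) : Prop :=
  (sin_bin L t /\ sextends L s t /\ forall m, m ≺ n -> @mmem M (ntriple t i m) X) \/ t = n.

Definition improve (n i s : N) : N :=
  if boolp.asbool (mu (candidate n i s) ≺ n) then mu (candidate n i s) else s.

Lemma Dc_candidate k (f1 f2 f3 f4 : ctx M k -> N) : Cf f1 -> Cf f2 -> Cf f3 -> Cf f4 ->
  Dc (fun v => candidate (f1 v) (f2 v) (f3 v) (f4 v)).
Proof.
move=> H1 H2 H3 H4; apply: (@Dc_app4 M k candidate) => //.
by rewrite /candidate; dc.
Qed.

Lemma candidate_ex n i s : exists t, candidate n i s t.
Proof. by exists n; right. Qed.

Lemma Cf_improve : Cf (fun w : ctx M 3 => improve w.1.1.2 w.1.2 w.2).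
Proof.
have Hmu : Cf (fun w : ctx M 3 => mu (candidate w.1.1.2 w.1.2 w.2)).
  apply: (@Cf_mu M 3 (fun w => candidate w.1.1.2 w.1.2 w.2)).
    by apply: Dc_candidate; dc.
  by move=> w; apply: candidate_ex.
by rewrite /improve; dc.
Qed.

Lemma improveP n i s : sin_bin L s -> sin_bin L (improve n i s) /\ sextends L s (improve n i s).
Proof.
move=> Hs; rewrite /improve; case: boolp.asboolP => [Hlt|_]; last by split=> // x.
have [||[[Ht [Hst _]]|E] _] := @muP M (candidate n i s); last by rewrite E in Hlt; case: (num_lt_irr Hlt).
- by apply: Dc_candidate; dc.
- exact: candidate_ex.
- by [].
Qed.

Definition approx (n i : N) : N := primrec (fun _ => e) improve n i.

Lemma Cf_e : Cf (fun w : ctx M 1 => (fun _ : N => e) w.2).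
Proof. exact: Cf_const. Qed.

Lemma Cf_approx k (f g : ctx M k -> N) : Cf f -> Cf g -> Cf (fun v => approx (f v) (g v)).
Proof. exact: (Cf_primrec Cf_e Cf_improve). Qed.

Lemma approx0 n : approx n 0 = e.
Proof. exact: (primrec0 Cf_e Cf_improve). Qed.

Lemma approxS n i : approx n (i + 1) = improve n i (approx n i).
Proof. exact: (primrecS Cf_e Cf_improve). Qed.

Lemma approx_bin n i : sin_bin L (approx n i).
Proof.
apply: (@Sg1_induction M (fun i => sin_bin L (approx n i))) i => [||i].
- by apply: (proj1 (_ : Dc _)); dc; apply: Cf_approx; dc.
- by rewrite approx0; exists 0.
- by move=> H; rewrite approxS; have [] := improveP n i H.
Qed.

Lemma approx_mono n i j : i ≼ j -> sextends L (approx n i) (approx n j).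
Proof.
apply: (@Sg1_induction M (fun j => i ≼ j -> sextends L (approx n i) (approx n j))) j => [||j IH Hj].
- by apply: (proj1 (_ : Dc _)); dc; apply: Cf_approx; dc.
- by case=> [/num_lt0|->] // x.
- case: (classic (i = j + 1)) => [->|Hn]; first by move=> x.
  have {}Hj : i ≼ j by case: Hj => // /num_ltS.
  move=> x /(IH Hj); rewrite approxS; have [_] := improveP n j (approx_bin n j); exact.
Qed.

Definition stable (i t n0 : N) : Prop := forall n, n0 ≼ n -> approx n i = t.

(** Let [t] be the least extension of [s] in the [i]-th set. Every smaller number is refuted at some
    [m]; collection bounds these [m], and from then on the search passes over everything below
    [t]. *)
Lemma stable_step i s n0 : stable i s n0 ->
  exists t n1, sin_D L X i t /\ stable (i + 1) t n1.
Proof.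
move=> Hst.
have s_bin : sin_bin L s by rewrite -(Hst n0); [apply: approx_bin | right].
pose good t := sin_bin L t /\ sextends L s t /\ forall m, @mmem M (ntriple t i m) X.
have [||t [[Ht [Hest HX]] Hmin]] := @least_number M good.
- apply: (@Sg1_iff M 1 _ (fun v => exists m, ~ (sin_bin L v.2 /\ sextends L s v.2 /\
    @mmem M (ntriple v.2 i m) X))).
    move=> v; split=> [H|[m Hm] [H1 [H2 H3]]]; last by apply: Hm.
    apply: NNPP => Hn; apply: H; split; first by apply: NNPP => H1; apply: Hn; exists 0; tauto.
    split; first by apply: NNPP => H1; apply: Hn; exists 0; tauto.
    by move=> m; apply: NNPP => H1; apply: Hn; exists m; tauto.
  apply: (@Sg1_ex M 1 (fun w => ~ (sin_bin L w.1.2 /\ sextends L s w.1.2 /\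
    @mmem M (ntriple w.1.2 i w.2) X))).
  by apply: (proj1 (_ : Dc _)); dc.
- by have [t [[Ht HX] Hst']] := X_dense i s_bin; exists t; split.
have [||b Hb] := @Dc_collection M (fun t' m => ~ (sin_bin L t' /\ sextends L s t' /\
    @mmem M (ntriple t' i m) X)) t.
- by dc.
- move=> t' Ht'; apply: NNPP => Hn; apply: (Hmin t' Ht').
  have H m : sin_bin L t' /\ sextends L s t' /\ @mmem M (ntriple t' i m) X.
    by apply: NNPP => H; apply: Hn; exists m.
  by split; [case: (H 0) | split; [case: (H 0) => _ [] | move=> m; case: (H m) => _ []]].
(* From [n0] on step [i] yields [s], from [b] on all numbers below [t] are refuted, and beyond [t]
   the search, which stops at [n], reaches [t]. *)
exists t, (n0 + b + t + 1); split; first by split.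
move=> n Hn; rewrite approxS Hst; last nlin.
have E : mu (candidate n i s) = t.
  apply: mu_eq; first by apply: Dc_candidate; dc.
    by left; split=> //; split.
  move=> t' Ht' [[H1 [H2 H3]]|E]; last by rewrite E in Ht'; nlin.
  have [m [Hm Hnm]] := Hb t' Ht'; apply: Hnm; split=> //; split=> //; apply: H3; nlin.
by rewrite /improve E; case: boolp.asboolP => // H; case: H; nlin.
Qed.

(** String and stage are packed into one number [y], so that a single existential quantifier
    precedes the Pi-0-1 statement of stability. *)
Lemma stable_ex : models M ISigma02 -> forall i, exists t n0, stable i t n0.
Proof.
move=> HM i.
have [||x [y Hy]|y Hy] := @Sigma02_ind M (fun i y => stable i (pr1 y) (pr2 y)) HM _ _ _ i.
- apply: (@Sg1_iff M 2 _ (fun v => exists n, pr2 v.2 ≼ n /\ approx n v.1.2 <> pr1 v.2)).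
    move=> v; split=> [H|[n [Hn Hne]] H]; last exact/Hne/H.
    apply: NNPP => Hn; apply: H => n Hle; apply: NNPP => Hne; apply: Hn; by exists n.
  apply: (@Sg1_ex M 2 (fun w => pr2 w.1.2 ≼ w.2 /\ approx w.2 w.1.1.2 <> pr1 w.1.2)).
  by apply: (proj1 (_ : Dc _)); dc; apply: Cf_approx; dc.
- by exists (npair e 0) => n _; rewrite approx0 pr1_npair.
- have [t [n1 [_ Ht]]] := stable_step Hy.
  by exists (npair t n1); rewrite pr1_npair pr2_npair.
- by exists (pr1 y), (pr2 y).
Qed.

End Approximation.

Lemma limit_generic_ISigma02 : models M ISigma02 -> limit_generic.
Proof.
move=> HM X HX.
have [|e [He _]] := @bin_seq_ex M (fun _ => False) 0.
  by apply: Dc_D0; apply: D0_False.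
exists (fun n => approx X e n n); split; first by apply: Cf_approx; dc.
split=> [n|i]; first exact: approx_bin.
have [s [n0 Hs]] := stable_ex HX He HM i.
have [t [n1 [HD Ht]]] := stable_step HX He Hs.
(* From [n1] on, step [i + 1] yields [t]; from [i + 1] on, the diagonal string extends the outcome
   of that step. *)
exists t, (n1 + i + 1); split=> // n Hn; rewrite -(Ht n); last nlin.
by apply: approx_mono => //; nlin.
Qed.

End LimitGeneric.

(** * The Baire category theorem *)

Section Balls.
Variable M : rca_model.
Local Notation N := (num M).
Local Notation K := (ratio M).
Local Notation L := (std M).
Implicit Types (i j k l s t x y p q : N).

Definition center p : K := rval (pr1 p).
Definition radius p : K := rval (pr2 p).
Definition is_ball p : Prop := sis_rat L (pr1 p) /\ sis_rat L (pr2 p) /\ 0 < radius p.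
(** Negated strict inequalities without absolute values, so that decidability is automatic;
    [insideE] gives the metric form. *)
Definition inside p q : Prop :=
  ~ (radius q < center p - center q + radius p) /\
  ~ (radius q < center q - center p + radius p).

(* Strict inclusion, in a form that is visibly decidable. *)
Definition accepts p q : Prop :=
  is_ball q /\ center q - center p + radius q < radius p /\
  center p - center q + radius q < radius p.

Lemma insideE p q : inside p q <-> `|center p - center q| + radius p <= radius q.
Proof.
rewrite /inside; split=> [[/negP + /negP]|H].
  rewrite -!leNgt => H1 H2; case: (ger0P (center p - center q)) => _; lra.
by split; apply/negP; rewrite -leNgt; move: H; case: (ger0P (center p - center q)) => H0 H; lra.
Qed.

Lemma inside_refl p : inside p p.
Proof. by apply/insideE; rewrite subrr normr0 add0r. Qed.

Lemma inside_trans p q t : inside p q -> inside q t -> inside p t.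
Proof.
move=> /insideE H /insideE H'; apply/insideE.
have := ler_distD (center q) (center p) (center t); lra.
Qed.

Lemma accepts_inside p q : accepts p q -> inside q p.
Proof. by move=> [_ [H1 H2]]; split; apply/negP; rewrite -leNgt ltW. Qed.

Variable b0 : N.
Hypothesis b0_ball : is_ball b0.

(* A digit [1] at position [j] proposes the ball coded by the first component
   of [j]; it replaces the current ball if it lies strictly inside. *)
Definition next s j p : N :=
  if boolp.asbool (bit s j /\ accepts p (pr1 j)) then pr1 j else p.

Definition ball_at s j : N := primrec (fun _ => b0) next s j.

Lemma Cf_b0 : Cf (fun w : ctx M 1 => (fun _ : N => b0) w.2).
Proof. exact: Cf_const. Qed.

Lemma Dc_is_ball n (f : ctx M n -> N) : Cf f -> Dc (fun v => is_ball (f v)).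
Proof. by move=> Hf; rewrite /is_ball /radius; dc. Qed.

Lemma Dc_accepts n (f g : ctx M n -> N) : Cf f -> Cf g -> Dc (fun v => accepts (f v) (g v)).
Proof.
move=> Hf Hg; rewrite /accepts /center /radius; apply: Dc_and; first exact: Dc_is_ball.
by dc; kf; dc.
Qed.

Lemma Cf_next : Cf (fun w : ctx M 3 => next w.1.1.2 w.1.2 w.2).
Proof.
apply: Cf_if; [|dc|dc].
by apply: Dc_and; [dc | apply: Dc_accepts; dc].
Qed.

Lemma Cf_ball_at n (f g : ctx M n -> N) : Cf f -> Cf g -> Cf (fun v => ball_at (f v) (g v)).
Proof. exact: (Cf_primrec Cf_b0 Cf_next). Qed.

Lemma ball_at0 s : ball_at s 0 = b0.
Proof. exact: (primrec0 Cf_b0 Cf_next). Qed.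

Lemma ball_atS s j : ball_at s (j + 1) = next s j (ball_at s j).
Proof. exact: (primrecS Cf_b0 Cf_next). Qed.

Lemma ball_at_is_ball s j : is_ball (ball_at s j).
Proof.
apply: (@Sg1_induction M (fun j => is_ball (ball_at s j))) j => [||j IH].
- by apply: (proj1 (_ : Dc _)); apply: Dc_is_ball; apply: Cf_ball_at; dc.
- by rewrite ball_at0.
- by rewrite ball_atS /next; case: boolp.asboolP => // -[_ []].
Qed.

Lemma ball_at_mono s i j : i ≼ j -> inside (ball_at s j) (ball_at s i).
Proof.
apply: (@Sg1_induction M (fun j => i ≼ j -> inside (ball_at s j) (ball_at s i))) j => [||j IH Hj].
- have Cb (f g : ctx M 1 -> N) : Cf f -> Cf g -> Dc (fun v => inside (f v) (g v)).
    by move=> Hf Hg; rewrite /inside /center /radius; dc; kf; dc.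
  apply: (proj1 (_ : Dc _)); dc.
  by apply: Cb; apply: Cf_ball_at; dc.
- by case=> [/num_lt0|->] //; apply: inside_refl.
- case: (classic (i = j + 1)) => [->|Hn]; first exact: inside_refl.
  have {}Hj : i ≼ j by case: Hj => // /num_ltS.
  apply: inside_trans (IH Hj); rewrite ball_atS /next.
  by case: boolp.asboolP => [[_ /accepts_inside]|_] //; apply: inside_refl.
Qed.

Lemma ball_at_agree s t l : (forall i, i ≺ l -> (bit s i <-> bit t i)) ->
  ball_at s l = ball_at t l.
Proof.
move=> H; suff E k : k ≼ l -> ball_at s k = ball_at t k by apply: E; right.
move: k; apply: (@Sg1_induction M (fun k => k ≼ l -> ball_at s k = ball_at t k)) => [||k IH Hk].
- by apply: (proj1 (_ : Dc _)); dc; apply: Cf_ball_at; dc.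
- by rewrite !ball_at0.
- have Hkl : k ≺ l by apply: num_lt_le_trans (num_lt_le k) Hk.
  rewrite !ball_atS IH; last by left.
  rewrite /next.
  suff -> : (bit s k /\ accepts (ball_at t k) (pr1 k)) = (bit t k /\ accepts (ball_at t k) (pr1 k)) by [].
  by apply: propositional_extensionality; rewrite H.
Qed.

Lemma ball_at_const s l k : (forall i, l ≼ i -> ~ bit s i) -> l ≼ k ->
  ball_at s k = ball_at s l.
Proof.
move=> H; apply: (@Sg1_induction M (fun k => l ≼ k -> ball_at s k = ball_at s l)) k => [||k IH Hk].
- by apply: (proj1 (_ : Dc _)); dc; apply: Cf_ball_at; dc.
- by case=> [/num_lt0|->].
- case: (classic (l = k + 1)) => [->|Hn] //.
  have {}Hk : l ≼ k by case: Hk => // /num_ltS.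
  rewrite ball_atS /next; case: boolp.asboolP => [[/(H k Hk)]|_] //.
  exact: IH.
Qed.

(** The code of a string bounds its length, so [s] steps read all digits and the length need not be
    computed. *)
Definition ball s : N := ball_at s s.

Lemma bin_seq_no_bit s l i : sbin_seq L s l -> l ≼ i -> ~ bit s i.
Proof.
move=> Hs Hl /(bit_lt Hs) Hi; exact: num_lt_irr (num_lt_le_trans Hi Hl).
Qed.

Lemma ball_bin_seq s l : sbin_seq L s l -> ball s = ball_at s l.
Proof.
move=> Hs; apply: ball_at_const; last exact: bin_seq_len.
by move=> i; apply: bin_seq_no_bit.
Qed.

Lemma ball_extends s t : sin_bin L s -> sin_bin L t -> sextends L s t ->
  inside (ball t) (ball s).
Proof.
move=> [l Hs] [l' Ht] H; rewrite (ball_bin_seq Hs).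
rewrite (@ball_at_agree s t l); last by move=> i Hi; apply: (bits_extends Hs Ht).
apply: ball_at_mono; apply: num_le_trans (bin_seq_len Ht).
exact: extends_len Hs Ht H.
Qed.

(** A digit at position [npair p (c + l)] proposes [p]. The free second component places it beyond
    the digits of [s] and makes the code of [t] exceed [c], which [condition] requires of a
    witness. *)
Lemma ball_ex s p c : sin_bin L s -> accepts (ball s) p ->
  exists t, [/\ sin_bin L t, sextends L s t, ball t = p & c ≺ t].
Proof.
move=> [l Hs] Hp; pose j := npair p (c + l).
have Hlj : l ≼ j.
  by apply: num_le_trans (npair_ge2 _ _); apply/nu_le; rewrite nuD lerDr nu_ge0.
have Hcj : c ≼ j.
  by apply: num_le_trans (npair_ge2 _ _); apply/nu_le; rewrite nuD lerDl nu_ge0.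
have [|t [Ht Hb]] := @bin_seq_ex M (fun i => bit s i \/ i = j) (j + 1); first by dc.
have Hlen := bin_seq_len Ht.
have agree i : i ≺ j -> (bit s i <-> bit t i).
  move=> Hi; rewrite Hb; last by apply/num_ltS; left.
  by split=> [|[|E]] //; [left | rewrite E in Hi; case: (num_lt_irr Hi)].
exists t; split; first by exists (j + 1).
- apply: (extends_bits Hs Ht); first by apply: num_le_trans Hlj _; left; apply: num_lt_le.
  by move=> i Hi; apply/agree/(num_lt_le_trans Hi Hlj).
- rewrite (ball_bin_seq Ht) ball_atS -(ball_at_agree agree).
  rewrite (ball_at_const _ Hlj); last by move=> i; apply: bin_seq_no_bit.
  rewrite -(ball_bin_seq Hs) /next pr1_npair; case: boolp.asboolP => // -[].
  by split=> //; apply/Hb; [apply: num_lt_le | right].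
- by apply: num_le_lt_trans Hcj (num_lt_le_trans (num_lt_le j) Hlen).
Qed.

End Balls.

Section SmallNumbers.
Variable M : rca_model.
Local Notation N := (num M).
Local Notation K := (ratio M).

Lemma smaller_pos (a b : K) : 0 < a -> 0 < b -> exists v : K, [/\ 0 < v, v < a & v < b].
Proof.
by move=> Ha Hb; case: (lerP a b) => H; [exists (a / 2) | exists (b / 2)]; split; lra.
Qed.

Lemma inv_small (e : K) : 0 < e -> exists i : N, (nu i + 1)^-1 < e.
Proof.
move=> He; have [i Hi] := ratio_bound e^-1; exists i.
rewrite -[ltRHS]invrK ltf_pV2 ?posrE ?invr_gt0 ?nu_den_gt0 //.
by apply: le_lt_trans Hi _; rewrite ltrDl.
Qed.

End SmallNumbers.

(** * From a generic sequence to a point of the intersection *)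

Section Baire.
Variable M : rca_model.
Local Notation N := (num M).
Local Notation K := (ratio M).
Local Notation L := (std M).
Local Notation "x ∈ X" := (@mmem M x X) (at level 70).
Implicit Types (i j k l s t p q c : N).

(** Density yields a real that lies in both balls with some margin. It need not be rational, but a
    late enough term [q] of its sequence lies in both balls with a common margin [e]. *)
Lemma dense_ball (A : N -> Prop) (a r : N) : sdense L (fun x => sin_open L x A) ->
  sis_rat L a -> sis_rat L r -> 0 < rval r ->
  exists n0 b t, [/\ sis_rat L b, sis_rat L t, forall n, n0 ≼ n -> A (ntriple n b t) &
    exists q (e : K), [/\ sis_rat L q, 0 < e, `|rval a - rval q| + e <= rval r &
      `|rval b - rval q| + e <= rval t]].
Proof.
move=> HA Ha Hr Hr0.
(* [V] contains [ntriple n a r] for all [n] and nothing else, so it codes a single ball; its center,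
   as a constant sequence, shows that it is non-empty. *)
have [|V HV] := @comprehension M (fun z => z = ntriple (pr1 z) a r); first by dc.
have HVn n : ntriple n a r ∈ V by apply/HV; rewrite pr1_npair.
have [||y [Hy [[n1 [b [t [Hb [Ht [Hball Hin]]]]]] [n2 [a' [r' [_ [_ [Hball' Hin']]]]]]]]] := HA V.
- move=> z /HV ->; exists (pr1 z), a, r; split=> //; split=> //; exact/rat_posE.
- have [|X HX] := @comprehension M (fun z => z = npair (pr1 z) a); first by dc.
  have HXu : represents X (fun=> rval a).
    split=> [z /HX E|n]; first by exists (pr1 z), a.
    by exists a; apply/HX; rewrite pr1_npair.
  have HXc : cauchy (fun _ : N => rval a) by move=> e He; exists 0 => *; rewrite subrr normr0.
  exists X; split; first by apply/is_realE; exists (fun=> rval a).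
  exists 0, a, r; split=> //; split; first exact/rat_posE.
  split; last by move=> n _; apply: HVn.
  apply/(in_ballE HXu) => //; exists (rval r); split=> //; exists 0 => n _.
  by rewrite subrr normr0 add0r.
have E : ntriple n2 a' r' = ntriple (pr1 (ntriple n2 a' r')) a r by apply/HV/Hin'; right.
have [_ /npair_inj [Ea Er]] := npair_inj E; rewrite {}Ea {}Er in Hball'.
move/is_realE: Hy => [u [Hyu Hyc]].
move/(in_ballE Hyu Hyc Ha Hr): Hball' => [e1 [He1 [m1 Hm1]]].
move/rat_posE: Ht => [Ht _].
move/(in_ballE Hyu Hyc Hb Ht): Hball => [e2 [He2 [m2 Hm2]]].
have [m [Hm Hm']] := num_max m1 m2.
have [q Hq] := proj2 Hyu m; have [Hqr Eq] := proj1 (represents_mem m q Hyu) Hq.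
have [e [He H1 H2]] := smaller_pos He1 He2.
exists n1, b, t; split=> //; exists q, e; rewrite Eq; split=> //.
  by have := Hm1 m Hm; lra.
by have := Hm2 m Hm'; lra.
Qed.

Section Conditions.
Variables (W : sets M) (b0 : N).
Hypothesis b0_ball : is_ball b0.

(* [c = ntriple n b t] witnesses that the closed ball of [s] is contained in the
   [i]-th open set. *)
Definition captures i s c : Prop :=
  sis_rat L (pr1 (pr2 c)) /\ sis_rat L (pr2 (pr2 c)) /\
  radius (ball b0 s) < (nu i + 1)^-1 /\
  center (ball b0 s) - rval (pr1 (pr2 c)) + radius (ball b0 s) < rval (pr2 (pr2 c)) /\
  rval (pr1 (pr2 c)) - center (ball b0 s) + radius (ball b0 s) < rval (pr2 (pr2 c)).

Definition confirmed i c m : Prop :=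
  forall n, n ≺ m -> pr1 c ≼ n ->
  npair i (ntriple n (pr1 (pr2 c)) (pr2 (pr2 c))) ∈ W.

(** With [c] confined below [s] this is decidable, so quantifying over [m] gives a Pi-0-1 property
    of [s], at the price that [c] may depend on [m]. *)
Definition condition s i m : Prop :=
  exists c, c ≺ s /\ (captures i s c /\ confirmed i c m).

Lemma Dc_captures n (f g h : ctx M n -> N) : Cf f -> Cf g -> Cf h ->
  Dc (fun v => captures (f v) (g v) (h v)).
Proof.
move=> Hf Hg Hh; apply: (@Dc_app3 M n captures) => //.
rewrite /captures /center /radius /ball; dc; kf; dc; apply: (Cf_ball_at b0); dc.
Qed.

Lemma Dc_confirmed n (f g h : ctx M n -> N) : Cf f -> Cf g -> Cf h ->
  Dc (fun v => confirmed (f v) (g v) (h v)).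
Proof.
move=> Hf Hg Hh; apply: (@Dc_app3 M n confirmed) => //.
by rewrite /confirmed; dc.
Qed.

Lemma condition_set : exists X : sets M, forall s i m, ntriple s i m ∈ X <-> condition s i m.
Proof.
have [|X HX] := @comprehension M (fun z => condition (pr1 z) (pr1 (pr2 z)) (pr2 (pr2 z))).
  by rewrite /condition; dc; [apply: Dc_captures | apply: Dc_confirmed]; dc.
by exists X => s i m; rewrite HX /ntriple !pr2_npair !pr1_npair.
Qed.

(** If each candidate below [s] failed at some stage, collection would bound these stages by some
    [b]. As [confirmed] only grows stronger with [m], the witness for stage [b] would contradict its
    own failure. *)
Lemma condition_witness s i : (forall m, condition s i m) ->
  exists c, captures i s c /\ forall n, pr1 c ≼ n ->
    npair i (ntriple n (pr1 (pr2 c)) (pr2 (pr2 c))) ∈ W.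
Proof.
move=> H; apply: NNPP => Hn.
have [||b Hb] := @Dc_collection M (fun c m => ~ (captures i s c /\ confirmed i c m)) s.
- by dc; [apply: Dc_captures | apply: Dc_confirmed]; dc.
- move=> c _; apply: NNPP => Hc; apply: Hn; exists c.
  have {}Hc m : captures i s c /\ confirmed i c m by apply: NNPP => H'; apply: Hc; exists m.
  split; first by case: (Hc 0).
  by move=> n Hle; have [_] := Hc (n + 1); apply=> //; apply: num_lt_le.
- have [c [Hc [H1 H2]]] := H b; have [m [Hm]] := Hb c Hc; apply; split=> // n Hnm.
  by apply: H2; nlin.
Qed.

(** A ball around the rational point from [dense_ball], with radius below the margin there and below
    [1 / (i + 1)], lies strictly inside the ball of [s] and inside a ball of the [i]-th open set. *)
Lemma condition_dense i s :
  sdense L (fun x => sin_open L x (ssection W i)) -> sin_bin L s ->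
  exists t, [/\ sin_bin L t, sextends L s t & forall m, condition t i m].
Proof.
move=> Hd Hs; have [Ha [Hr Hr0]] : is_ball (ball b0 s) by apply: ball_at_is_ball.
have [n0 [b [t [Hb Ht Hin [q [e [Hq He H1 H2]]]]]]] := dense_ball Hd Ha Hr Hr0.
have Hi : 0 < (nu i + 1)^-1 by rewrite invr_gt0 nu_den_gt0.
have [v [Hv Hve Hvi]] := smaller_pos He Hi.
have [r' Hr' Er'] := is_rat_ex v.
pose c := ntriple n0 b t.
have Hacc : accepts (ball b0 s) (npair q r').
  rewrite /accepts /is_ball /center /radius !pr1_npair !pr2_npair Er'; split=> //.
  move: H1; rewrite -/(center _) -/(radius _); case: (ger0P (_ - rval q)) => H0 H1; split; lra.
have [t' [Ht' Hext Eb Hc]] := @ball_ex M b0 s (npair q r') c Hs Hacc.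
exists t'; split=> // m; exists c; split=> //.
rewrite /captures /confirmed Eb /c /ntriple !pr2_npair !pr1_npair /center /radius.
rewrite !pr1_npair !pr2_npair Er'; split; last by move=> n _ /Hin.
split=> //; split=> //; split=> //.
by move: H2; case: (ger0P (rval b - rval q)) => H0 H2; split; lra.
Qed.

End Conditions.

Lemma Baire_of_limit_generic : limit_generic M -> sBaire L.
Proof.
move=> HLG W Hcode Hdense V HV [x0 [_ [nV [a0 [r0 [Ha0 [/rat_posE [Hr0 Hr0p] [_ HVin]]]]]]]].
(* All centers stay in the closed starting ball; half the radius keeps the limit strictly inside the
   ball of radius [r0]. *)
have [r1 Hr1 Er1] := is_rat_ex (rval r0 / 2).
pose b0 := npair a0 r1.
have Hb0 : is_ball b0.
  by rewrite /is_ball /radius /b0 pr1_npair pr2_npair Er1; split=> //; split=> //; lra.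
have [X HX] := condition_set W b0.
have [|S [HS [HSbin Hgen]]] := HLG X.
  move=> i s Hs; have [t [Ht Hst Hc]] := condition_dense Hb0 (Hdense i) Hs.
  by exists t; split=> //; split=> // n; apply/HX.
pose y n := pr1 (ball b0 (S n)).
have HyC : Cf (fun w : ctx M 1 => y w.2).
  by rewrite /y /ball; dc; apply: (Cf_ball_at b0).
have [|Y HY] := @comprehension M (fun z => z = npair (pr1 z) (y (pr1 z))).
  by dc; apply: (@Cf_app1 M _ y) => //; dc.
pose u n := rval (y n).
have Hball n : is_ball (ball b0 (S n)) by apply: ball_at_is_ball.
have HYu : represents Y u.
  split=> [z /HY E|n]; last by exists (y n); apply/HY; rewrite pr1_npair.
  by exists (pr1 z), (y (pr1 z)); split=> //; split=> //; case: (Hball (pr1 z)).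
(* A string of the [i]-th set that is an initial segment of almost all [S n] traps almost all
   centers in its closed ball. *)
have near i : exists t c n0, [/\ captures b0 i t c,
    forall n, pr1 c ≼ n -> npair i (ntriple n (pr1 (pr2 c)) (pr2 (pr2 c))) ∈ W &
    forall n, n0 ≼ n -> `|u n - center (ball b0 t)| <= radius (ball b0 t)].
  have [t [n0 [[Ht HD] Hext]]] := Hgen i.
  have [|c [Hc Hin]] := @condition_witness W b0 t i; first by move=> m; apply/HX.
  exists t, c, n0; split=> // n /Hext He.
  have /insideE := ball_extends b0 Ht (HSbin n) He.
  have [_ [_ Hr]] := Hball n; rewrite -/(u n) /center -/(y n) -/(u n); lra.
have Hu : cauchy u.
  move=> e He; have [|i Hi] := @inv_small M (e / 2); first lra.
  have [t [c [n0 [[_ [_ [Hr _]]] _ Hn]]]] := near i.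
  exists n0 => m n /Hn H1 /Hn H2.
  apply: le_lt_trans (ler_distD (center (ball b0 t)) (u m) (u n)) _.
  by rewrite distrC in H2; lra.
exists Y; split; first by apply/is_realE; exists u.
split=> [i|].
  have [t [c [n0 [[Hb [Ht [_ [H1 H2]]]] Hin Hn]]]] := near i.
  exists (pr1 c), (pr1 (pr2 c)), (pr2 (pr2 c)); split=> //.
  have Hrad : 0 < radius (ball b0 t) by have [_ []] := ball_at_is_ball Hb0 t t.
  split; first by apply/rat_posE; split=> //; lra.
  split; last by move=> n; apply: Hin.
  apply/(in_ballE HYu) => //.
  (* This is the margin by which the closed ball of [t] stays inside the captured ball, positive
     because [captures] is strict. *)
  pose e := rval (pr2 (pr2 c)) - (`|rval (pr1 (pr2 c)) - center (ball b0 t)| + radius (ball b0 t)).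
  exists e; split.
    by rewrite /e; case: (ger0P (rval _ - _)) => H0; lra.
  exists n0 => n /Hn; rewrite distrC => H.
  have := ler_distD (center (ball b0 t)) (rval (pr1 (pr2 c))) (u n).
  by rewrite /e; lra.
exists nV, a0, r0; split=> //; split; first exact/rat_posE.
split=> //; apply/(in_ballE HYu) => //.
exists (rval r0 / 2); split; first lra.
exists 0 => n _.
have /insideE : inside (ball b0 (S n)) b0.
  rewrite -{2}(ball_at0 b0 (S n)); apply: ball_at_mono => //.
  by apply/nu_le; rewrite nu0 nu_ge0.
have [_ [_ Hr]] := Hball n.
rewrite {2}/center {2}/radius /b0 pr1_npair pr2_npair Er1 distrC -/b0 {1}/center -/(y n) -/(u n); lra.
Qed.

End Baire.

Lemma derivable_Baire T : (forall p, RCA0 p -> T p) ->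
  (forall M : rca_model, models M T -> limit_generic M) ->
  derivable T Baire_category_theorem.
Proof.
move=> HT H; apply: completeness => M HM rho sigma.
pose M' := RCAModel (sigma 0%N) (fun p Hp => HM p (HT p Hp)).
apply/(@sat_Baire M' rho sigma)/Baire_of_limit_generic; exact: (H M').
Qed.

Theorem proposition4p13 :
  derivable (extend RCA0 ISigma02) Baire_category_theorem /\
  derivable (extend RCA0 (eq Pi01G)) Baire_category_theorem.
Proof.
split; apply: derivable_Baire => [p|M HM]; try by left.
- by apply: limit_generic_ISigma02 => p Hp; apply: HM; right.
- apply: limit_generic_Pi01G.
  apply: (proj1 (@sat_Pi01G M (fun=> m0 M) (fun=> rca_set M))).
  by apply: HM; right.
Qed.
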